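(* For $a\in\mathcal{R}$ let $[a]=\{b\in\mathcal{R}\mid fb\in\mathcal{R}a\text{ for some }f\in\mathcal{M}\setminus\{0\}\}$. Then: (1) for every $a\in\mathcal{R}$, $[a]$ is a left ideal of $\mathcal{R}$; (2) for every left ideal $I$ of $\mathcal{R}$ there exists $a\in I$ with $\mathcal{R}a\subset I\subset[a]$; (3) for every $\phi\in H$ there exists $a\in\mathcal{R}$ with $\mathrm{ann}_{\mathcal{R}}(\phi)=[a]$.
   Context: Let $\mathrm{Hol}$ be the space of holomorphic functions on the upper half plane, $f'=\frac{1}{2\pi i}\frac{df}{dz}$, $E_2,E_4,E_6$ the Eisenstein series with constant term $1$, and $D_kf=f'-\frac{k}{12}E_2f$. Let $H=\bigoplus_{n\in\mathbb{R}}H_n$ with each $H_n$ a copy of $\mathrm{Hol}$, elements written $(f,n)$, with product $(f,n)(g,m)=(fg,n+m)$. Define $\delta(f,n)=(D_nf,n+2)$, $e_4(f,n)=(E_4f,n+4)$, $e_6(f,n)=(E_6f,n+6)$; $\mathcal{R}$ is the $\mathbb{C}$-algebra of linear operators on $H$ generated by $\delta,e_4,e_6$, and $H$ is a left $\mathcal{R}$-module. $\mathcal{M}=\mathbb{C}[E_4,E_6]$ (level-one holomorphic modular forms, not necessarily homogeneous elements) is identified with the subalgebra of $\mathcal{R}$ generated by $e_4,e_6$. $\mathrm{ann}_{\mathcal{R}}(\phi)=\{a\in\mathcal{R}\mid a\phi=0\}$. *)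

(* Defs.v *)
From Stdlib Require Import Reals List.
From Coquelicot Require Import Coquelicot.
Open Scope R_scope.

Definition UHP (z : C) : Prop := 0 < Im z.

Definition holo (f : C -> C) : Prop :=
  forall z : C, UHP z -> @ex_derive C_AbsRing C_NormedModule f z.

Definition cexp (z : C) : C := (exp (Re z) * cos (Im z), exp (Re z) * sin (Im z)).
Definition qpar (z : C) : C := cexp (Cmult (RtoC (2 * PI)) (Cmult Ci z)).

Definition sigma (k n : nat) : nat :=
  fold_right Nat.add 0%nat
    (map (fun d => if Nat.eqb (Nat.modulo n d) 0 then Nat.pow d k else 0%nat)
         (seq 1 n)).

Definition CSeries (a : nat -> C) : C :=
  (Series (fun n => Re (a n)), Series (fun n => Im (a n))).

(** Eisenstein series with constant term 1 (q-expansions):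
    E_k = 1 + c_k * sum_{n>=1} sigma_{k-1}(n) q^n, c_2=-24, c_4=240, c_6=-504. *)
Definition Eis (c : R) (k : nat) (z : C) : C :=
  Cplus (RtoC 1)
    (Cmult (RtoC c)
       (CSeries (fun n => Cmult (RtoC (INR (sigma (k - 1) n))) (Cpow (qpar z) n)))).
Definition E2 : C -> C := Eis (-24) 2.
Definition E4 : C -> C := Eis 240 4.
Definition E6 : C -> C := Eis (-504) 6.

Definition dprime (f : C -> C) (z : C) : C :=
  Cmult (Cinv (Cmult (RtoC (2 * PI)) Ci)) (C_derive f z).
Definition Dk (k : R) (f : C -> C) (z : C) : C :=
  Cminus (dprime f z) (Cmult (RtoC (k / 12)) (Cmult (E2 z) (f z))).

(** Graded functions: component n (n real) is a function on C, of which only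
    the values on the upper half plane matter. *)
Definition gfun : Type := R -> C -> C.

(** Membership in H = direct sum over n in R of Hol:
    finitely many nonzero components, each holomorphic on the upper half plane. *)
Definition inH (phi : gfun) : Prop :=
  (forall n, holo (phi n)) /\
  exists L : list R, forall n, ~ In n L -> forall z, UHP z -> phi n z = RtoC 0.

Definition Heq (phi psi : gfun) : Prop :=
  forall n z, UHP z -> phi n z = psi n z.
Definition zeroH : gfun := fun _ _ => RtoC 0.

Definition Op : Type := gfun -> gfun.

(** delta (f,n) = (D_n f, n+2);  e4 (f,n) = (E4 f, n+4);  e6 (f,n) = (E6 f, n+6). *)
Definition delta : Op := fun phi m z => Dk (m - 2) (phi (m - 2)) z.
Definition e4 : Op := fun phi m z => Cmult (E4 z) (phi (m - 4) z).
Definition e6 : Op := fun phi m z => Cmult (E6 z) (phi (m - 6) z).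
Definition scalOp (c : C) : Op := fun phi m z => Cmult c (phi m z).
Definition addOp (a b : Op) : Op := fun phi m z => Cplus (a phi m z) (b phi m z).
Definition mulOp (a b : Op) : Op := fun phi => a (b phi).
Definition zeroOp : Op := scalOp (RtoC 0).

Inductive inR : Op -> Prop :=
| inR_delta : inR delta
| inR_e4 : inR e4
| inR_e6 : inR e6
| inR_scal : forall c, inR (scalOp c)
| inR_add : forall a b, inR a -> inR b -> inR (addOp a b)
| inR_mul : forall a b, inR a -> inR b -> inR (mulOp a b).

Inductive inM : Op -> Prop :=
| inM_e4 : inM e4
| inM_e6 : inM e6
| inM_scal : forall c, inM (scalOp c)
| inM_add : forall a b, inM a -> inM b -> inM (addOp a b)
| inM_mul : forall a b, inM a -> inM b -> inM (mulOp a b).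

Definition eqOp (a b : Op) : Prop :=
  forall phi, inH phi -> Heq (a phi) (b phi).

Definition LeftIdeal (I : Op -> Prop) : Prop :=
  (forall a, I a -> inR a) /\
  (forall a b, I a -> inR b -> eqOp a b -> I b) /\
  I zeroOp /\
  (forall a b, I a -> I b -> I (addOp a b)) /\
  (forall r a, inR r -> I a -> I (mulOp r a)).

Definition bracket (a : Op) (b : Op) : Prop :=
  inR b /\
  exists f, inM f /\ ~ eqOp f zeroOp /\
    exists r, inR r /\ eqOp (mulOp f b) (mulOp r a).

Definition ann (phi : gfun) (b : Op) : Prop := inR b /\ Heq (b phi) zeroH.

(* Main.v *)
(** By Ramanujan's identities [D_4 E_4 = - E_6 / 3] and [D_6 E_6 = - E_4^2 / 2], [delta m = m delta + m']
    with [m'] in M for every [m] in M, so every element of R is a sum of [m_i delta^i] and left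
    pseudo-division by an element of order [n] works after multiplication by an element of M.
    This gives (1) (an Ore condition) and (2) (take a nonzero element of least order in [I]).
    For (3), M acts without torsion on H, because holomorphic functions on the half plane form a domain,
    so [[a]] annihilates [phi] as soon as [a] does.

    For an operator to map H into itself, the complex derivative of a holomorphic function must again
    be holomorphic, whence Goursat's lemma and Cauchy's formula, here on squares.
    Ramanujan's identities reduce to three convolution sums of divisor functions, obtained by sorting
    the solutions of [ax + by = n] in two ways.  *)

Require Import Defs.
From Stdlib Require Import Reals List.
From Coquelicot Require Import Coquelicot.
From Stdlib Require Import Lra Lia Psatz Permutation Classical ClassicalEpsilon Setoid Morphisms.
From mathcomp Require Import ssreflect ssrfun.
Import ListNotations.

(** * Complex differentiability *)

(** [holo] asks for a complex derivative at each point and says nothing about its continuity, so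
    Green's theorem is out of reach and all regularity of the derivative has to come from Goursat's
    lemma. The commutator of [delta] with M lies in M because [Dk] is affine in its weight:
    D_{n+k}(fg) = (D_n f) g + f (D_k g). Hence the commutator of [delta] with [e4] is multiplication
    by D_4 E_4, whatever the weight it is applied in, and Ramanujan's identities say that this
    function comes from M again. Elements of M need not be homogeneous, so that M acts on H by
    convolution over weights rather than by one product of functions; torsion-freeness therefore
    goes through the top weights. Pseudo-division uses only upper bounds for the order in
    [delta]. *)

Definition ccont (f : C -> C) (z : C) : Prop :=
  forall eps, 0 < eps -> exists d, 0 < d /\
    forall h, Cmod h < d -> Cmod (f (z + h)%C - f z)%C < eps.

(** The bound is not strict, so that [h = 0] satisfies it without a side condition. *)
Definition cder (f : C -> C) (z l : C) : Prop :=
  forall eps, 0 < eps -> exists d, 0 < d /\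
    forall h, Cmod h < d ->
      Cmod (f (z + h)%C - f z - h * l)%C <= eps * Cmod h.

Lemma Cmod_minus_sym (x y : C) : Cmod (x - y)%C = Cmod (y - x)%C.
Proof. rewrite -Cmod_opp; f_equal; ring. Qed.

Lemma Cmod_triangle_minus (x y : C) : Cmod (x - y)%C <= Cmod x + Cmod y.
Proof. rewrite -(Cmod_opp y); apply: Cmod_triangle. Qed.

Lemma Cmod_triangle_rev (x y : C) : Cmod x - Cmod y <= Cmod (x - y)%C.
Proof.
have := Cmod_triangle (x - y)%C y.
have -> : (x - y + y)%C = x by ring.
lra.
Qed.

Lemma Cmod_le_abs (z : C) : Cmod z <= Rabs (Re z) + Rabs (Im z).
Proof.
have -> : z = (RtoC (Re z) + Ci * RtoC (Im z))%C.
  by case: z => x y; rewrite /Ci /Cmult /Cplus /RtoC /=; f_equal; ring.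
apply: Rle_trans (Cmod_triangle _ _) _.
rewrite Cmod_mult Cmod_Ci !Cmod_R /= Rmult_1_l.
by apply: Req_le; f_equal; f_equal; ring.
Qed.

Lemma im_le_Cmod (z : C) : Rabs (Im z) <= Cmod z.
Proof. exact: Rle_trans (Rmax_r _ _) (Rmax_Cmod z). Qed.

Lemma Cplus_minus_l (z w : C) : (z + (w - z))%C = w.
Proof. ring. Qed.

Lemma is_derive_cder (f : C -> C) (z l : C) :
  @is_derive C_AbsRing C_NormedModule f z l <-> cder f z l.
Proof.
split.
- move=> [_ H] eps He.
  have := H z (fun P HP => HP) (mkposreal _ He) => /= -[d Hd].
  exists d; split; first exact: cond_pos.
  move=> h Hh.
  have B : ball (z : AbsRing_UniformSpace C_AbsRing) d (z + h)%C.
    change (Cmod ((z + h) - z)%C < d).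
    by have -> : (z + h - z)%C = h by ring.
  have := Hd _ B.
  change (Cmod ((f (z + h)%C - f z) - (z + h - z) * l)%C
     <= eps * Cmod ((z + h) - z)%C -> Cmod (f (z + h)%C - f z - h * l)%C <= eps * Cmod h).
  by have -> : (z + h - z)%C = h by ring.
- move=> H; split; first exact: is_linear_scal_l.
  move=> x Hx eps.
  have E : z = x :> C.
    exact: (@is_filter_lim_locally_unique C_AbsRing (AbsRing_NormedModule C_AbsRing)).
  rewrite -E.
  have [d [Hd D]] := H eps (cond_pos eps).
  exists (mkposreal d Hd) => y.
  change (Cmod (y - z)%C < d ->
    Cmod ((f y - f z) - (y - z) * l)%C <= eps * Cmod (y - z)%C).
  by move=> /D; rewrite Cplus_minus_l.
Qed.

Lemma cder_ex (f : C -> C) (z : C) :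
  @ex_derive C_AbsRing C_NormedModule f z <-> exists l, cder f z l.
Proof. by split=> -[l /is_derive_cder H]; exists l. Qed.

Lemma cder_C_derive (f : C -> C) (z l : C) : cder f z l -> C_derive f z = l.
Proof. by move=> /is_derive_cder /is_C_derive_unique. Qed.

Lemma ccont_ext_loc (f g : C -> C) (z : C) r : 0 < r ->
  (forall h, Cmod h < r -> f (z + h)%C = g (z + h)%C) -> ccont f z -> ccont g z.
Proof.
move=> Hr E H eps He; have [d [Hd D]] := H eps He.
exists (Rmin r d); split; first exact: Rmin_glb_lt.
move=> h Hh.
rewrite -E; last by apply: Rlt_le_trans Hh (Rmin_l _ _).
have -> : g z = f z.
  by have := E 0%C; rewrite Cmod_0 Cplus_0_r => ->.
by apply: D; apply: Rlt_le_trans Hh (Rmin_r _ _).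
Qed.

Lemma ccont_const (c z : C) : ccont (fun _ => c) z.
Proof.
move=> eps He; exists 1; split; first lra.
move=> h _; have -> : (c - c)%C = 0%C by ring.
by rewrite Cmod_0.
Qed.

Lemma ccont_id (z : C) : ccont (fun x => x) z.
Proof.
move=> eps He; exists eps; split=> // h Hh.
by have -> : (z + h - z)%C = h by ring.
Qed.

Lemma ccont_plus (f g : C -> C) (z : C) :
  ccont f z -> ccont g z -> ccont (fun x => f x + g x)%C z.
Proof.
move=> F G eps He.
have [|d [Hd D]] := F (eps/2); first lra.
have [|e [He' E]] := G (eps/2); first lra.
exists (Rmin d e); split; first exact: Rmin_glb_lt.
move=> h Hh.
have Hd' : Cmod h < d by apply: Rlt_le_trans Hh (Rmin_l _ _).
have He2 : Cmod h < e by apply: Rlt_le_trans Hh (Rmin_r _ _).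
have -> : (f (z + h) + g (z + h) - (f z + g z) = (f (z + h) - f z) + (g (z+h) - g z))%C by ring.
apply: Rle_lt_trans (Cmod_triangle _ _) _.
have := D _ Hd'; have := E _ He2; lra.
Qed.

Lemma ccont_mult (f g : C -> C) (z : C) :
  ccont f z -> ccont g z -> ccont (fun x => f x * g x)%C z.
Proof.
move=> F G eps He.
set A := Cmod (f z) + 1; set B := Cmod (g z) + 1.
have A0 : 0 < A by rewrite /A; have := Cmod_ge_0 (f z); lra.
have B0 : 0 < B by rewrite /B; have := Cmod_ge_0 (g z); lra.
have [|d [Hd D]] := F (Rmin 1 (eps / 2 / B)).
  by apply: Rmin_glb_lt; [lra | apply: Rdiv_lt_0_compat; lra].
have [|e [He' E]] := G (eps / 2 / A); first by apply: Rdiv_lt_0_compat; lra.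
exists (Rmin d e); split; first exact: Rmin_glb_lt.
move=> h Hh.
have Hd' : Cmod h < d by apply: Rlt_le_trans Hh (Rmin_l _ _).
have He2 : Cmod h < e by apply: Rlt_le_trans Hh (Rmin_r _ _).
have D1 := D _ Hd'; have E1 := E _ He2.
have D2 := Rlt_le_trans _ _ _ D1 (Rmin_l _ _).
have D3 := Rlt_le_trans _ _ _ D1 (Rmin_r _ _).
have -> : (f (z + h) * g (z + h) - (f z * g z) =
  f (z + h) * (g (z+h) - g z) + (f (z + h) - f z) * g z)%C by ring.
apply: Rle_lt_trans (Cmod_triangle _ _) _.
rewrite !Cmod_mult.
have FA : Cmod (f (z + h)%C) <= A.
  have := Cmod_triangle (f (z+h)%C - f z)%C (f z).
  have -> : (f (z+h) - f z + f z = f (z+h))%C by ring.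
  rewrite /A; lra.
have GB : Cmod (g z) <= B by rewrite /B; lra.
have H1 : Cmod (f (z + h)%C) * Cmod (g (z + h) - g z)%C <= A * Cmod (g (z + h) - g z)%C.
  by apply: Rmult_le_compat_r => //; apply: Cmod_ge_0.
have H2 : Cmod (f (z + h) - f z)%C * Cmod (g z) <= Cmod (f (z + h) - f z)%C * B.
  by apply: Rmult_le_compat_l => //; apply: Cmod_ge_0.
have H3 : A * Cmod (g (z + h) - g z)%C < eps / 2.
  have -> : eps / 2 = A * (eps / 2 / A) by field; lra.
  exact: Rmult_lt_compat_l.
have H4 : Cmod (f (z + h) - f z)%C * B < eps / 2.
  have -> : eps / 2 = (eps / 2 / B) * B by field; lra.
  exact: Rmult_lt_compat_r.
lra.
Qed.

Lemma ccont_opp (f : C -> C) (z : C) : ccont f z -> ccont (fun x => - f x)%C z.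
Proof.
move=> F; apply: (ccont_ext_loc (fun x => RtoC (-1) * f x)%C _ _ 1); first lra.
  by move=> h _; ring.
apply: ccont_mult => //; exact: ccont_const.
Qed.

Lemma ccont_minus (f g : C -> C) (z : C) :
  ccont f z -> ccont g z -> ccont (fun x => f x - g x)%C z.
Proof. by move=> F G; apply: ccont_plus => //; apply: ccont_opp. Qed.

Lemma ccont_inv (f : C -> C) (z : C) :
  ccont f z -> f z <> 0%C -> ccont (fun x => / f x)%C z.
Proof.
move=> F N eps He.
have P : 0 < Cmod (f z) by apply/Cmod_gt_0.
set m := Cmod (f z) in P *.
have [|d [Hd D]] := F (Rmin (m / 2) (eps * (m * m / 2))).
  apply: Rmin_glb_lt; first lra.
  apply: Rmult_lt_0_compat => //; nra.
exists d; split => // h Hh.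
have D1 := D _ Hh.
have D2 := Rlt_le_trans _ _ _ D1 (Rmin_l _ _).
have D3 := Rlt_le_trans _ _ _ D1 (Rmin_r _ _).
have L : m / 2 < Cmod (f (z + h)%C).
  have := Cmod_triangle_rev (f z) (f z - f (z+h))%C.
  have -> : (f z - (f z - f (z + h)))%C = f (z+h)%C by ring.
  rewrite (Cmod_minus_sym (f z)) -/m; lra.
have N' : f (z + h)%C <> 0%C by apply/Cmod_gt_0; lra.
have -> : (/ f (z + h) - / f z = (f z - f (z+h)) / (f (z+h) * f z))%C by field.
rewrite Cmod_div; last exact: Cmult_neq_0.
rewrite Cmod_mult Cmod_minus_sym -/m.
have Q : 0 < Cmod (f (z+h)%C) * m by apply: Rmult_lt_0_compat; lra.
apply: (Rmult_lt_reg_r (Cmod (f (z+h)%C) * m)) => //.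
rewrite /Rdiv Rmult_assoc Rinv_l; last lra.
rewrite Rmult_1_r; apply: Rlt_trans D3 _.
apply: Rmult_lt_compat_l => //.
nra.
Qed.

Lemma ccont_comp (f g : C -> C) (z : C) :
  ccont f z -> ccont g (f z) -> ccont (fun x => g (f x)) z.
Proof.
move=> F G eps He; have [d [Hd D]] := G eps He; have [e [He' E]] := F d Hd.
exists e; split=> // h /E /D.
by rewrite Cplus_minus_l.
Qed.

Lemma ccont_div (f g : C -> C) (z : C) :
  ccont f z -> ccont g z -> g z <> 0%C -> ccont (fun x => f x / g x)%C z.
Proof. by move=> F G N; apply: ccont_mult => //; apply: ccont_inv. Qed.

Lemma ccont_pow (f : C -> C) (z : C) n : ccont f z -> ccont (fun x => f x ^ n)%C z.
Proof.
move=> F; elim: n => [|n IH] /=; first exact: ccont_const.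
exact: ccont_mult.
Qed.

Lemma ccont_nonzero (f : C -> C) (z : C) : ccont f z -> f z <> 0%C ->
  exists d, 0 < d /\ forall h, Cmod h < d -> f (z + h)%C <> 0%C.
Proof.
move=> F /Cmod_gt_0 N; have [d [Hd D]] := F _ N.
exists d; split=> // h /D H E; move: H; rewrite E.
have -> : (0 - f z = - f z)%C by ring.
rewrite Cmod_opp; lra.
Qed.

(* Caratheodory's difference quotient: it reduces the calculus of [cder] to that of [ccont]. *)
Definition slope (f : C -> C) (z l h : C) : C :=
  match excluded_middle_informative (h = 0%C) with
  | left _ => l
  | right _ => ((f (z + h) - f z) / h)%C
  end.

Lemma slope_0 (f : C -> C) (z l : C) : slope f z l 0%C = l.
Proof. by rewrite /slope; case: excluded_middle_informative. Qed.

Lemma slope_neq (f : C -> C) (z l h : C) : h <> 0%C -> slope f z l h = ((f (z + h) - f z) / h)%C.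
Proof. by move=> N; rewrite /slope; case: excluded_middle_informative . Qed.

Lemma slope_spec (f : C -> C) (z l h : C) : (f (z + h) = f z + h * slope f z l h)%C.
Proof.
case: (excluded_middle_informative (h = RtoC 0)) => [->|N].
  by rewrite Cplus_0_r; ring.
by rewrite slope_neq //; field.
Qed.

Lemma cder_slope (f : C -> C) (z l : C) : cder f z l <-> ccont (slope f z l) 0%C.
Proof.
split.
- move=> H eps He.
  have [|d [Hd D]] := H (eps/2); first lra.
  exists d; split=> // h Hh.
  rewrite Cplus_0_l slope_0.
  case: (excluded_middle_informative (h = RtoC 0)) => [->|N].
    rewrite slope_0; have -> : (l - l = 0)%C by ring.
    by rewrite Cmod_0.
  have P : 0 < Cmod h by apply/Cmod_gt_0.
  have := D h Hh.
  have -> : (f (z + h) - f z - h * l = (slope f z l h - l) * h)%C.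
    by rewrite (slope_spec f z l h); ring.
  rewrite Cmod_mult => H1.
  have : Cmod (slope f z l h - l)%C <= eps / 2 by nra.
  lra.
- move=> H eps He.
  have [d [Hd D]] := H eps He.
  exists d; split=> // h Hh.
  have -> : (f (z + h) - f z - h * l = (slope f z l h - l) * h)%C.
    by rewrite (slope_spec f z l h); ring.
  rewrite Cmod_mult; apply: Rmult_le_compat_r; first exact: Cmod_ge_0.
  have := D h Hh; rewrite Cplus_0_l slope_0; lra.
Qed.

(** To differentiate, it is enough to exhibit a factor of the increment that is continuous at 0;
    away from 0 it has to be the difference quotient. *)
Lemma cder_factor (f : C -> C) (z l : C) (phi : C -> C) :
  ccont phi 0%C -> phi 0%C = l -> (forall h, f (z + h) = f z + h * phi h)%C ->
  cder f z l.
Proof.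
move=> P E H; apply/cder_slope.
apply: (ccont_ext_loc phi _ _ 1 _ _ P); first lra.
move=> h _; rewrite Cplus_0_l.
case: (excluded_middle_informative (h = RtoC 0)) => [->|N]; first by rewrite slope_0.
by rewrite slope_neq // H; field.
Qed.

Lemma ccont_shift (f : C -> C) (z : C) : ccont f z <-> ccont (fun h => f (z + h)%C) 0%C.
Proof.
split.
- move=> H; apply: (ccont_comp (fun h => z + h)%C f); last by rewrite Cplus_0_r.
  apply: ccont_plus; [exact: ccont_const | exact: ccont_id].
- move=> H eps He; have [d [Hd D]] := H eps He; exists d; split=> // h /D.
  by rewrite Cplus_0_l Cplus_0_r.
Qed.

Lemma cder_cont (f : C -> C) (z l : C) : cder f z l -> ccont f z.
Proof.
move=> /cder_slope H; apply/ccont_shift.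
apply: (ccont_ext_loc (fun h => f z + h * slope f z l h)%C _ _ 1); first lra.
  by move=> h _; rewrite -slope_spec.
apply: ccont_plus; first exact: ccont_const.
apply: ccont_mult => //; exact: ccont_id.
Qed.

Lemma cder_ext_loc (f g : C -> C) (z l : C) r : 0 < r ->
  (forall h, Cmod h < r -> f (z + h)%C = g (z + h)%C) -> cder f z l -> cder g z l.
Proof.
move=> Hr E H eps He; have [d [Hd D]] := H eps He.
exists (Rmin r d); split; first exact: Rmin_glb_lt.
move=> h Hh.
rewrite -E; last by apply: Rlt_le_trans Hh (Rmin_l _ _).
have -> : g z = f z.
  by have := E 0%C; rewrite Cmod_0 Cplus_0_r => ->.
by apply: D; apply: Rlt_le_trans Hh (Rmin_r _ _).
Qed.

Lemma cder_const (c z : C) : cder (fun _ => c) z 0%C.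
Proof.
apply: (cder_factor _ _ _ (fun _ => 0%C)) => //; first exact: ccont_const.
by move=> h; ring.
Qed.

Lemma cder_id (z : C) : cder (fun x => x) z 1%C.
Proof.
apply: (cder_factor _ _ _ (fun _ => 1%C)) => //; first exact: ccont_const.
by move=> h; ring.
Qed.

Lemma cder_plus (f g : C -> C) (z l m : C) :
  cder f z l -> cder g z m -> cder (fun x => f x + g x)%C z (l + m)%C.
Proof.
move=> /cder_slope F /cder_slope G.
apply: (cder_factor _ _ _ (fun h => slope f z l h + slope g z m h)%C).
- exact: ccont_plus.
- by rewrite !slope_0.
- by move=> h; rewrite (slope_spec f z l) (slope_spec g z m); ring.
Qed.

Lemma cder_mult (f g : C -> C) (z l m : C) :
  cder f z l -> cder g z m -> cder (fun x => f x * g x)%C z (l * g z + f z * m)%C.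
Proof.
move=> F' G'; have /ccont_shift Gc := cder_cont _ _ _ G'.
move: F' G' => /cder_slope F /cder_slope G.
apply: (cder_factor _ _ _ (fun h => slope f z l h * g (z + h) + f z * slope g z m h)%C).
- apply: ccont_plus; first exact: ccont_mult.
  apply: ccont_mult => //; exact: ccont_const.
- by rewrite !slope_0 Cplus_0_r.
- by move=> h; rewrite (slope_spec f z l) (slope_spec g z m); ring.
Qed.

Lemma cder_scal (c : C) (f : C -> C) (z l : C) : cder f z l -> cder (fun x => c * f x)%C z (c * l)%C.
Proof.
move=> F; have := cder_mult _ _ _ _ _ (cder_const c z) F.
by have -> : (0 * f z + c * l = c * l)%C by ring.
Qed.

Lemma cder_opp (f : C -> C) (z l : C) : cder f z l -> cder (fun x => - f x)%C z (- l)%C.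
Proof.
move=> /(cder_scal (RtoC (-1))) H.
have -> : (- l = -1 * l)%C by ring.
apply: (cder_ext_loc _ _ _ _ 1 _ _ H); first lra.
by move=> h _; ring.
Qed.

Lemma cder_minus (f g : C -> C) (z l m : C) :
  cder f z l -> cder g z m -> cder (fun x => f x - g x)%C z (l - m)%C.
Proof. by move=> F G; apply: cder_plus => //; apply: cder_opp. Qed.

Lemma cder_comp (f g : C -> C) (z l m : C) :
  cder f z l -> cder g (f z) m -> cder (fun x => g (f x)) z (l * m)%C.
Proof.
move=> /cder_slope F /cder_slope G.
apply: (cder_factor _ _ _ (fun h => slope f z l h * slope g (f z) m (h * slope f z l h))%C).
- apply: ccont_mult => //.
  apply: (ccont_comp (fun h => h * slope f z l h)%C).
    apply: ccont_mult => //; exact: ccont_id.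
  by rewrite Cmult_0_l.
- by rewrite Cmult_0_l !slope_0.
- by move=> h; rewrite (slope_spec f z l) (slope_spec g (f z) m); ring.
Qed.

Lemma cder_inv (z : C) : z <> 0%C -> cder (fun x => / x)%C z (- / (z * z))%C.
Proof.
move=> N.
have [d [Hd D]] := ccont_nonzero _ z (ccont_id z) N.
apply/cder_slope.
apply: (ccont_ext_loc (fun h => - / ((z + h) * z))%C _ _ d) => //.
- move=> h Hh; rewrite Cplus_0_l.
  case: (excluded_middle_informative (h = RtoC 0)) => [->|Nh].
    by rewrite slope_0 Cplus_0_r.
  rewrite slope_neq //; have H1 := D h Hh; field; by [].
- apply: ccont_opp; apply: ccont_inv.
    apply: ccont_mult; last exact: ccont_const.
    apply: ccont_plus; [exact: ccont_const | exact: ccont_id].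
  by rewrite Cplus_0_r; apply: Cmult_neq_0.
Qed.

Lemma cder_div (f g : C -> C) (z l m : C) : cder f z l -> cder g z m -> g z <> 0%C ->
  cder (fun x => f x / g x)%C z ((l * g z - f z * m) / (g z * g z))%C.
Proof.
move=> F G N.
have H := cder_mult _ _ _ _ _ F (cder_comp _ _ _ _ _ G (cder_inv _ N)).
have -> : ((l * g z - f z * m) / (g z * g z) = l * / g z + f z * (m * - / (g z * g z)))%C.
  by field.
exact: H.
Qed.

Lemma cder_shift (f : C -> C) (z w l : C) : cder f (z + w)%C l <-> cder (fun h => f (z + h)%C) w l.
Proof.
split=> H eps He; have [d [Hd D]] := H eps He; exists d; split=> // h /D;
 by rewrite Cplus_assoc.
Qed.

(** * Integrals over the boundary of a rectangle *)

Definition isI (f : R -> C) (a b : R) (l : C) : Prop := @is_RInt C_R_NormedModule f a b l.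
Definition exI (f : R -> C) (a b : R) : Prop := @ex_RInt C_R_NormedModule f a b.
Definition CI (f : R -> C) (a b : R) : C := @RInt C_R_CompleteNormedModule f a b.

Lemma CI_correct (f : R -> C) (a b : R) : exI f a b -> isI f a b (CI f a b).
Proof. exact: (@RInt_correct C_R_CompleteNormedModule). Qed.

Lemma isI_unique (f : R -> C) (a b : R) (l : C) : isI f a b l -> CI f a b = l.
Proof. exact: (@is_RInt_unique C_R_CompleteNormedModule). Qed.

Lemma CI_ext (f g : R -> C) (a b : R) :
  (forall x, Rmin a b < x < Rmax a b -> f x = g x) -> CI f a b = CI g a b.
Proof. exact: (@RInt_ext C_R_CompleteNormedModule). Qed.

Lemma isI_plus (f g : R -> C) (a b : R) (l m : C) :
  isI f a b l -> isI g a b m -> isI (fun x => f x + g x)%C a b (l + m)%C.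
Proof. exact: (@is_RInt_plus C_R_NormedModule). Qed.

Lemma isI_pair (f : R -> C) (a b : R) (l : C) :
  is_RInt (fun x => Re (f x)) a b (Re l) -> is_RInt (fun x => Im (f x)) a b (Im l) ->
  isI f a b l.
Proof.
case: l => l1 l2 H1 H2.
exact: (@is_RInt_fct_extend_pair R_NormedModule R_NormedModule).
Qed.

Lemma isI_Re (f : R -> C) (a b : R) (l : C) :
  isI f a b l -> is_RInt (fun x => Re (f x)) a b (Re l).
Proof. exact: (@is_RInt_fct_extend_fst R_NormedModule R_NormedModule). Qed.

Lemma isI_Im (f : R -> C) (a b : R) (l : C) :
  isI f a b l -> is_RInt (fun x => Im (f x)) a b (Im l).
Proof. exact: (@is_RInt_fct_extend_snd R_NormedModule R_NormedModule). Qed.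

(** The integrals take values in C as a module over the reals, so a complex factor has to pass
    through real and imaginary parts. *)
Lemma isI_scal (c : C) (f : R -> C) (a b : R) (l : C) :
  isI f a b l -> isI (fun x => c * f x)%C a b (c * l)%C.
Proof.
move=> H; have H1 := isI_Re _ _ _ _ H; have H2 := isI_Im _ _ _ _ H.
apply: isI_pair.
- exact: (is_RInt_minus _ _ _ _ _ _ (is_RInt_scal _ _ _ (Re c) _ H1) (is_RInt_scal _ _ _ (Im c) _ H2)).
- exact: (is_RInt_plus _ _ _ _ _ _ (is_RInt_scal _ _ _ (Re c) _ H2) (is_RInt_scal _ _ _ (Im c) _ H1)).
Qed.

Lemma exI_plus (f g : R -> C) (a b : R) :
  exI f a b -> exI g a b -> exI (fun x => f x + g x)%C a b.
Proof. by move=> [l F] [m G]; exists (l + m)%C; apply: isI_plus. Qed.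

Lemma exI_scal (c : C) (f : R -> C) (a b : R) :
  exI f a b -> exI (fun x => c * f x)%C a b.
Proof. by move=> [l F]; exists (c * l)%C; apply: isI_scal. Qed.

Lemma isI_minus (f g : R -> C) (a b : R) (l m : C) :
  isI f a b l -> isI g a b m -> isI (fun x => f x - g x)%C a b (l - m)%C.
Proof. exact: (@is_RInt_minus C_R_NormedModule). Qed.

Lemma exI_minus (f g : R -> C) (a b : R) :
  exI f a b -> exI g a b -> exI (fun x => f x - g x)%C a b.
Proof. by move=> [l F] [m G]; exists (l - m)%C; apply: isI_minus. Qed.

Lemma CI_plus (f g : R -> C) (a b : R) : exI f a b -> exI g a b ->
  CI (fun x => f x + g x)%C a b = (CI f a b + CI g a b)%C.
Proof. by move=> F G; apply: isI_unique; apply: isI_plus; apply: CI_correct. Qed.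

Lemma CI_minus (f g : R -> C) (a b : R) : exI f a b -> exI g a b ->
  CI (fun x => f x - g x)%C a b = (CI f a b - CI g a b)%C.
Proof. by move=> F G; apply: isI_unique; apply: isI_minus; apply: CI_correct. Qed.

Lemma CI_scal (c : C) (f : R -> C) (a b : R) : exI f a b ->
  CI (fun x => c * f x)%C a b = (c * CI f a b)%C.
Proof. by move=> F; apply: isI_unique; apply: isI_scal; apply: CI_correct. Qed.

Lemma CI_const (c : C) (a b : R) : CI (fun _ => c) a b = (RtoC (b - a) * c)%C.
Proof.
rewrite /CI RInt_const /scal /= /prod_scal /scal /= /mult /=.
by case: c => x y; rewrite /Cmult /=; f_equal; ring.
Qed.

Lemma CI_chasles (f : R -> C) (a b c : R) : exI f a b -> exI f b c ->
  (CI f a b + CI f b c)%C = CI f a c.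
Proof. exact: (@RInt_Chasles C_R_CompleteNormedModule). Qed.

Lemma CI_swap (f : R -> C) (a b : R) : exI f a b -> (- CI f a b)%C = CI f b a.
Proof. exact: (@opp_RInt_swap C_R_CompleteNormedModule). Qed.

Lemma CI_bound (f : R -> C) (a b M : R) : a <= b -> exI f a b ->
  (forall x, a <= x <= b -> Cmod (f x) <= M) -> Cmod (CI f a b) <= (b - a) * M.
Proof.
move=> L E B.
have := @norm_RInt_le_const C_R_NormedModule f a b (CI f a b) M L _ (CI_correct _ _ _ E).
rewrite -Cmod_norm; apply => x /B; by rewrite Cmod_norm.
Qed.

Lemma exI_continuous (f : R -> C) (a b : R) :
  (forall x, Rmin a b <= x <= Rmax a b ->
     @continuous R_UniformSpace C_UniformSpace f x) -> exI f a b.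
Proof. exact: (@ex_RInt_continuous C_R_CompleteNormedModule). Qed.

Lemma ccont_continuous_re (f : C -> C) (x c : R) : ccont f (x, c) ->
  @continuous R_UniformSpace C_UniformSpace (fun t => f (t, c)) x.
Proof.
move=> H; apply/filterlim_locally => eps.
have [d [Hd D]] := H eps (cond_pos eps).
exists (mkposreal d Hd) => y B.
have := D (RtoC (y - x)).
have -> : ((x, c) + RtoC (y - x))%C = (y, c) by rewrite /Cplus /RtoC /=; f_equal; ring.
rewrite Cmod_R => /(_ B) H1.
split.
- apply: Rle_lt_trans H1; exact: (re_le_Cmod (f (y, c) - f (x, c))%C).
- apply: Rle_lt_trans H1; exact: (im_le_Cmod (f (y, c) - f (x, c))%C).
Qed.

Lemma ccont_continuous_im (f : C -> C) (x c : R) : ccont f (c, x) ->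
  @continuous R_UniformSpace C_UniformSpace (fun t => f (c, t)) x.
Proof.
move=> H; apply/filterlim_locally => eps.
have [d [Hd D]] := H eps (cond_pos eps).
exists (mkposreal d Hd) => y B.
have := D (Ci * RtoC (y - x))%C.
have -> : ((c, x) + Ci * RtoC (y - x))%C = (c, y).
  by rewrite /Cplus /Cmult /Ci /RtoC /=; f_equal; ring.
rewrite Cmod_mult Cmod_Ci Cmod_R Rmult_1_l => /(_ B) H1.
split.
- apply: Rle_lt_trans H1; exact: (re_le_Cmod (f (c, y) - f (c, x))%C).
- apply: Rle_lt_trans H1; exact: (im_le_Cmod (f (c, y) - f (c, x))%C).
Qed.

(* Counterclockwise; signed, so that [b < a] or [d < c] is allowed. *)
Definition rect_int (f : C -> C) (a b c d : R) : C :=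
  (CI (fun x => f (x, c) - f (x, d)) a b + Ci * CI (fun y => f (b, y) - f (a, y)) c d)%C.

Definition edges (f : C -> C) (a b c d : R) : Prop :=
  exI (fun x => f (x, c)) a b /\ exI (fun x => f (x, d)) a b /\
  exI (fun y => f (a, y)) c d /\ exI (fun y => f (b, y)) c d.

Definition rect (a b c d : R) (z : C) : Prop :=
  (Rmin a b <= Re z <= Rmax a b) /\ (Rmin c d <= Im z <= Rmax c d).

Definition bdry (a b c d : R) (z : C) : Prop :=
  rect a b c d z /\ (Re z = a \/ Re z = b \/ Im z = c \/ Im z = d).

Lemma Rmin_Rmax_l (a b : R) : Rmin a b <= a <= Rmax a b.
Proof. split; [exact: Rmin_l | exact: Rmax_l]. Qed.

Lemma Rmin_Rmax_r (a b : R) : Rmin a b <= b <= Rmax a b.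
Proof. split; [exact: Rmin_r | exact: Rmax_r]. Qed.

Lemma edges_cont (f : C -> C) (a b c d : R) :
  (forall z, bdry a b c d z -> ccont f z) -> edges f a b c d.
Proof.
move=> H; repeat split; apply: exI_continuous => x Hx.
- apply: ccont_continuous_re; apply: H; split; last by right; right; left.
  by split=> //; apply: Rmin_Rmax_l.
- apply: ccont_continuous_re; apply: H; split; last by right; right; right.
  by split=> //; apply: Rmin_Rmax_r.
- apply: ccont_continuous_im; apply: H; split; last by left.
  by split=> //; apply: Rmin_Rmax_l.
- apply: ccont_continuous_im; apply: H; split; last by right; left.
  by split=> //; apply: Rmin_Rmax_r.
Qed.

Lemma edges_cont_rect (f : C -> C) (a b c d : R) :
  (forall z, rect a b c d z -> ccont f z) -> edges f a b c d.
Proof. by move=> H; apply: edges_cont => z [Hz _]; apply: H. Qed.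

Lemma rect_int_ext (f g : C -> C) (a b c d : R) :
  (forall z, bdry a b c d z -> f z = g z) -> rect_int f a b c d = rect_int g a b c d.
Proof.
move=> E; rewrite /rect_int.
have [? ?] := Rmin_Rmax_l a b; have [? ?] := Rmin_Rmax_l c d.
have [? ?] := Rmin_Rmax_r a b; have [? ?] := Rmin_Rmax_r c d.
rewrite (CI_ext _ (fun x => g (x, c) - g (x, d))%C a b); last first.
  by move=> x Hx; rewrite !E //; (split; [split => /=; lra | rewrite /=; tauto]).
rewrite (CI_ext _ (fun y => g (b, y) - g (a, y))%C c d) //.
by move=> x Hx; rewrite !E //; (split; [split => /=; lra | rewrite /=; tauto]).
Qed.

Lemma rect_int_plus (f g : C -> C) (a b c d : R) : edges f a b c d -> edges g a b c d ->
  rect_int (fun z => f z + g z)%C a b c d = (rect_int f a b c d + rect_int g a b c d)%C.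
Proof.
move=> [F1 [F2 [F3 F4]]] [G1 [G2 [G3 G4]]]; rewrite /rect_int.
rewrite !CI_minus ?CI_plus //; try exact: exI_plus.
ring.
Qed.

Lemma rect_int_scal (k : C) (f : C -> C) (a b c d : R) : edges f a b c d ->
  rect_int (fun z => k * f z)%C a b c d = (k * rect_int f a b c d)%C.
Proof.
move=> [F1 [F2 [F3 F4]]]; rewrite /rect_int.
rewrite !CI_minus ?CI_scal //; try exact: exI_scal.
ring.
Qed.

Lemma edges_scal (k : C) (f : C -> C) (a b c d : R) : edges f a b c d ->
  edges (fun z => k * f z)%C a b c d.
Proof. by move=> [F1 [F2 [F3 F4]]]; repeat split; apply: exI_scal. Qed.

(** The differences between opposite sides are constant, and their two contributions cancel.
    Goursat's lemma needs no other integral in closed form. *)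
Lemma rect_int_affine (k l : C) (a b c d : R) : rect_int (fun z => k + l * z)%C a b c d = 0%C.
Proof.
rewrite /rect_int.
rewrite (CI_ext _ (fun _ => l * (Ci * RtoC (c - d)))%C); last first.
  move=> x _; rewrite /Ci /RtoC; case: l k => ? ? [? ?]; rewrite /Cminus /Cplus /Copp /Cmult /=; f_equal; ring.
rewrite (CI_ext (fun y => _ - _)%C (fun _ => l * RtoC (b - a))%C); last first.
  move=> x _; rewrite /RtoC; case: l k => ? ? [? ?]; rewrite /Cminus /Cplus /Copp /Cmult /=; f_equal; ring.
rewrite !CI_const !RtoC_minus; ring.
Qed.

Lemma rect_int_hsplit (f : C -> C) (a m b c d : R) : edges f a m c d -> edges f m b c d ->
  rect_int f a b c d = (rect_int f a m c d + rect_int f m b c d)%C.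
Proof.
move=> [F1 [F2 [F3 F4]]] [G1 [G2 [G3 G4]]]; rewrite /rect_int.
rewrite -(CI_chasles _ a m b); try exact: exI_minus.
rewrite (CI_minus (fun y => f (b, y))) // (CI_minus (fun y => f (b, y))) // (CI_minus (fun y => f (m, y))) //.
ring.
Qed.

Lemma rect_int_vsplit (f : C -> C) (a b c m d : R) : edges f a b c m -> edges f a b m d ->
  rect_int f a b c d = (rect_int f a b c m + rect_int f a b m d)%C.
Proof.
move=> [F1 [F2 [F3 F4]]] [G1 [G2 [G3 G4]]]; rewrite /rect_int.
rewrite -(CI_chasles (fun y => _ - _)%C c m d); try exact: exI_minus.
rewrite (CI_minus (fun y => f (y, c))) // (CI_minus (fun y => f (y, c))) // (CI_minus (fun y => f (y, m))) //.
ring.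
Qed.

Lemma rect_int_bound (f : C -> C) (a b c d M : R) : a <= b -> c <= d -> edges f a b c d ->
  (forall z, bdry a b c d z -> Cmod (f z) <= M) ->
  Cmod (rect_int f a b c d) <= 2 * M * ((b - a) + (d - c)).
Proof.
move=> L1 L2 [F1 [F2 [F3 F4]]] B; rewrite /rect_int.
apply: Rle_trans (Cmod_triangle _ _) _.
rewrite Cmod_mult Cmod_Ci Rmult_1_l.
have Hb : forall x y, a <= x <= b -> c <= y <= d -> (x = a \/ x = b \/ y = c \/ y = d) ->
  Cmod (f (x, y)) <= M.
  move=> x y Hx Hy O; apply: B; split=> //; rewrite /rect !Rmin_left ?Rmax_right //.
have H1 : Cmod (CI (fun x => f (x, c) - f (x, d))%C a b) <= (b - a) * (2 * M).
  apply: CI_bound => //; first exact: exI_minus.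
  move=> x Hx; apply: Rle_trans (Cmod_triangle_minus _ _) _.
  have := Hb x c Hx (conj (Rle_refl _) L2); have := Hb x d Hx (conj L2 (Rle_refl _)).
  move=> /(_ ltac:(auto)) ? /(_ ltac:(auto)) ?; lra.
have H2 : Cmod (CI (fun y => f (b, y) - f (a, y))%C c d) <= (d - c) * (2 * M).
  apply: CI_bound => //; first exact: exI_minus.
  move=> x Hx; apply: Rle_trans (Cmod_triangle_minus _ _) _.
  have := Hb a x (conj (Rle_refl _) L1) Hx; have := Hb b x (conj L1 (Rle_refl _)) Hx.
  move=> /(_ ltac:(auto)) ? /(_ ltac:(auto)) ?; lra.
lra.
Qed.

Lemma rect_int_hswap (f : C -> C) (a b c d : R) : edges f a b c d ->
  rect_int f b a c d = (- rect_int f a b c d)%C.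
Proof.
move=> [F1 [F2 [F3 F4]]]; rewrite /rect_int -CI_swap; last exact: exI_minus.
rewrite (CI_minus (fun y => f (a, y))) // (CI_minus (fun y => f (b, y))) //.
ring.
Qed.

Lemma rect_int_vswap (f : C -> C) (a b c d : R) : edges f a b c d ->
  rect_int f a b d c = (- rect_int f a b c d)%C.
Proof.
move=> [F1 [F2 [F3 F4]]]; rewrite /rect_int -(CI_swap _ c d); last exact: exI_minus.
rewrite (CI_minus (fun y => f (y, c))) // (CI_minus (fun y => f (y, d))) //.
ring.
Qed.

(** * Goursat's lemma *)

Lemma nested_intervals (a b : nat -> R) :
  (forall n, a n <= a (S n)) -> (forall n, b (S n) <= b n) -> (forall n, a n <= b n) ->
  exists x, forall n, a n <= x <= b n.
Proof.
move=> A B AB.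
have A' : forall n k, a n <= a (n + k)%nat.
  move=> n; elim=> [|k IH]; first by rewrite Nat.add_0_r; lra.
  rewrite Nat.add_succ_r; apply: Rle_trans IH (A _).
have B' : forall n k, b (n + k)%nat <= b n.
  move=> n; elim=> [|k IH]; first by rewrite Nat.add_0_r; lra.
  rewrite Nat.add_succ_r; apply: Rle_trans (B _) IH.
have AB' : forall n m, a n <= b m.
  move=> n m; have := A' n m; have := B' m n; rewrite (Nat.add_comm m n).
  have := AB (n + m)%nat; lra.
have [|| x [U L]] := completeness (fun r => exists n, r = a n).
- by exists (b O) => r [n ->].
- by exists (a O); exists O.
exists x => n; split; first by apply: U; exists n.
by apply: L => r [k ->].
Qed.

Lemma pow2_small (l d : R) : 0 < d -> exists n : nat, l / 2 ^ n < d.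
Proof.
move=> Hd.
have H : is_lim_seq (fun n => l * (1 / 2) ^ n) (Finite (l * 0)).
  apply: (is_lim_seq_scal_l _ l 0); apply: is_lim_seq_geom.
  rewrite Rabs_pos_eq; lra.
rewrite Rmult_0_r in H.
have /is_lim_seq_spec /(_ (mkposreal d Hd)) [N HN] := H.
exists N; have := HN N (Nat.le_refl _); rewrite Rminus_0_r /= => /Rabs_def2 [H1 _].
have -> : l / 2 ^ N = l * (1 / 2) ^ N.
  by rewrite /Rdiv Rmult_1_l pow_inv; lra.
exact: H1.
Qed.

(** A form of Cousin's lemma: a property that passes from the four quarters to the whole, and that
    holds for all small rectangles around each point, holds for the given rectangle. Otherwise some
    quarter fails at every stage, and the failing rectangles shrink to a point. *)
Lemma bisection (P : R -> R -> R -> R -> Prop) (a0 b0 c0 d0 : R) :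
  a0 <= b0 -> c0 <= d0 ->
  (forall a b c d, a0 <= a <= b -> b <= b0 -> c0 <= c <= d -> d <= d0 ->
     let m := (a + b) / 2 in let n := (c + d) / 2 in
     P a m c n -> P m b c n -> P a m n d -> P m b n d -> P a b c d) ->
  (forall x y, a0 <= x <= b0 -> c0 <= y <= d0 -> exists r, 0 < r /\
     forall a b c d, a0 <= a <= x -> x <= b <= b0 -> c0 <= c <= y -> y <= d <= d0 ->
       b - a < r -> d - c < r -> P a b c d) ->
  P a0 b0 c0 d0.
Proof.
move=> L1 L2 Hs Hl; apply: NNPP => N0.
pose Q := (R * R * (R * R))%type.
pose bad (q : Q) := (a0 <= q.1.1 <= q.1.2) /\ q.1.2 <= b0 /\ (c0 <= q.2.1 <= q.2.2) /\ q.2.2 <= d0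
   /\ ~ P q.1.1 q.1.2 q.2.1 q.2.2.
pose half (q q' : Q) := q.1.1 <= q'.1.1 /\ q'.1.2 <= q.1.2 /\ q.2.1 <= q'.2.1 /\ q'.2.2 <= q.2.2 /\
  q'.1.2 - q'.1.1 = (q.1.2 - q.1.1) / 2 /\ q'.2.2 - q'.2.1 = (q.2.2 - q.2.1) / 2.
(* The hypothesis [bad q] stands inside the existential, so that choice gives a total function [g]
   that can be iterated. *)
have step : forall q, exists q', bad q -> bad q' /\ half q q'.
  move=> [[a b] [c d]]; rewrite /bad /half /=.
  case: (classic ((a0 <= a <= b) /\ b <= b0 /\ (c0 <= c <= d) /\ d <= d0 /\ ~ P a b c d));
    last by move=> H; exists ((a, b), (c, d)).
  move=> [H1 [H2 [H3 [H4 H5]]]].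
  have := Hs a b c d H1 H2 H3 H4; set m := (a + b) / 2; set n := (c + d) / 2 => /= Hq.
  have Hm : m - a = (b - a) / 2 by rewrite /m; field.
  have Hm' : b - m = (b - a) / 2 by rewrite /m; field.
  have Hn : n - c = (d - c) / 2 by rewrite /n; field.
  have Hn' : d - n = (d - c) / 2 by rewrite /n; field.
  case: (classic (P a m c n)) => [P1|P1]; last first.
    by exists ((a, m), (c, n)) => _ /=; repeat split=> //; lra.
  case: (classic (P m b c n)) => [P2|P2]; last first.
    by exists ((m, b), (c, n)) => _ /=; repeat split=> //; lra.
  case: (classic (P a m n d)) => [P3|P3]; last first.
    by exists ((a, m), (n, d)) => _ /=; repeat split=> //; lra.
  case: (classic (P m b n d)) => [P4|P4]; last first.
    by exists ((m, b), (n, d)) => _ /=; repeat split=> //; lra.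
  by case: H5; apply: Hq.
pose g q := proj1_sig (constructive_indefinite_description _ (step q)).
have Hg : forall q, bad q -> bad (g q) /\ half q (g q).
  by move=> q; rewrite /g; case: constructive_indefinite_description.
pose u n := Nat.iter n g ((a0, b0), (c0, d0)).
have Bu : forall n, bad (u n).
  elim=> [|n IH]; last by case: (Hg _ IH).
  by rewrite /bad /=; repeat split=> //; lra.
have Hu : forall n, half (u n) (u (S n)) by move=> n; case: (Hg _ (Bu n)).
have W1 : forall n, (u n).1.2 - (u n).1.1 = (b0 - a0) / 2 ^ n.
  elim=> [|n IH]; first by rewrite /=; field.
  have [_ [_ [_ [_ [-> _]]]]] := Hu n; rewrite IH /=; field.
  by apply: pow_nonzero; lra.
have W2 : forall n, (u n).2.2 - (u n).2.1 = (d0 - c0) / 2 ^ n.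
  elim=> [|n IH]; first by rewrite /=; field.
  have [_ [_ [_ [_ [_ ->]]]]] := Hu n; rewrite IH /=; field.
  by apply: pow_nonzero; lra.
have [||| x Hx] := nested_intervals (fun n => (u n).1.1) (fun n => (u n).1.2).
- by move=> n; have := Hu n; rewrite /half; tauto.
- by move=> n; have := Hu n; rewrite /half; tauto.
- by move=> n; have := Bu n; rewrite /bad; tauto.
have [||| y Hy] := nested_intervals (fun n => (u n).2.1) (fun n => (u n).2.2).
- by move=> n; have := Hu n; rewrite /half; tauto.
- by move=> n; have := Hu n; rewrite /half; tauto.
- by move=> n; have := Bu n; rewrite /bad; tauto.
have Hx0 := Hx O; have Hy0 := Hy O.
have [r [Hr HP]] := Hl x y Hx0 Hy0.
have [N1 HN] := pow2_small ((b0 - a0) + (d0 - c0)) r Hr.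
have E : ((b0 - a0) + (d0 - c0)) / 2 ^ N1 = (b0 - a0) / 2 ^ N1 + (d0 - c0) / 2 ^ N1.
  by field; apply: pow_nonzero; lra.
have p2 : 0 < 2 ^ N1 by apply: pow_lt; lra.
have G1 : 0 <= (b0 - a0) / 2 ^ N1 by apply: Rdiv_le_0_compat; lra.
have G2 : 0 <= (d0 - c0) / 2 ^ N1 by apply: Rdiv_le_0_compat; lra.
have [B1 [B2 [B3 [B4 B5]]]] := Bu N1.
have := Hx N1; have := Hy N1; have := W1 N1; have := W2 N1.
move=> E2 E1 Hy1 Hx1.
apply: B5; apply: HP; lra.
Qed.

(** The bound [eps * (width + height) ^ 2] is compatible with quartering, since each quarter has
    half the width and half the height and there are four of them. On a small rectangle around a
    point it follows by subtracting the tangent affine function, whose integral is 0. *)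
Lemma goursat (f : C -> C) (a b c d : R) : a <= b -> c <= d ->
  (forall z, rect a b c d z -> exists l, cder f z l) -> rect_int f a b c d = 0%C.
Proof.
move=> L1 L2 D.
have Hsub : forall a' b' c' d', a <= a' <= b' -> b' <= b -> c <= c' <= d' -> d' <= d ->
    edges f a' b' c' d'.
  move=> a' b' c' d' H1 H2 H3 H4; apply: edges_cont_rect => z.
  rewrite /rect !Rmin_left ?Rmax_right; try lra.
  move=> Hz; have [|l Hl] := D z; last exact: cder_cont Hl.
  rewrite /rect !Rmin_left ?Rmax_right; lra.
have H : forall eps, 0 < eps -> Cmod (rect_int f a b c d) <= eps * ((b - a) + (d - c)) ^ 2.
  move=> eps He.
  apply: (bisection (fun a b c d => Cmod (rect_int f a b c d) <= eps * ((b - a) + (d - c)) ^ 2)) => //.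
  - move=> a' b' c' d' H1 H2 H3 H4 m n I1 I2 I3 I4.
    have m1 : a' <= m <= b' by rewrite /m; lra.
    have n1 : c' <= n <= d' by rewrite /n; lra.
    rewrite (rect_int_hsplit f a' m b' c' d'); try (apply: Hsub; lra).
    rewrite (rect_int_vsplit f a' m c' n d'); try (apply: Hsub; lra).
    rewrite (rect_int_vsplit f m b' c' n d'); try (apply: Hsub; lra).
    apply: Rle_trans (Cmod_triangle _ _) _.
    have T1 := Cmod_triangle (rect_int f a' m c' n) (rect_int f a' m n d').
    have T2 := Cmod_triangle (rect_int f m b' c' n) (rect_int f m b' n d').
    have E1 : (m - a' + (n - c')) = (b' - a' + (d' - c')) / 2 by rewrite /m /n; field.
    have E2 : (b' - m + (n - c')) = (b' - a' + (d' - c')) / 2 by rewrite /m /n; field.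
    have E3 : (m - a' + (d' - n)) = (b' - a' + (d' - c')) / 2 by rewrite /m /n; field.
    have E4 : (b' - m + (d' - n)) = (b' - a' + (d' - c')) / 2 by rewrite /m /n; field.
    rewrite E1 in I1; rewrite E2 in I2; rewrite E3 in I3; rewrite E4 in I4.
    lra.
  - move=> x y Hx Hy.
    have [|l Hl] := D (x, y); first by rewrite /rect !Rmin_left ?Rmax_right /=; lra.
    (* The half absorbs the factor 2 of [rect_int_bound]; sides shorter than [r / 2] keep [z] within
       distance [r] of the point. *)
    have [|r [Hr HD]] := Hl (eps / 2); first lra.
    exists (r / 2); split; first lra.
    move=> a' b' c' d' H1 H2 H3 H4 W1 W2.
    set p : C := (x, y).
    pose g z := (f z - ((f p - p * l) + l * z))%C.
    have Eg : edges g a' b' c' d'.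
      rewrite /g; apply: edges_cont_rect => z.
      rewrite /rect !Rmin_left ?Rmax_right; try lra.
      move=> Hz; apply: ccont_minus.
        have [|l' Hl'] := D z; last exact: cder_cont Hl'.
        rewrite /rect !Rmin_left ?Rmax_right; lra.
      apply: ccont_plus; first exact: ccont_const.
      apply: ccont_mult; [exact: ccont_const | exact: ccont_id].
    have Ea : edges (fun z => (f p - p * l) + l * z)%C a' b' c' d'.
      apply: edges_cont_rect => z _.
      apply: ccont_plus; first exact: ccont_const.
      apply: ccont_mult; [exact: ccont_const | exact: ccont_id].
    have -> : rect_int f a' b' c' d' = rect_int g a' b' c' d'.
      rewrite (rect_int_ext f (fun z => g z + ((f p - p * l) + l * z))%C); last first.
        by move=> z _; rewrite /g; ring.
      by rewrite rect_int_plus // rect_int_affine Cplus_0_r.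
    have -> : eps * (b' - a' + (d' - c')) ^ 2 =
       2 * (eps / 2 * (b' - a' + (d' - c'))) * (b' - a' + (d' - c')) by field.
    apply: rect_int_bound => //; try lra.
    move=> z [[]]; rewrite !Rmin_left ?Rmax_right; try lra.
    move=> Hz1 Hz2 _.
    have M : Cmod (z - p)%C <= (b' - a') + (d' - c').
      apply: Rle_trans (Cmod_le_abs _) _.
      change (Rabs (Re z - x) + Rabs (Im z - y) <= b' - a' + (d' - c')).
      by apply: Rplus_le_compat; apply: Rabs_le; lra.
    have := HD (z - p)%C; rewrite Cplus_minus_l => /(_ ltac:(lra)) HH.
    have -> : g z = (f z - f (x, y) - (z - p) * l)%C by rewrite /g -/p; ring.
    apply: Rle_trans HH _; apply: Rmult_le_compat_l => //; lra.
case: (Rle_lt_or_eq_dec 0 _ (Cmod_ge_0 (rect_int f a b c d))) => [P|E]; last exact: Cmod_eq_0.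
set L := (b - a + (d - c)) ^ 2 in H.
have L0 : 0 <= L by rewrite /L; apply: pow2_ge_0.
have H2 : 0 < Cmod (rect_int f a b c d) / (2 * (L + 1)) by apply: Rdiv_lt_0_compat; lra.
have := H _ H2.
have : Cmod (rect_int f a b c d) / (2 * (L + 1)) * L < Cmod (rect_int f a b c d); last lra.
have -> : Cmod (rect_int f a b c d) / (2 * (L + 1)) * L = Cmod (rect_int f a b c d) * (L / (2 * (L + 1))).
  by field; lra.
rewrite -{2}(Rmult_1_r (Cmod (rect_int f a b c d))).
apply: Rmult_lt_compat_l => //.
apply: (Rmult_lt_reg_r (2 * (L + 1))); first lra.
rewrite /Rdiv Rmult_assoc Rinv_l; lra.
Qed.

(** * Cauchy's formula *)

Lemma rect_hswap (a b c d : R) (z : C) : rect b a c d z <-> rect a b c d z.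
Proof. by rewrite /rect (Rmin_comm b a) (Rmax_comm b a). Qed.

Lemma rect_vswap (a b c d : R) (z : C) : rect a b d c z <-> rect a b c d z.
Proof. by rewrite /rect (Rmin_comm d c) (Rmax_comm d c). Qed.

(** Reversed rectangles cannot be avoided: in [goursat_corner] the exceptional point is always the
    first corner, whichever way the rectangle extends from it. *)
Lemma rect_int_oriented (P : R -> R -> R -> R -> Prop) (a b c d : R) :
  (forall a b c d, P a b c d -> P b a c d) -> (forall a b c d, P a b c d -> P a b d c) ->
  (forall a b c d, a <= b -> c <= d -> P a b c d) -> P a b c d.
Proof.
move=> Hh Hv H.
case: (Rle_dec a b) => L1; case: (Rle_dec c d) => L2.
- exact: H.
- apply: Hv; apply: H; lra.
- apply: Hh; apply: H; lra.
- apply: Hh; apply: Hv; apply: H; lra.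
Qed.

Lemma goursat_oriented (f : C -> C) (a b c d : R) :
  (forall z, rect a b c d z -> exists l, cder f z l) -> rect_int f a b c d = 0%C.
Proof.
apply: (rect_int_oriented (fun a b c d => (forall z, rect a b c d z -> exists l, cder f z l) ->
  rect_int f a b c d = 0%C)); clear a b c d.
- move=> a b c d H D; rewrite rect_int_hswap; last first.
    apply: edges_cont_rect => z /(rect_hswap b a) /D [l Hl]; exact: cder_cont Hl.
  rewrite H; first ring.
  by move=> z /(rect_hswap b a) /D.
- move=> a b c d H D; rewrite rect_int_vswap; last first.
    apply: edges_cont_rect => z /(rect_vswap a b d c) /D [l Hl]; exact: cder_cont Hl.
  rewrite H; first ring.
  by move=> z /(rect_vswap a b d c) /D.
- exact: goursat.
Qed.

Lemma rect_int_bound_oriented (f : C -> C) (a b c d M : R) :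
  (forall z, rect a b c d z -> ccont f z) ->
  (forall z, rect a b c d z -> Cmod (f z) <= M) ->
  Cmod (rect_int f a b c d) <= 2 * M * (Rabs (b - a) + Rabs (d - c)).
Proof.
apply: (rect_int_oriented (fun a b c d => (forall z, rect a b c d z -> ccont f z) ->
  (forall z, rect a b c d z -> Cmod (f z) <= M) ->
  Cmod (rect_int f a b c d) <= 2 * M * (Rabs (b - a) + Rabs (d - c)))); clear a b c d.
- move=> a b c d H D B; rewrite rect_int_hswap; last first.
    by apply: edges_cont_rect => z /(rect_hswap b a) /D.
  rewrite Cmod_opp Rabs_minus_sym; apply: H => z /(rect_hswap b a); auto.
- move=> a b c d H D B; rewrite rect_int_vswap; last first.
    by apply: edges_cont_rect => z /(rect_vswap a b d c) /D.
  rewrite Cmod_opp (Rabs_minus_sym c); apply: H => z /(rect_vswap a b d c); auto.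
- move=> a b c d L1 L2 D B; rewrite !Rabs_pos_eq; try lra.
  apply: rect_int_bound => //; first exact: edges_cont_rect.
  by move=> z [/B].
Qed.

Lemma Rle_small (x k : R) : 0 <= x -> 0 <= k ->
  (exists e, 0 < e /\ forall t, 0 < t < e -> x <= k * t) -> x = 0.
Proof.
move=> Hx Hk [e [He H]].
case: (Rle_lt_or_eq_dec 0 x Hx) => [P|//].
pose t := Rmin (e / 2) (x / (2 * (k + 1))).
have Q : 0 < x / (2 * (k + 1)) by apply: Rdiv_lt_0_compat; lra.
have t0 : 0 < t by apply: Rmin_glb_lt; lra.
have t1 : t <= e / 2 by apply: Rmin_l.
have t2 : t <= x / (2 * (k + 1)) by apply: Rmin_r.
have := H t ltac:(lra).
have : (k + 1) * t <= x / 2.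
  have -> : x / 2 = (k + 1) * (x / (2 * (k + 1))) by field; lra.
  by apply: Rmult_le_compat_l; lra.
lra.
Qed.

Lemma Rseg (p u t : R) : 0 <= t <= 1 ->
  Rmin p u <= p + t * (u - p) <= Rmax p u.
Proof.
move=> Ht; rewrite /Rmin /Rmax; case: (Rle_dec p u) => H; nra.
Qed.

(** Cut off at the exceptional corner a copy of the rectangle scaled by [t]. Goursat's lemma
    disposes of the remaining two pieces, and the small piece contributes O(t), because [f] is
    bounded by [K] near the corner. *)
Lemma goursat_corner (f : C -> C) (p q u v : R) : u <> p -> v <> q ->
  (forall z, rect p u q v z -> ccont f z) ->
  (forall z, rect p u q v z -> z <> (p, q) -> exists l, cder f z l) ->
  rect_int f p u q v = 0%C.
Proof.
move=> Nu Nv Hc D.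
apply: Cmod_eq_0.
set K := Cmod (f (p, q)) + 1.
have K0 : 0 < K by rewrite /K; have := Cmod_ge_0 (f (p, q)); lra.
set T := Rabs (u - p) + Rabs (v - q).
have T0 : 0 < T.
  rewrite /T; have := Rabs_pos_lt (u - p) ltac:(lra); have := Rabs_pos_lt (v - q) ltac:(lra); lra.
apply: (Rle_small _ (2 * K * T)); first exact: Cmod_ge_0.
  by apply: Rmult_le_pos; nra.
have Hpq : rect p u q v (p, q) by split; apply: Rmin_Rmax_l.
have [|e [He HE]] := Hc _ Hpq 1; first lra.
have eT : 0 < e / T by apply: Rdiv_lt_0_compat.
exists (Rmin 1 (e / T)); split; first by apply: Rmin_glb_lt; lra.
move=> t [Ht0 Ht].
have Ht1 := Rlt_le_trans _ _ _ Ht (Rmin_l _ _).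
have Ht2 := Rlt_le_trans _ _ _ Ht (Rmin_r _ _).
have tT : t * T < e.
  have -> : e = e / T * T by field; lra.
  exact: Rmult_lt_compat_r.
set ut := p + t * (u - p); set vt := q + t * (v - q).
have Hut : Rmin p u <= ut <= Rmax p u by apply: Rseg; lra.
have Hvt : Rmin q v <= vt <= Rmax q v by apply: Rseg; lra.
have [Pu Pu'] := (Rmin_Rmax_l p u, Rmin_Rmax_r p u).
have [Pv Pv'] := (Rmin_Rmax_l q v, Rmin_Rmax_r q v).
have sub : forall a b c d z, Rmin p u <= a <= Rmax p u -> Rmin p u <= b <= Rmax p u ->
  Rmin q v <= c <= Rmax q v -> Rmin q v <= d <= Rmax q v -> rect a b c d z -> rect p u q v z.
  move=> a b c d z A B C' D' [[Z1 Z2] [Z3 Z4]].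
  by move: Z1 Z2 Z3 Z4; rewrite /rect /Rmin /Rmax;
   repeat case: Rle_dec; move: A B C' D'; rewrite /Rmin /Rmax;
   repeat case: Rle_dec; move=> *; lra.
rewrite (rect_int_hsplit f p ut u q v); try by apply: edges_cont_rect => z Hz; apply: Hc; apply: sub Hz.
rewrite (rect_int_vsplit f p ut q vt v); try by apply: edges_cont_rect => z Hz; apply: Hc; apply: sub Hz.
have E1 : rect_int f p ut vt v = 0%C.
  apply: goursat_oriented => z Hz; apply: D; first by apply: sub Hz.
  move=> E; move: Hz => [_]; rewrite E /=.
  have : (0 < v - q \/ v - q < 0) by lra.
  rewrite /vt => -[S|S]; rewrite /Rmin /Rmax; case: Rle_dec; nra.
have E2 : rect_int f ut u q v = 0%C.
  apply: goursat_oriented => z Hz; apply: D; first by apply: sub Hz.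
  move=> E; move: Hz => [+ _]; rewrite E /=.
  have : (0 < u - p \/ u - p < 0) by lra.
  rewrite /ut => -[S|S]; rewrite /Rmin /Rmax; case: Rle_dec; nra.
rewrite E1 E2 !Cplus_0_r.
have -> : 2 * K * T * t = 2 * K * (Rabs (ut - p) + Rabs (vt - q)).
  have -> : ut - p = t * (u - p) by rewrite /ut; ring.
  have -> : vt - q = t * (v - q) by rewrite /vt; ring.
  rewrite !Rabs_mult (Rabs_pos_eq t); last lra.
  rewrite /T; ring.
apply: rect_int_bound_oriented.
  by move=> z Hz; apply: Hc; apply: sub Hz.
move=> z [Z1 Z2].
have B1 : Rabs (Re z - p) <= t * Rabs (u - p).
  have <- : Rabs (t * (u - p)) = t * Rabs (u - p) by rewrite Rabs_mult Rabs_pos_eq; lra.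
  move: Z1; rewrite /ut /Rmin /Rmax /Rabs; repeat case: Rle_dec; repeat case: Rcase_abs; lra.
have B2 : Rabs (Im z - q) <= t * Rabs (v - q).
  have <- : Rabs (t * (v - q)) = t * Rabs (v - q) by rewrite Rabs_mult Rabs_pos_eq; lra.
  move: Z2; rewrite /vt /Rmin /Rmax /Rabs; repeat case: Rle_dec; repeat case: Rcase_abs; lra.
have B3 : Cmod (z - (p, q))%C < e.
  apply: Rle_lt_trans (Cmod_le_abs _) _.
  change (Rabs (Re z - p) + Rabs (Im z - q) < e).
  apply: Rle_lt_trans tT; rewrite /T; lra.
have := HE _ B3; rewrite Cplus_minus_l => B4.
have := Cmod_triangle_rev (f z) (f z - f (p, q))%C.
have -> : (f z - (f z - f (p, q)))%C = f (p, q) by ring.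
rewrite /K; lra.
Qed.

(** Cutting along the horizontal and the vertical line through [w] gives four rectangles with [w] as
    a corner; the swaps turn [w] into the first corner of each. *)
Lemma goursat_punctured (f : C -> C) (w : C) (a b c d : R) :
  a < Re w < b -> c < Im w < d ->
  (forall z, rect a b c d z -> ccont f z) ->
  (forall z, rect a b c d z -> z <> w -> exists l, cder f z l) ->
  rect_int f a b c d = 0%C.
Proof.
case: w => p q /= Hp Hq Hc D.
have sub : forall a' b' c' d' z, a <= a' <= b -> a <= b' <= b ->
  c <= c' <= d -> c <= d' <= d -> rect a' b' c' d' z -> rect a b c d z.
  move=> a' b' c' d' z A B C' D'.
  rewrite /rect (Rmin_left a) ?(Rmax_right a) ?(Rmin_left c) ?(Rmax_right c); try lra.
  rewrite /Rmin /Rmax; repeat case: Rle_dec; lra.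
have corner : forall u v, (u = a \/ u = b) -> (v = c \/ v = d) ->
    edges f p u q v /\ rect_int f p u q v = 0%C.
  move=> u v Hu Hv; split.
    apply: edges_cont_rect => z Hz; apply: Hc; apply: sub Hz; lra.
  apply: goursat_corner; try lra.
    move=> z Hz; apply: Hc; apply: sub Hz; lra.
  move=> z Hz; apply: D; apply: sub Hz; lra.
have E : forall a' b' c' d', a <= a' <= b -> a <= b' <= b ->
  c <= c' <= d -> c <= d' <= d -> edges f a' b' c' d'.
  move=> a' b' c' d' A B C' D'; apply: edges_cont_rect => z Hz; apply: Hc; apply: sub Hz; lra.
rewrite (rect_int_hsplit f a p b c d); try (apply: E; lra).
rewrite (rect_int_vsplit f a p c q d); try (apply: E; lra).
rewrite (rect_int_vsplit f p b c q d); try (apply: E; lra).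
rewrite (rect_int_hswap f p a c q); last (apply: E; lra).
rewrite (rect_int_hswap f p a q d); last (apply: E; lra).
rewrite (rect_int_vswap f p a q c); last (apply: E; lra).
rewrite (rect_int_vswap f p b q c); last (apply: E; lra).
have [_ ->] := corner a c ltac:(auto) ltac:(auto).
have [_ ->] := corner a d ltac:(auto) ltac:(auto).
have [_ ->] := corner b c ltac:(auto) ltac:(auto).
have [_ ->] := corner b d ltac:(auto) ltac:(auto).
ring.
Qed.

Lemma bdry_interior_neq (a b c d : R) (w z : C) :
  a < Re w < b -> c < Im w < d -> bdry a b c d z -> (z - w)%C <> 0%C.
Proof.
move=> Ha Hc [_ H] E.
have E' : z = w by rewrite -(Cplus_minus_l w z) E Cplus_0_r.
rewrite E' in H; lra.
Qed.

Lemma edges_kernel (f : C -> C) (w : C) (a b c d : R) :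
  a < Re w < b -> c < Im w < d -> (forall z, bdry a b c d z -> ccont f z) ->
  edges (fun z => f z / (z - w))%C a b c d.
Proof.
move=> Ha Hc F; apply: edges_cont => z Hz.
apply: ccont_div; first exact: F.
  apply: ccont_minus; [exact: ccont_id | exact: ccont_const].
exact: bdry_interior_neq Hz.
Qed.

(** The difference quotient of [f] at [w], completed by the derivative, is continuous and is
    differentiable off [w], so its integral vanishes by [goursat_punctured]. Splitting the quotient
    gives the formula with the kernel integral left unevaluated. *)
Lemma cauchy_formula (f : C -> C) (w : C) (a b c d : R) :
  a < Re w < b -> c < Im w < d ->
  (forall z, rect a b c d z -> exists l, cder f z l) ->
  rect_int (fun z => f z / (z - w))%C a b c d = (f w * rect_int (fun z => 1 / (z - w))%C a b c d)%C.
Proof.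
move=> Ha Hc D.
have Hw : rect a b c d w by rewrite /rect !Rmin_left ?Rmax_right; lra.
have [l Hl] := D w Hw.
have Ef : edges (fun z => f z / (z - w))%C a b c d.
  apply: edges_kernel => // z [/D [m Hm] _]; exact: cder_cont Hm.
have E1 : edges (fun z => 1 / (z - w))%C a b c d.
  apply: edges_kernel => // z _; exact: ccont_const.
have H0 : rect_int (fun z => slope f w l (z - w))%C a b c d = 0%C.
  apply: (goursat_punctured _ w) => // z Hz.
  - case: (classic (z = w)) => [->|N].
      apply: (ccont_comp (fun z => z - w)%C (slope f w l)).
        apply: ccont_minus; [exact: ccont_id | exact: ccont_const].
      have -> : (w - w = 0)%C by ring.
      by apply/cder_slope.
    have [m Hm] := D z Hz.
    have N' : (z - w)%C <> 0%C by move=> E; apply: N; rewrite -(Cplus_minus_l w z) E Cplus_0_r.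
    have Cm : ccont (fun z => z - w)%C z.
      apply: ccont_minus; [exact: ccont_id | exact: ccont_const].
    have [r [Hr R']] := ccont_nonzero _ _ Cm N'.
    apply: (ccont_ext_loc (fun z => (f z - f w) / (z - w))%C _ _ r) => //.
      by move=> h /R' Hh; rewrite slope_neq // Cplus_minus_l.
    apply: ccont_div => //; apply: ccont_minus; last exact: ccont_const.
    exact: cder_cont Hm.
  - move=> N.
    have [m Hm] := D z Hz.
    have N' : (z - w)%C <> 0%C by move=> E; apply: N; rewrite -(Cplus_minus_l w z) E Cplus_0_r.
    have Cm : ccont (fun z => z - w)%C z.
      apply: ccont_minus; [exact: ccont_id | exact: ccont_const].
    have [r [Hr R']] := ccont_nonzero _ _ Cm N'.
    eexists; apply: (cder_ext_loc (fun z => (f z - f w) / (z - w))%C _ _ _ r) => //.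
      by move=> h /R' Hh; rewrite slope_neq // Cplus_minus_l.
    apply: cder_div => //; apply: cder_minus; try exact: cder_const; [exact: Hm | exact: cder_id].
have E : rect_int (fun z => slope f w l (z - w))%C a b c d =
    (rect_int (fun z => f z / (z - w))%C a b c d + (- f w) * rect_int (fun z => 1 / (z - w))%C a b c d)%C.
  rewrite -rect_int_scal // -rect_int_plus //; last exact: edges_scal.
  apply: rect_int_ext => z Hz; have N := bdry_interior_neq _ _ _ _ _ _ Ha Hc Hz.
  by rewrite slope_neq // Cplus_minus_l; field.
rewrite E in H0.
rewrite -(Cplus_0_r (f w * _)%C) -H0; ring.
Qed.

(** Only the nonvanishing of the kernel integral is wanted, and each of the four sides makes a
    positive contribution to its imaginary part. *)
Lemma Im_rect_int_kernel_pos (w : C) (a b c d : R) :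
  a < Re w < b -> c < Im w < d -> 0 < Im (rect_int (fun z => 1 / (z - w))%C a b c d).
Proof.
case: w => p q Ha Hc; simpl in Ha, Hc.
have [E1 [E2 [E3 E4]]] : edges (fun z => 1 / (z - (p, q)))%C a b c d.
  apply: edges_kernel => // z _; exact: ccont_const.
set k := (fun z => 1 / (z - (p, q)))%C in E1 E2 E3 E4 *.
have I1 := isI_Im _ _ _ _ (CI_correct _ _ _ (exI_minus _ _ _ _ E1 E2)).
have I2 := isI_Re _ _ _ _ (CI_correct _ _ _ (exI_minus _ _ _ _ E4 E3)).
have -> : Im (rect_int k a b c d) = Im (CI (fun x => k (x, c) - k (x, d))%C a b)
     + Re (CI (fun y => k (b, y) - k (a, y))%C c d).
  by rewrite /rect_int /Ci /=; ring.
have kE : forall x y, (x - p) * (x - p) + (y - q) * (y - q) <> 0 -> k (x, y) =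
   ((x - p) / ((x - p) * (x - p) + (y - q) * (y - q)),
    - (y - q) / ((x - p) * (x - p) + (y - q) * (y - q))).
  move=> x y N; rewrite /k /Cdiv /Cminus /Cplus /Copp /Cinv /Cmult /RtoC /=.
  by f_equal; field; move=> E; apply: N; rewrite -E; ring.
have sq : forall x y : R, y <> 0 -> 0 < x * x + y * y.
  move=> x y N; have := Rle_0_sqr x; have := Rsqr_pos_lt y N; rewrite /Rsqr; lra.
have sq' : forall x y : R, x <> 0 -> 0 < x * x + y * y.
  move=> x y N; have := Rle_0_sqr y; have := Rsqr_pos_lt x N; rewrite /Rsqr; lra.
have conts : forall u, (u <> q) -> forall x, ccont k (x, u).
  move=> u Hu x; apply: ccont_div; first exact: ccont_const.
    apply: ccont_minus; [exact: ccont_id | exact: ccont_const].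
  by move=> E; have := f_equal Im E; rewrite /=; lra.
have conts' : forall u, (u <> p) -> forall x, ccont k (u, x).
  move=> u Hu x; apply: ccont_div; first exact: ccont_const.
    apply: ccont_minus; [exact: ccont_id | exact: ccont_const].
  by move=> E; have := f_equal Re E; rewrite /=; lra.
have P1 : 0 < Im (CI (fun x => k (x, c) - k (x, d))%C a b).
  rewrite -(is_RInt_unique _ _ _ _ I1).
  apply: RInt_gt_0; first lra.
    move=> x Hx; change (0 < Im (k (x, c) - k (x, d))%C).
    rewrite !kE /=; try by apply: Rgt_not_eq; apply: sq; lra.
    have S1 := sq (x - p) (c - q) ltac:(lra); have S2 := sq (x - p) (d - q) ltac:(lra).
    have : 0 < - (c - q) / ((x - p) * (x - p) + (c - q) * (c - q)) by apply: Rdiv_lt_0_compat; lra.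
    have : 0 < (d - q) / ((x - p) * (x - p) + (d - q) * (d - q)) by apply: Rdiv_lt_0_compat; lra.
    rewrite Rdiv_opp_l; lra.
  move=> x _.
  apply: (continuous_comp (U := R_UniformSpace) (V := C_UniformSpace) (fun x => k (x, c) - k (x, d))%C Im);
    last by case: (k (x, c) - k (x, d))%C => ? ?; apply: continuous_snd.
  apply: (continuous_minus (V := C_R_NormedModule) (fun x => k (x, c)) (fun x => k (x, d)));
    apply: ccont_continuous_re; apply: conts; lra.
have P2 : 0 < Re (CI (fun y => k (b, y) - k (a, y))%C c d).
  rewrite -(is_RInt_unique _ _ _ _ I2).
  apply: RInt_gt_0; first lra.
    move=> x Hx; change (0 < Re (k (b, x) - k (a, x))%C).
    rewrite !kE /=; try by apply: Rgt_not_eq; apply: sq'; lra.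
    have S1 := sq' (a - p) (x - q) ltac:(lra); have S2 := sq' (b - p) (x - q) ltac:(lra).
    have : 0 < - (a - p) / ((a - p) * (a - p) + (x - q) * (x - q)) by apply: Rdiv_lt_0_compat; lra.
    have : 0 < (b - p) / ((b - p) * (b - p) + (x - q) * (x - q)) by apply: Rdiv_lt_0_compat; lra.
    rewrite Rdiv_opp_l; lra.
  move=> x _.
  apply: (continuous_comp (U := R_UniformSpace) (V := C_UniformSpace) (fun x => k (b, x) - k (a, x))%C Re);
    last by case: (k (b, x) - k (a, x))%C => ? ?; apply: continuous_fst.
  apply: (continuous_minus (V := C_R_NormedModule) (fun x => k (b, x)) (fun x => k (a, x)));
    apply: ccont_continuous_im; apply: conts'; lra.
lra.
Qed.

Lemma rect_int_kernel_neq_0 (w : C) (a b c d : R) :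
  a < Re w < b -> c < Im w < d -> rect_int (fun z => 1 / (z - w))%C a b c d <> 0%C.
Proof.
move=> Ha Hc E; have := Im_rect_int_kernel_pos w a b c d Ha Hc; rewrite E /=; lra.
Qed.

(** * Complex power series *)

Definition cabs (a : nat -> C) : Prop := ex_series (fun n => Cmod (a n)).

Lemma ex_series_Rle (a b : nat -> R) :
  (forall n, Rabs (a n) <= b n) -> ex_series b -> ex_series a.
Proof. exact: (@ex_series_le R_AbsRing R_CompleteNormedModule). Qed.

Lemma cabs_le (a : nat -> C) (b : nat -> R) :
  (forall n, Cmod (a n) <= b n) -> ex_series b -> cabs a.
Proof.
move=> H; apply: ex_series_Rle => n; rewrite Rabs_pos_eq //; exact: Cmod_ge_0.
Qed.

Lemma cabs_absRe (a : nat -> C) : cabs a -> ex_series (fun n => Rabs (Re (a n))).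
Proof. apply: ex_series_Rle => n; rewrite Rabs_Rabsolu; exact: re_le_Cmod. Qed.

Lemma cabs_absIm (a : nat -> C) : cabs a -> ex_series (fun n => Rabs (Im (a n))).
Proof. apply: ex_series_Rle => n; rewrite Rabs_Rabsolu; exact: im_le_Cmod. Qed.

Lemma cabs_Re (a : nat -> C) : cabs a -> ex_series (fun n => Re (a n)).
Proof. by move=> /cabs_absRe /ex_series_Rabs. Qed.

Lemma cabs_Im (a : nat -> C) : cabs a -> ex_series (fun n => Im (a n)).
Proof. by move=> /cabs_absIm /ex_series_Rabs. Qed.

Lemma cabs_plus (a b : nat -> C) : cabs a -> cabs b -> cabs (fun n => a n + b n)%C.
Proof.
move=> A B; apply: (cabs_le _ (fun n => Cmod (a n) + Cmod (b n))).
  by move=> n; apply: Cmod_triangle.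
exact: (ex_series_plus (V := R_NormedModule)).
Qed.

Lemma cabs_scal (c : C) (a : nat -> C) : cabs a -> cabs (fun n => c * a n)%C.
Proof.
move=> A; apply: (cabs_le _ (fun n => Cmod c * Cmod (a n))).
  by move=> n; rewrite Cmod_mult; lra.
exact: (ex_series_scal_l (V := R_NormedModule)).
Qed.

Lemma cabs_incr (a : nat -> C) : cabs a <-> cabs (fun n => a (S n)).
Proof. exact: (ex_series_incr_1 (V := R_NormedModule)). Qed.

Lemma CSeries_ext (a b : nat -> C) : (forall n, a n = b n) -> CSeries a = CSeries b.
Proof. by move=> E; rewrite /CSeries; f_equal; apply: Series_ext => n; rewrite E. Qed.

Lemma CSeries_plus (a b : nat -> C) : cabs a -> cabs b ->
  CSeries (fun n => a n + b n)%C = (CSeries a + CSeries b)%C.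
Proof.
move=> A B; rewrite /CSeries /Cplus /=; f_equal; apply: Series_plus;
  by [apply: cabs_Re | apply: cabs_Im].
Qed.

Lemma CSeries_scal (c : C) (a : nat -> C) : cabs a ->
  CSeries (fun n => c * a n)%C = (c * CSeries a)%C.
Proof.
move=> A; rewrite /CSeries /Cmult /=.
have R1 : forall k, ex_series (fun n => k * Re (a n)).
  by move=> k; apply: (ex_series_scal_l (V := R_NormedModule)); apply: cabs_Re.
have R2 : forall k, ex_series (fun n => k * Im (a n)).
  by move=> k; apply: (ex_series_scal_l (V := R_NormedModule)); apply: cabs_Im.
f_equal.
  by rewrite -!Series_scal_l -Series_minus.
by rewrite -!Series_scal_l -Series_plus.
Qed.

Lemma CSeries_incr (a : nat -> C) : cabs a ->
  CSeries a = (a O + CSeries (fun n => a (S n)))%C.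
Proof.
move=> A; rewrite /CSeries /Cplus /=; f_equal; apply: Series_incr_1;
  by [apply: cabs_Re | apply: cabs_Im].
Qed.

Lemma Series_ge0 (a : nat -> R) : (forall n, 0 <= a n) -> ex_series a -> 0 <= Series a.
Proof.
move=> H A; have -> : 0 = Series (fun _ => 0 * 0) by rewrite Series_scal_l; ring.
by apply: Series_le => // n; split; [lra | rewrite Rmult_0_l].
Qed.

(** Multiplying the terms by the conjugate of the sum [s] makes the sum real: [|s|^2] is the real
    part of the rotated series, to which the real triangle inequality applies. *)
Lemma CSeries_bound (a : nat -> C) : cabs a ->
  Cmod (CSeries a) <= Series (fun n => Cmod (a n)).
Proof.
move=> A; set s := CSeries a.
case: (Rle_lt_or_eq_dec 0 _ (Cmod_ge_0 s)) => [P|<-]; last first.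
  by apply: Series_ge0 => // n; apply: Cmod_ge_0.
apply: (Rmult_le_reg_l (Cmod s)) => //.
have E : Cmod s * Cmod s = Re (CSeries (fun n => Cconj s * a n)%C).
  rewrite CSeries_scal // -/s.
  have := Cmod2_conj s; rewrite Cmult_comm => <-; rewrite /=; ring.
rewrite E -Series_scal_l.
apply: Rle_trans (Rle_abs _) _.
have A' : cabs (fun n => Cconj s * a n)%C by apply: cabs_scal.
apply: Rle_trans (Series_Rabs _ (cabs_absRe _ A')) _.
apply: Series_le.
  move=> n; split; first exact: Rabs_pos.
  by apply: Rle_trans (re_le_Cmod _) _; rewrite Cmod_mult Cmod_conj; lra.
exact: (ex_series_scal_l (V := R_NormedModule)).
Qed.

Fixpoint Csum (a : nat -> C) (n : nat) : C :=
  match n with O => RtoC 0 | S k => (Csum a k + a k)%C end.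

Lemma Csum_Re (a : nat -> C) n : Re (Csum a (S n)) = sum_n (fun k => Re (a k)) n.
Proof.
elim: n => [|n IH]; first by rewrite sum_O /= Rplus_0_l.
by rewrite sum_Sn -IH.
Qed.

Lemma Csum_Im (a : nat -> C) n : Im (Csum a (S n)) = sum_n (fun k => Im (a k)) n.
Proof.
elim: n => [|n IH]; first by rewrite sum_O /= Rplus_0_l.
by rewrite sum_Sn -IH.
Qed.

Lemma CSeries_limit (a : nat -> C) (l : C) (b : nat -> R) :
  (forall n, Cmod (l - Csum a n)%C <= b n) -> is_lim_seq b 0 -> CSeries a = l.
Proof.
move=> H B.
(* [Csum a n] has [n] terms while [sum_n] up to [n] has [n + 1], hence the shift. *)
have B' : is_lim_seq (fun n => b (S n)) 0 by have := proj1 (is_lim_seq_incr_1 b 0) B.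
rewrite /CSeries [l]surjective_pairing; f_equal; apply: is_series_unique.
- change (is_lim_seq (sum_n (fun n => Re (a n))) (Re l)).
  apply: (is_lim_seq_le_le (fun n => Re l - b (S n)) _ (fun n => Re l + b (S n))).
  + move=> n; rewrite -Csum_Re; have := Rle_trans _ _ _ (re_le_Cmod _) (H (S n)).
    change (Rabs (Re l - Re (Csum a (S n))) <= b (S n) -> Re l - b (S n) <= Re (Csum a (S n)) <= Re l + b (S n)).
    by move=> /Rabs_le_between; lra.
  + rewrite -{2}(Rminus_0_r (Re l)); apply: is_lim_seq_minus' => //; exact: is_lim_seq_const.
  + rewrite -{2}(Rplus_0_r (Re l)); apply: is_lim_seq_plus' => //; exact: is_lim_seq_const.
- change (is_lim_seq (sum_n (fun n => Im (a n))) (Im l)).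
  apply: (is_lim_seq_le_le (fun n => Im l - b (S n)) _ (fun n => Im l + b (S n))).
  + move=> n; rewrite -Csum_Im; have := Rle_trans _ _ _ (im_le_Cmod _) (H (S n)).
    change (Rabs (Im l - Im (Csum a (S n))) <= b (S n) -> Im l - b (S n) <= Im (Csum a (S n)) <= Im l + b (S n)).
    by move=> /Rabs_le_between; lra.
  + rewrite -{2}(Rminus_0_r (Im l)); apply: is_lim_seq_minus' => //; exact: is_lim_seq_const.
  + rewrite -{2}(Rplus_0_r (Im l)); apply: is_lim_seq_plus' => //; exact: is_lim_seq_const.
Qed.

Definition CPS (a : nat -> C) (h : C) : C := CSeries (fun n => a n * h ^ n)%C.

(** Going through the real radius of convergence of the moduli gives access to the real results on
    formal derivatives and on shifted coefficients. *)
Definition rad (a : nat -> C) (r : R) : Prop :=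
  Rbar_le (Finite r) (CV_radius (fun n => Cmod (a n))).

Lemma rad_ex (a : nat -> C) (r x : R) : rad a r -> 0 <= x < r ->
  ex_series (fun n => Cmod (a n) * x ^ n).
Proof.
move=> Hr Hx.
have := CV_disk_inside (fun n => Cmod (a n)) x.
move=> /(_ _) H; apply: ex_series_Rabs; apply: H.
apply: Rbar_lt_le_trans Hr; rewrite Rabs_pos_eq /=; lra.
Qed.

Lemma rad_cabs (a : nat -> C) (r : R) (h : C) : rad a r -> Cmod h < r ->
  cabs (fun n => a n * h ^ n)%C.
Proof.
move=> Hr Hx; apply: (cabs_le _ (fun n => Cmod (a n) * Cmod h ^ n)).
  by move=> n; rewrite Cmod_mult Cmod_pow; lra.
by apply: rad_ex Hr _; split=> //; apply: Cmod_ge_0.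
Qed.

Definition dS (a : nat -> C) (n : nat) : C := (INR (S n) * a (S n))%C.

Lemma rad_dS (a : nat -> C) (r : R) : rad a r -> rad (dS a) r.
Proof.
rewrite /rad -(CV_radius_derive (fun n => Cmod (a n))).
congr (Rbar_le _ _); apply: CV_radius_ext => n.
by rewrite /dS /PS_derive Cmod_mult Cmod_R Rabs_pos_eq //; apply: pos_INR.
Qed.

Lemma rad_S (a : nat -> C) (r : R) : rad a r -> rad (fun n => a (S n)) r.
Proof. by rewrite /rad -(CV_radius_decr_1 (fun n => Cmod (a n))). Qed.

Lemma rad_bounded (a : nat -> C) (r M : R) : 0 <= r ->
  (forall n, Cmod (a n) * r ^ n <= M) -> rad a r.
Proof.
move=> Hr H; have [U _] := CV_radius_bounded (fun n => Cmod (a n)).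
apply: U; exists M => n; rewrite Rabs_pos_eq //.
by apply: Rmult_le_pos; [apply: Cmod_ge_0 | apply: pow_le].
Qed.

(** The sharp constant would be half of this one; the product of the two integers is the coefficient
    that appears in the second formal derivative [dS (dS a)]. *)
Lemma pow_second_order (h e : C) (r : R) n : Cmod h <= r -> Cmod (h + e)%C <= r ->
  Cmod ((h + e) ^ (S (S n)) - h ^ (S (S n)) - INR (S (S n)) * e * h ^ (S n))%C <=
  Cmod e * Cmod e * (INR (S (S n)) * INR (S n) * r ^ n).
Proof.
move=> H1 H2; have r0 : 0 <= r by apply: Rle_trans H1; apply: Cmod_ge_0.
elim: n => [|n IH].
  have -> : ((h + e) ^ 2 - h ^ 2 - INR 2 * e * h ^ 1)%C = (e * e)%C.
    by rewrite /= RtoC_plus; ring.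
  rewrite Cmod_mult /=.
  have : 0 <= Cmod e * Cmod e by apply: Rmult_le_pos; apply: Cmod_ge_0.
  lra.
have -> : ((h + e) ^ (S (S (S n))) - h ^ (S (S (S n))) - INR (S (S (S n))) * e * h ^ (S (S n)) =
  (h + e) * ((h + e) ^ (S (S n)) - h ^ (S (S n)) - INR (S (S n)) * e * h ^ (S n)) +
  (INR (S (S n)) * (e * e)) * h ^ (S n))%C.
  by rewrite (S_INR (S (S n))) RtoC_plus; simpl Cpow; ring.
apply: Rle_trans (Cmod_triangle _ _) _.
rewrite (Cmod_mult (h + e)) (Cmod_mult (_ * _)%C) (Cmod_mult (INR _)) Cmod_mult Cmod_R Cmod_pow.
rewrite (Rabs_pos_eq (INR _)); last exact: pos_INR.
set D := Cmod (_ - _)%C in IH *.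
set E := Cmod e * Cmod e in IH *.
have E0 : 0 <= E by apply: Rmult_le_pos; apply: Cmod_ge_0.
have T1 : Cmod (h + e)%C * D <= r * (E * (INR (S (S n)) * INR (S n) * r ^ n)).
  by apply: Rmult_le_compat => //; apply: Cmod_ge_0.
have T2 : Cmod h ^ (S n) <= r ^ (S n) by apply: pow_incr; split=> //; apply: Cmod_ge_0.
have T3 : INR (S (S n)) * E * Cmod h ^ (S n) <= INR (S (S n)) * E * r ^ (S n).
  by apply: Rmult_le_compat_l => //; apply: Rmult_le_pos => //; apply: pos_INR.
have -> : E * (INR (S (S (S n))) * INR (S (S n)) * r ^ (S n)) =
   r * (E * (INR (S (S n)) * INR (S n) * r ^ n)) + INR (S (S n)) * E * r ^ (S n) + INR (S (S n)) * E * r ^ (S n).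
  rewrite (S_INR (S (S n))) (S_INR (S n)) /=; ring.
have : 0 <= INR (S (S n)) * E * r ^ (S n).
  by apply: Rmult_le_pos; [apply: Rmult_le_pos => //; apply: pos_INR | apply: pow_le].
lra.
Qed.

Lemma CPS_cder (a : nat -> C) (r : R) (h : C) : rad a r -> Cmod h < r ->
  cder (CPS a) h (CPS (dS a) h).
Proof.
move=> Hr Hh eps He.
(* A radius strictly between [|h|] and [r], at which the second formal derivative still converges
   absolutely. *)
set x := (Cmod h + r) / 2.
have h0 := Cmod_ge_0 h.
have Hx : Cmod h < x < r by rewrite /x; lra.
have S2 : ex_series (fun n => Cmod (dS (dS a) n) * x ^ n).
  by apply: rad_ex (rad_dS _ _ (rad_dS _ _ Hr)) _; lra.
set M := Series (fun n => Cmod (dS (dS a) n) * x ^ n).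
have M0 : 0 <= M.
  apply: Series_ge0 => // n.
  by apply: Rmult_le_pos; [exact: Cmod_ge_0 | apply: pow_le; lra].
exists (Rmin (x - Cmod h) (eps / (M + 1))); split.
  by apply: Rmin_glb_lt; [lra | apply: Rdiv_lt_0_compat; lra].
move=> e Hee.
have He1 := Rlt_le_trans _ _ _ Hee (Rmin_l _ _).
have He2 := Rlt_le_trans _ _ _ Hee (Rmin_r _ _).
have Hhe : Cmod (h + e)%C < x by have := Cmod_triangle h e; lra.
have C1 : cabs (fun n => a n * (h + e) ^ n)%C by apply: rad_cabs Hr _; lra.
have C2 : cabs (fun n => a n * h ^ n)%C by apply: rad_cabs Hr _; lra.
have C3 : cabs (fun n => dS a n * h ^ n)%C by apply: rad_cabs (rad_dS _ _ Hr) _; lra.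
(* The terms of degree 0 and 1 have no second-order remainder, so the error series starts in degree
   2. *)
pose D n := (a (S (S n)) * ((h + e) ^ (S (S n)) - h ^ (S (S n)) - INR (S (S n)) * e * h ^ (S n)))%C.
have E : (CPS a (h + e) - CPS a h - e * CPS (dS a) h)%C = CSeries D.
  rewrite /CPS.
  have C1' := C1; have C2' := C2.
  move: C1' => /cabs_incr C1'; have /cabs_incr C1'' := C1'.
  move: C2' => /cabs_incr C2'; have /cabs_incr C2'' := C2'.
  have /cabs_incr C3' := C3.
  rewrite (CSeries_incr _ C1) (CSeries_incr _ C1') (CSeries_incr _ C2) (CSeries_incr _ C2') (CSeries_incr _ C3).
  have -> : CSeries D = (CSeries (fun n => a (S (S n)) * (h + e) ^ (S (S n))) +
    (RtoC (-1) * CSeries (fun n => a (S (S n)) * h ^ (S (S n))) + (- e) * CSeries (fun n => dS a (S n) * h ^ (S n))))%C.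
    rewrite -!CSeries_scal // -!CSeries_plus //; try by repeat apply: cabs_plus => //; apply: cabs_scal.
    apply: CSeries_ext => n; rewrite /D /dS; ring.
  rewrite /dS; simpl Cpow; simpl INR; ring.
rewrite E.
have B : forall n, Cmod (D n) <= Cmod e * Cmod e * (Cmod (dS (dS a) n) * x ^ n).
  move=> n; rewrite /D /dS !Cmod_mult !Cmod_R !Rabs_pos_eq; try exact: pos_INR.
  have := pow_second_order h e x n (Rlt_le _ _ (proj1 Hx)) (Rlt_le _ _ Hhe).
  move=> /(Rmult_le_compat_l (Cmod (a (S (S n)))) _ _ (Cmod_ge_0 _)) H.
  apply: Rle_trans H _; apply: Req_le; ring.
have S3 : ex_series (fun n => Cmod e * Cmod e * (Cmod (dS (dS a) n) * x ^ n)).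
  exact: (ex_series_scal_l (V := R_NormedModule)).
have CD : cabs D by apply: cabs_le B S3.
apply: Rle_trans (CSeries_bound _ CD) _.
apply: Rle_trans (Series_le _ _ _ S3) _.
  by move=> n; split; [apply: Cmod_ge_0 | apply: B].
rewrite Series_scal_l -/M.
have e0 := Cmod_ge_0 e.
have : Cmod e * (M + 1) <= eps.
  have -> : eps = eps / (M + 1) * (M + 1) by field; lra.
  apply: Rmult_le_compat_r; lra.
nra.
Qed.

Lemma CPS_0 (a : nat -> C) (r : R) : 0 < r -> rad a r -> CPS a 0%C = a O.
Proof.
move=> r0 Hr; rewrite /CPS CSeries_incr; last by apply: rad_cabs Hr _; rewrite Cmod_0.
rewrite (CSeries_ext _ (fun n => 0 * (a (S n) * 0 ^ n))%C); last by move=> n /=; ring.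
rewrite CSeries_scal /=; first ring.
by apply: rad_cabs (rad_S _ _ Hr) _; rewrite Cmod_0.
Qed.

Lemma CPS_S (a : nat -> C) (r : R) (h : C) : rad a r -> Cmod h < r ->
  CPS a h = (a O + h * CPS (fun n => a (S n)) h)%C.
Proof.
move=> Hr Hh; rewrite /CPS CSeries_incr; last exact: rad_cabs Hr _.
rewrite -CSeries_scal; last by apply: rad_cabs (rad_S _ _ Hr) _.
rewrite /= Cmult_1_r; f_equal; apply: CSeries_ext => n; ring.
Qed.

Lemma ccont_eq0 (f : C -> C) (z : C) (r : R) : 0 < r -> ccont f z ->
  (forall h : C, h <> 0%C -> Cmod h < r -> f (z + h)%C = 0%C) -> f z = 0%C.
Proof.
move=> r0 F H; apply: NNPP => N.
have [d [Hd D]] := ccont_nonzero _ _ F N.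
pose t := Rmin d r / 2.
have t0 : 0 < Rmin d r by apply: Rmin_glb_lt.
have := Rmin_l d r; have := Rmin_r d r => t1 t2.
have Ct : Cmod (RtoC t) = t by rewrite Cmod_R Rabs_pos_eq // /t; lra.
apply: (D (RtoC t)); first by rewrite Ct /t; lra.
apply: H; last by rewrite Ct /t; lra.
by apply/Cmod_gt_0; rewrite Ct /t; lra.
Qed.

Lemma Cmult_integral (z w : C) : (z * w)%C = 0%C -> z = 0%C \/ w = 0%C.
Proof.
move=> E; case: (classic (z = RtoC 0)) => [|N1]; first by left.
case: (classic (w = RtoC 0)) => [|N2]; first by right.
by case: (Cmult_neq_0 _ _ N1 N2).
Qed.

(** The constant term is the value at 0. After dividing by [h] the shifted series vanishes for
    [h <> 0], and by continuity at 0 too, so the induction continues with it. *)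
Lemma CPS_unique (a : nat -> C) (r s : R) : 0 < s <= r -> rad a r ->
  (forall h, Cmod h < s -> CPS a h = 0%C) -> forall n, a n = 0%C.
Proof.
move=> [s0 sr] Hr H n; have r0 : 0 < r by lra.
elim: n a Hr H => [|n IH] a Hr H.
  by rewrite -(CPS_0 a r) // H // Cmod_0.
apply: (IH (fun n => a (S n))); first exact: rad_S.
have a0 : a O = 0%C by rewrite -(CPS_0 a r) // H // Cmod_0.
have Z : forall h : C, h <> 0%C -> Cmod h < s -> CPS (fun n => a (S n)) h = 0%C.
  move=> h Nh Hh.
  have := H h Hh; rewrite (CPS_S a r) //; last lra.
  rewrite a0 Cplus_0_l => E.
  by case: (Cmult_integral _ _ E).
move=> h Hh; case: (classic (h = 0%C)) => [->|Nh]; last exact: Z.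
apply: (ccont_eq0 _ _ s) => //.
  apply: cder_cont; apply: (CPS_cder _ r); first exact: rad_S.
  by rewrite Cmod_0.
by move=> e; rewrite Cplus_0_l; apply: Z.
Qed.

(** * Local power series and the identity theorem *)

Lemma exI_bounded (f : R -> C) (a b : R) : exI f a b ->
  exists M, forall t, Rmin a b <= t <= Rmax a b -> Cmod (f t) <= M.
Proof.
move=> /(@ex_RInt_ub C_R_NormedModule) [M H]; exists M => t /H.
by rewrite -Cmod_norm.
Qed.

Lemma edges_bounded (f : C -> C) (a b c d : R) : edges f a b c d ->
  exists M, forall z, bdry a b c d z -> Cmod (f z) <= M.
Proof.
move=> [/exI_bounded [M1 H1] [/exI_bounded [M2 H2] [/exI_bounded [M3 H3] /exI_bounded [M4 H4]]]].
exists (Rmax (Rmax M1 M2) (Rmax M3 M4)) => -[x y] [[/= Hx Hy] O].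
have := Rmax_l (Rmax M1 M2) (Rmax M3 M4); have := Rmax_r (Rmax M1 M2) (Rmax M3 M4).
have := Rmax_l M1 M2; have := Rmax_r M1 M2; have := Rmax_l M3 M4; have := Rmax_r M3 M4.
case: O => [E|[E|[E|E]]]; move: Hx Hy; rewrite E => Hx Hy.
- have := H3 y Hy; lra.
- have := H4 y Hy; lra.
- have := H1 x Hx; lra.
- have := H2 x Hx; lra.
Qed.

Definition square_bdry (w : C) (s : R) : C -> Prop :=
  bdry (Re w - s) (Re w + s) (Im w - s) (Im w + s).

Definition square_int (f : C -> C) (w : C) (s : R) : C :=
  rect_int f (Re w - s) (Re w + s) (Im w - s) (Im w + s).

Definition square_edges (f : C -> C) (w : C) (s : R) : Prop :=
  edges f (Re w - s) (Re w + s) (Im w - s) (Im w + s).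

Lemma square_bdry_far (w z : C) (s : R) : 0 < s -> square_bdry w s z -> s <= Cmod (z - w)%C.
Proof.
move=> s0 [_ O].
have R1 : Rabs (Re z - Re w) <= Cmod (z - w)%C := re_le_Cmod (z - w)%C.
have R2 : Rabs (Im z - Im w) <= Cmod (z - w)%C := im_le_Cmod (z - w)%C.
move: R1 R2; rewrite /Rabs; repeat case: Rcase_abs; lra.
Qed.

Lemma ccont_shifted (w z : C) : ccont (fun z => z - w)%C z.
Proof. apply: ccont_minus; [exact: ccont_id | exact: ccont_const]. Qed.

Section KernelSeries.
Context (phi : C -> C) (w : C) (s M : R) (s0 : 0 < s)
  (phic : forall z, square_bdry w s z -> ccont phi z)
  (phiM : forall z, square_bdry w s z -> Cmod (phi z) <= M).

Let coef k := square_int (fun z => phi z / (z - w) ^ S k)%C w s.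

Let far z : square_bdry w s z -> (z - w)%C <> 0%C.
Proof. move=> /(square_bdry_far _ _ _ s0) H; apply/Cmod_gt_0; lra. Qed.

Let far_h z h : Cmod h < s -> square_bdry w s z -> (z - w - h)%C <> 0%C.
Proof.
move=> Hh /(square_bdry_far _ _ _ s0) H; apply/Cmod_gt_0.
have := Cmod_triangle_rev (z - w)%C h; lra.
Qed.

Let M0 : 0 <= M.
Proof.
apply: Rle_trans (phiM (Re w - s, Im w - s) _); first exact: Cmod_ge_0.
split; last by left.
by rewrite /rect !Rmin_left ?Rmax_right /=; lra.
Qed.

Let esq_coef k : square_edges (fun z => phi z / (z - w) ^ S k)%C w s.
Proof.
apply: edges_cont => z Hz; apply: ccont_div; first exact: phic.
  apply: ccont_pow; exact: ccont_shifted.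
by apply: Cpow_nz; apply: far.
Qed.

Let esq_rem n h : Cmod h < s -> square_edges (fun z => phi z / ((z - w) ^ n * (z - w - h)))%C w s.
Proof.
move=> Hh; apply: edges_cont => z Hz; apply: ccont_div; first exact: phic.
  apply: ccont_mult; first by apply: ccont_pow; apply: ccont_shifted.
  apply: ccont_minus; [exact: ccont_shifted | exact: ccont_const].
by apply: Cmult_neq_0; [apply: Cpow_nz; apply: far | apply: far_h].
Qed.

(** The factor [8 * s] is the perimeter of the square. *)
Let square_int_bound f K : square_edges f w s -> (forall z, square_bdry w s z -> Cmod (f z) <= K) ->
  Cmod (square_int f w s) <= 8 * s * K.
Proof.
move=> E B; have := rect_int_bound f (Re w - s) (Re w + s) (Im w - s) (Im w + s) K
   ltac:(lra) ltac:(lra) E B.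
move=> H; apply: Rle_trans H _; apply: Req_le; ring.
Qed.

Lemma kernel_rad : rad coef s.
Proof.
apply: (rad_bounded _ _ (8 * M)); first lra.
move=> n.
have sn : 0 < s ^ n by apply: pow_lt.
have : Cmod (coef n) <= 8 * s * (M / s ^ S n).
  apply: square_int_bound => // z Hz.
  have H := square_bdry_far _ _ _ s0 Hz.
  rewrite Cmod_div; last by apply: Cpow_nz; apply: far.
  rewrite Cmod_pow.
  have P1 : s ^ S n <= Cmod (z - w)%C ^ S n by apply: pow_incr; lra.
  have P0 : 0 < s ^ S n by apply: pow_lt.
  apply: Rmult_le_compat; [exact: Cmod_ge_0 | by apply/Rlt_le/Rinv_0_lt_compat; lra | exact: phiM |].
  by apply: Rinv_le_contravar.
move=> /(Rmult_le_compat_r (s ^ n) _ _ (Rlt_le _ _ sn)) H.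
apply: Rle_trans H _; apply: Req_le; rewrite /=; field.
split; lra.
Qed.

(** The geometric expansion of 1 / (z - w - h) is used with its exact remainder after [n] terms, h^n
    / ((z - w)^n (z - w - h)). Only finite sums are integrated, so no exchange of a limit with an
    integral occurs. *)
Lemma kernel_series (h : C) : Cmod h < s ->
  square_int (fun z => phi z / (z - (w + h)))%C w s = CPS coef h.
Proof.
move=> Hh; symmetry.
have h0 := Cmod_ge_0 h.
pose b n := 8 * s * (M / (s - Cmod h)) * (Cmod h / s) ^ n.
have q1 : 0 <= Cmod h / s by apply: Rdiv_le_0_compat.
have q2 : Cmod h / s < 1.
  by apply: (Rmult_lt_reg_r s) => //; rewrite /Rdiv Rmult_assoc Rinv_l; lra.
apply: (CSeries_limit _ _ b); last first.
  rewrite -(Rmult_0_r (8 * s * (M / (s - Cmod h)))).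
  apply: (is_lim_seq_scal_l _ _ 0); apply: is_lim_seq_geom.
  by rewrite Rabs_pos_eq.
have rem : forall n, (square_int (fun z => phi z / (z - (w + h))) w s - Csum (fun k => coef k * h ^ k) n)%C =
   (h ^ n * square_int (fun z => phi z / ((z - w) ^ n * (z - w - h))) w s)%C.
  elim=> [|n IH].
    have S0 : forall x : C, (x - 0)%C = x by move=> x; ring.
    rewrite S0 Cmult_1_l.
    apply: rect_int_ext => z Hz; by have -> : (z - (w + h) = 1 * (z - w - h))%C by ring.
  have -> : (square_int (fun z => phi z / (z - (w + h))) w s - Csum (fun k => coef k * h ^ k) (S n) =
    (square_int (fun z => phi z / (z - (w + h))) w s - Csum (fun k => coef k * h ^ k) n) - coef n * h ^ n)%C.
    by simpl Csum; ring.
  rewrite IH.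
  have -> : square_int (fun z => phi z / ((z - w) ^ n * (z - w - h)))%C w s =
    (coef n + h * square_int (fun z => phi z / ((z - w) ^ (S n) * (z - w - h))) w s)%C.
    rewrite /coef /square_int -rect_int_scal; last exact: esq_rem.
    rewrite -rect_int_plus; [|exact: esq_coef|by apply: edges_scal; apply: esq_rem].
    apply: rect_int_ext => z Hz; have N1 := far z Hz; have N2 := far_h z h Hh Hz.
    have N3 := Cpow_nz _ n N1.
    simpl Cpow; field; repeat split => //.
  simpl Cpow; ring.
move=> n; rewrite rem Cmod_mult Cmod_pow.
have -> : b n = Cmod h ^ n * (8 * s * (M / (s ^ n * (s - Cmod h)))).
  rewrite /b /Rdiv Rpow_mult_distr pow_inv; field.
  by repeat split; try (apply: pow_nonzero; lra); lra.
apply: Rmult_le_compat_l; first exact: pow_le.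
apply: square_int_bound; first exact: esq_rem.
move=> z Hz; have H := square_bdry_far _ _ _ s0 Hz.
have N1 := far z Hz; have N2 := far_h z h Hh Hz.
rewrite Cmod_div; last by apply: Cmult_neq_0 => //; apply: Cpow_nz.
rewrite Cmod_mult Cmod_pow.
have P1 : s ^ n <= Cmod (z - w)%C ^ n by apply: pow_incr; lra.
have P0 : 0 < s ^ n by apply: pow_lt.
have P2 : s - Cmod h <= Cmod (z - w - h)%C.
  have := Cmod_triangle_rev (z - w)%C h; lra.
have P3 : 0 < s ^ n * (s - Cmod h) by apply: Rmult_lt_0_compat; lra.
have P4 : s ^ n * (s - Cmod h) <= Cmod (z - w)%C ^ n * Cmod (z - w - h)%C.
  apply: Rmult_le_compat; lra.
apply: Rmult_le_compat; [exact: Cmod_ge_0 | by apply/Rlt_le/Rinv_0_lt_compat; lra | exact: phiM |].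
by apply: Rinv_le_contravar.
Qed.

End KernelSeries.

(* Near [w] a holomorphic function is the quotient of the two power series representing
   the Cauchy integrals of [f] and of [1], so the value [2 pi i] of the latter is never needed. *)
Lemma holo_quotient_series (f : C -> C) (w : C) (s : R) : 0 < s ->
  (forall z, Rabs (Re z - Re w) <= s -> Rabs (Im z - Im w) <= s -> exists l, cder f z l) ->
  exists a b : nat -> C, rad a s /\ rad b s /\
    forall h, Cmod h < s -> CPS b h <> 0%C /\ (f (w + h) * CPS b h)%C = CPS a h.
Proof.
move=> s0 D.
have D' : forall z, rect (Re w - s) (Re w + s) (Im w - s) (Im w + s) z -> exists l, cder f z l.
  move=> z; rewrite /rect !Rmin_left ?Rmax_right; try lra.
  by move=> [Hx Hy]; apply: D; apply: Rabs_le; lra.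
have Fc : forall z, square_bdry w s z -> ccont f z.
  by move=> z [/D' [l Hl] _]; apply: cder_cont Hl.
have [M HM] := edges_bounded f _ _ _ _ (edges_cont _ _ _ _ _ Fc).
have Oc : forall z, square_bdry w s z -> ccont (fun _ => RtoC 1) z.
  by move=> z _; apply: ccont_const.
have OM : forall z, square_bdry w s z -> Cmod (RtoC 1) <= 1.
  by move=> z _; rewrite Cmod_1; lra.
exists (fun k => square_int (fun z => f z / (z - w) ^ S k)%C w s).
exists (fun k => square_int (fun z => 1 / (z - w) ^ S k)%C w s).
split; first exact: (kernel_rad _ _ _ M).
split; first exact: (kernel_rad (fun _ => RtoC 1) _ _ 1).
move=> h Hh.
rewrite -(kernel_series f w s M) // -(kernel_series (fun _ => RtoC 1) w s 1) //.
have := re_le_Cmod h; have := im_le_Cmod h => h1 h2.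
have I1 : Re w - s < Re (w + h)%C < Re w + s.
  change (Re w - s < Re w + Re h < Re w + s); move: h2; rewrite /Rabs; case: Rcase_abs; lra.
have I2 : Im w - s < Im (w + h)%C < Im w + s.
  change (Im w - s < Im w + Im h < Im w + s); move: h1; rewrite /Rabs; case: Rcase_abs; lra.
split; first exact: rect_int_kernel_neq_0.
by rewrite /square_int (cauchy_formula f).
Qed.

Lemma UHP_square (w z : C) : UHP w -> Rabs (Im z - Im w) <= Im w / 2 -> UHP z.
Proof. rewrite /UHP => H; rewrite /Rabs; case: Rcase_abs; lra. Qed.

Definition hol (f : C -> C) : Prop := forall z, UHP z -> exists l, cder f z l.

Lemma holo_hol (f : C -> C) : holo f <-> hol f.
Proof. by split=> H z /H /cder_ex. Qed.

Lemma hol_quotient_series (f : C -> C) (w : C) : hol f -> UHP w ->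
  exists a b : nat -> C, rad a (Im w / 2) /\ rad b (Im w / 2) /\
    forall h, Cmod h < Im w / 2 -> CPS b h <> 0%C /\ (f (w + h) * CPS b h)%C = CPS a h.
Proof.
move=> F W; apply: holo_quotient_series; first by rewrite /UHP in W; lra.
by move=> z _ H; apply: F; apply: UHP_square H.
Qed.

(** Around [w] the function is a quotient of power series, so on the whole disc its derivative is
    the explicit quotient [g], made of power series as well and therefore differentiable at the
    centre. *)
Lemma hol_derive (f : C -> C) : hol f -> hol (C_derive f).
Proof.
move=> F w W; set s := Im w / 2.
have s0 : 0 < s by rewrite /s; rewrite /UHP in W; lra.
have [a [b [Ra [Rb H]]]] := hol_quotient_series f w F W.
pose g h := ((CPS (dS a) h * CPS b h - CPS a h * CPS (dS b) h) / (CPS b h * CPS b h))%C.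
have Hg : forall h, Cmod h < s -> cder (fun h => CPS a h / CPS b h)%C h (g h).
  move=> h Hh; apply: cder_div; try exact: (CPS_cder _ s).
  by case: (H h Hh).
have Ef : forall h, Cmod h < s -> f (w + h)%C = (CPS a h / CPS b h)%C.
  move=> h Hh; have [N <-] := H h Hh; field; exact: N.
have Eg : forall h, Cmod h < s -> C_derive f (w + h)%C = g h.
  move=> h Hh; apply: cder_C_derive; apply/cder_shift.
  apply: (cder_ext_loc (fun h => CPS a h / CPS b h)%C _ _ _ (s - Cmod h)); first lra; last exact: Hg.
  move=> e He; rewrite Ef //; have := Cmod_triangle h e; lra.
have z0 : Cmod 0%C < s by rewrite Cmod_0.
have [N _] := H _ z0.
have [m Hm] : exists m, cder g 0%C m.
  eexists; apply: cder_div.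
  - apply: cder_minus; apply: cder_mult.
    + exact: (CPS_cder _ s (RtoC 0) (rad_dS _ _ Ra) z0).
    + exact: (CPS_cder _ s (RtoC 0) Rb z0).
    + exact: (CPS_cder _ s (RtoC 0) Ra z0).
    + exact: (CPS_cder _ s (RtoC 0) (rad_dS _ _ Rb) z0).
  - apply: cder_mult; exact: (CPS_cder _ s (RtoC 0) Rb z0).
  - exact: Cmult_neq_0.
exists m; rewrite -(Cplus_0_r w); apply/cder_shift.
apply: (cder_ext_loc g _ _ _ s) => // h Hh.
by rewrite Cplus_0_l Eg.
Qed.

Definition vanish_near (f : C -> C) (w : C) : Prop :=
  exists d, 0 < d /\ forall h, Cmod h < d -> f (w + h)%C = 0%C.

(** The numerator series vanishes near 0, so all its coefficients do, and [f] vanishes on a disc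
    whose radius depends only on [Im w], no matter how small [d] was. The chain of discs below
    relies on this uniformity. *)
Lemma vanish_near_disc (f : C -> C) (w : C) : hol f -> UHP w -> vanish_near f w ->
  forall h, Cmod h < Im w / 2 -> f (w + h)%C = 0%C.
Proof.
move=> F W [d [d0 Hd]] h Hh.
have s0 : 0 < Im w / 2 by rewrite /UHP in W; lra.
have [a [b [Ra [Rb H]]]] := hol_quotient_series f w F W.
have A0 : forall n, a n = 0%C.
  apply: (CPS_unique a (Im w / 2) (Rmin d (Im w / 2))) => //.
    by split; [apply: Rmin_glb_lt | apply: Rmin_r].
  move=> e He; have [_ <-] := H e (Rlt_le_trans _ _ _ He (Rmin_r _ _)).
  by rewrite Hd ?Cmult_0_l //; apply: Rlt_le_trans He (Rmin_l _ _).
have [N E] := H h Hh.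
have Z : CPS a h = 0%C.
  rewrite /CPS /CSeries; rewrite (Series_ext _ (fun _ => 0 * 0)); last by move=> n; rewrite A0 /=; ring.
  rewrite (Series_ext (fun n => Im _) (fun _ => 0 * 0)); last by move=> n; rewrite A0 /=; ring.
  by rewrite Series_scal_l Rmult_0_l.
by rewrite Z in E; case: (Cmult_integral _ _ E).
Qed.

Lemma vanish_disc_near (f : C -> C) (w z : C) (s : R) :
  (forall h, Cmod h < s -> f (w + h)%C = 0%C) -> Cmod (z - w)%C < s -> vanish_near f z.
Proof.
move=> H Hz; exists (s - Cmod (z - w)%C); split; first lra.
move=> h Hh; have -> : (z + h = w + ((z - w) + h))%C by ring.
apply: H; have := Cmod_triangle (z - w)%C h; lra.
Qed.

(** On the segment from [w] to [z] the imaginary part stays at least [m], so [vanish_near_disc]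
    applies with radius at least [m / 2] at each of the points [p k], whose spacing is below
    [m / 2]. *)
Lemma identity_theorem (f : C -> C) (w : C) : hol f -> UHP w -> vanish_near f w ->
  forall z, UHP z -> f z = 0%C.
Proof.
move=> F W V z Z.
set m := Rmin (Im w) (Im z).
have m0 : 0 < m by apply: Rmin_glb_lt.
have [N HN] : exists N : nat, Cmod (z - w)%C / INR (S N) < m / 2.
  have [N [HN N0]] := archimed_cor1 (m / 2 / (Cmod (z - w)%C + 1))
    ltac:(apply: Rdiv_lt_0_compat; [lra | have := Cmod_ge_0 (z - w)%C; lra]).
  have c0 := Cmod_ge_0 (z - w)%C.
  have iN : 0 < INR (S N) by apply: lt_0_INR; lia.
  exists N.
  have H1 : / INR (S N) <= / INR N.

    apply: Rinv_le_contravar; first by apply: lt_0_INR; lia.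
    by apply: le_INR; lia.
  have H2 : / INR (S N) < m / 2 / (Cmod (z - w)%C + 1) by lra.
  have H3 : (Cmod (z - w)%C + 1) * / INR (S N) < m / 2.
    have -> : m / 2 = (Cmod (z - w)%C + 1) * (m / 2 / (Cmod (z - w)%C + 1)) by field; lra.
    by apply: Rmult_lt_compat_l; lra.
  have : 0 < / INR (S N) by apply: Rinv_0_lt_compat.
  rewrite /Rdiv; nra.
have iN : 0 < INR (S N) by apply: lt_0_INR; lia.
pose p k := (w + RtoC (INR k / INR (S N)) * (z - w))%C.
have Hp : forall k, (k <= S N)%nat -> m <= Im (p k).
  move=> k Hk.
  have -> : Im (p k) = Im w + INR k / INR (S N) * (Im z - Im w) by rewrite /p; move: (_ / _) => t; case: (w) => ? ?; case: (z) => ? ? /=; ring.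
  have : 0 <= INR k / INR (S N) <= 1.
    split; first by apply: Rdiv_le_0_compat => //; apply: pos_INR.
    apply: (Rmult_le_reg_r (INR (S N))) => //.
    rewrite /Rdiv Rmult_assoc Rinv_l; last lra.
    by rewrite Rmult_1_r Rmult_1_l; apply: le_INR.
  move: (INR k / INR (S N)) => t Ht.
  have := Rmin_l (Im w) (Im z); have := Rmin_r (Im w) (Im z); rewrite -/m; nra.
have Vp : forall k, (k <= S N)%nat -> vanish_near f (p k).
  elim=> [|k IH] Hk.
    have -> : p O = w by rewrite /p /= /Rdiv Rmult_0_l Cmult_0_l Cplus_0_r.
    exact: V.
  have Hk' : (k <= S N)%nat by lia.
  have U : UHP (p k) by rewrite /UHP; have := Hp k Hk'; lra.
  apply: (vanish_disc_near _ (p k) _ (Im (p k) / 2)); first by apply: vanish_near_disc => //; apply: IH.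
  have -> : (p (S k) - p k = RtoC (/ INR (S N)) * (z - w))%C.
    rewrite /p S_INR.
    have -> : (INR k + 1) / INR (S N) = INR k / INR (S N) + / INR (S N) by field; lra.
    by rewrite RtoC_plus; ring.
  rewrite Cmod_mult Cmod_R Rabs_pos_eq; last by apply/Rlt_le/Rinv_0_lt_compat.
  have := Hp k Hk'; rewrite Rmult_comm; rewrite /Rdiv in HN; lra.
have [d [d0 Hd]] := Vp (S N) (Nat.le_refl _).
have := Hd 0%C; rewrite Cmod_0 Cplus_0_r => /(_ d0).
have -> : p (S N) = z.
  rewrite /p; have -> : INR (S N) / INR (S N) = 1 by field; lra.
  ring.
by [].
Qed.

Lemma hol_integral (f g : C -> C) : hol f -> hol g ->
  (forall z, UHP z -> (f z * g z)%C = 0%C) ->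
  (forall z, UHP z -> f z = 0%C) \/ (forall z, UHP z -> g z = 0%C).
Proof.
move=> F G H.
case: (classic (forall z, UHP z -> f z = 0%C)) => [|N]; first by left.
right.
have [w W] : exists w, ~ (UHP w -> f w = 0%C) by apply: not_all_ex_not.
have [W1 W2] := imply_to_and _ _ W.
have [l Hl] := F w W1.
have [d [d0 Hd]] := ccont_nonzero _ _ (cder_cont _ _ _ Hl) W2.
apply: (identity_theorem g w) => //.
have w0 : 0 < Im w by [].
exists (Rmin d (Im w)); split; first exact: Rmin_glb_lt.
move=> h Hh.
have h1 := Rlt_le_trans _ _ _ Hh (Rmin_l _ _); have h2 := Rlt_le_trans _ _ _ Hh (Rmin_r _ _).
have U : UHP (w + h)%C.
  change (0 < Im w + Im h); have := im_le_Cmod h; rewrite /Rabs; case: Rcase_abs; lra.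
have := H _ U => /Cmult_integral [E|//].
by case: (Hd h h1).
Qed.

(** * Convolution sums of divisor functions *)

Definition Lsum {T : Type} (l : list T) (f : T -> R) : R := fold_right Rplus 0 (map f l).

Lemma Lsum_cons {T : Type} (x : T) (l : list T) (f : T -> R) : Lsum (x :: l) f = f x + Lsum l f.
Proof. by []. Qed.

Lemma Lsum_app {T : Type} (l1 l2 : list T) (f : T -> R) :
  Lsum (l1 ++ l2) f = Lsum l1 f + Lsum l2 f.
Proof.
elim: l1 => [|x l IH]; first by rewrite /= {2}/Lsum /=; ring.
by rewrite -app_comm_cons !Lsum_cons IH; ring.
Qed.

Lemma Lsum_ext {T : Type} (l : list T) (f g : T -> R) :
  (forall x, In x l -> f x = g x) -> Lsum l f = Lsum l g.
Proof.
elim: l => [//|x l IH] H; rewrite !Lsum_cons IH; last by move=> y Hy; apply: H; right.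
by rewrite H //; left.
Qed.

Lemma Lsum_map {S T : Type} (h : S -> T) (l : list S) (f : T -> R) :
  Lsum (map h l) f = Lsum l (fun x => f (h x)).
Proof. by rewrite /Lsum map_map. Qed.

Lemma Lsum_plus {T : Type} (l : list T) (f g : T -> R) :
  Lsum l (fun x => f x + g x) = Lsum l f + Lsum l g.
Proof.
elim: l => [|x l IH]; first by rewrite /Lsum /=; ring.
by rewrite !Lsum_cons IH; ring.
Qed.

Lemma Lsum_scal {T : Type} (l : list T) (k : R) (f : T -> R) :
  Lsum l (fun x => k * f x) = k * Lsum l f.
Proof.
elim: l => [|x l IH]; first by rewrite /Lsum /=; ring.
by rewrite !Lsum_cons IH; ring.
Qed.

Lemma Lsum_filter {T : Type} (l : list T) (p : T -> bool) (f : T -> R) :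
  Lsum (filter p l) f = Lsum l (fun x => if p x then f x else 0).
Proof.
elim: l => [//|x l IH]; rewrite [filter _ _]/= Lsum_cons -IH.
by case: (p x); rewrite ?Lsum_cons //; ring.
Qed.

Lemma Lsum_prod {S T : Type} (l1 : list S) (l2 : list T) (f : S * T -> R) :
  Lsum (list_prod l1 l2) f = Lsum l1 (fun x => Lsum l2 (fun y => f (x, y))).
Proof.
elim: l1 => [//|x l IH]; by rewrite [list_prod _ _]/= Lsum_app Lsum_map Lsum_cons IH.
Qed.

Lemma Lsum_perm {T : Type} (l1 l2 : list T) (f : T -> R) :
  Permutation l1 l2 -> Lsum l1 f = Lsum l2 f.
Proof.
elim=> [//|x l l' _ IH|x y l|l m k _ -> _ ->] //; rewrite !Lsum_cons; first by rewrite IH.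
ring.
Qed.

Lemma Lsum_bij {S T : Type} (h : S -> T) (l1 : list S) (l2 : list T) (f : T -> R) :
  NoDup l1 -> NoDup l2 ->
  (forall x, In x l1 -> In (h x) l2) ->
  (forall x y, In x l1 -> In y l1 -> h x = h y -> x = y) ->
  (forall y, In y l2 -> exists x, In x l1 /\ h x = y) ->
  Lsum l1 (fun x => f (h x)) = Lsum l2 f.
Proof.
move=> N1 N2 H I J; rewrite -Lsum_map; apply: Lsum_perm; apply: NoDup_Permutation => //.
  exact: NoDup_map_NoDup_ForallPairs.
move=> y; split.
  by move=> /in_map_iff [x [<- Hx]]; apply: H.
by move=> /J [x [Hx <-]]; apply: in_map.
Qed.

Lemma NoDup_list_prod {S T : Type} (l1 : list S) (l2 : list T) :
  NoDup l1 -> NoDup l2 -> NoDup (list_prod l1 l2).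
Proof.
move=> H1 H2; elim: l1 H1 => [|x l IH] H /=; first by constructor.
move: H => /NoDup_cons_iff [Hx H]; apply: NoDup_app; last first.
- by move=> [a b] /in_map_iff [y [[<- <-] _]] /in_prod_iff [].
- exact: IH.
- by apply: NoDup_map_NoDup_ForallPairs => // y z _ _ [].
Qed.

Definition pairs (n : nat) : list (nat * nat) := list_prod (seq 1 n) (seq 1 n).

Lemma in_pairs n a x : In (a, x) (pairs n) <-> (1 <= a <= n /\ 1 <= x <= n)%nat.
Proof. rewrite in_prod_iff !in_seq; lia. Qed.

Lemma NoDup_pairs n : NoDup (pairs n).
Proof. by apply: NoDup_list_prod; apply: seq_NoDup. Qed.

(** The size [n] of the box is independent of the product [k], so that all terms of a convolution at
    [n] are sums over the same list [pairs n]. *)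
Definition dpairs (n k : nat) : list (nat * nat) :=
  filter (fun p => Nat.eqb (p.1 * p.2) k) (pairs n).

Lemma in_dpairs n k a x :
  In (a, x) (dpairs n k) <-> (1 <= a <= n /\ 1 <= x <= n /\ a * x = k)%nat.
Proof. rewrite filter_In in_pairs Nat.eqb_eq /=; tauto. Qed.

Lemma NoDup_dpairs n k : NoDup (dpairs n k).
Proof. by apply: NoDup_filter; apply: NoDup_pairs. Qed.

Lemma sigma_dpairs (j n k : nat) : (k <= n)%nat ->
  INR (Defs.sigma j k) = Lsum (dpairs n k) (fun p => INR p.1 ^ j).
Proof.
move=> Hk.
have -> : INR (Defs.sigma j k) = Lsum (filter (fun d => Nat.eqb (Nat.modulo k d) 0) (seq 1 k)) (fun d => INR d ^ j).
  rewrite Lsum_filter /Defs.sigma; elim: (seq 1 k) => [//|d l IH].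
  rewrite [map _ _]/= [fold_right _ _ _]/= plus_INR IH Lsum_cons.
  case: Nat.eqb; last by rewrite /=; ring.
  by rewrite pow_INR.
symmetry; apply: (Lsum_bij fst _ _ (fun d => INR d ^ j)).
- exact: NoDup_dpairs.
- by apply: NoDup_filter; apply: seq_NoDup.
- move=> [a x] /in_dpairs [H1 [H2 H3]]; apply/filter_In; rewrite /= in_seq Nat.eqb_eq.
  split; first nia.
  by rewrite -H3 Nat.mul_comm; apply: Nat.Div0.mod_mul.
- move=> [a x] [b y] /in_dpairs [H1 [H2 H3]] /in_dpairs [H4 [H5 H6]] /= E; subst b.
  f_equal; nia.
- move=> d /filter_In [/in_seq H1 /Nat.eqb_eq H2].
  have H3 := Nat.div_mod_eq k d.
  exists (d, Nat.div k d); split=> //; apply/in_dpairs.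
  rewrite H2 Nat.add_0_r in H3.
  repeat split; nia.
Qed.

Definition quads (n : nat) : list (nat * nat * (nat * nat)) :=
  filter (fun q => Nat.eqb (q.1.1 * q.1.2 + q.2.1 * q.2.2) n) (list_prod (pairs n) (pairs n)).

Lemma in_quads n a x b y : In ((a, x), (b, y)) (quads n) <->
  (1 <= a /\ 1 <= x /\ 1 <= b /\ 1 <= y /\ a * x + b * y = n)%nat.
Proof.
rewrite filter_In in_prod_iff !in_pairs Nat.eqb_eq /=.
split; first tauto.
move=> [H1 [H2 [H3 [H4 H5]]]]; repeat split => //; nia.
Qed.

Lemma NoDup_quads n : NoDup (quads n).
Proof. by apply: NoDup_filter; apply: NoDup_list_prod; apply: NoDup_pairs. Qed.

Lemma sum_f_R0_Lsum {T : Type} (l : list T) (F : nat -> T -> R) n :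
  sum_f_R0 (fun k => Lsum l (F k)) n = Lsum l (fun p => sum_f_R0 (fun k => F k p) n).
Proof.
elim: n => [//|n IH] /=; rewrite IH -Lsum_plus; by apply: Lsum_ext.
Qed.

Lemma sum_f_R0_single (c n : nat) (f : nat -> R) :
  sum_f_R0 (fun k => if Nat.eqb c k then f k else 0) n = if Nat.leb c n then f c else 0.
Proof.
elim: n => [|n IH] /=; first by case: c.
rewrite IH; case: (Nat.eqb_spec c (S n)) => [->|N].
  rewrite Nat.leb_refl (proj2 (Nat.leb_gt (S n) n)); [ring | lia].
case: (Nat.leb_spec c n) => H; case: (Nat.leb_spec c (S n)) => H'; try lia; ring.
Qed.

Definition conv (u v : nat -> R) (n : nat) : R := sum_f_R0 (fun k => u k * v (n - k)%nat) n.

Definition sig (j n : nat) : R := INR (Defs.sigma j n).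

(** For given pairs [(a, x)] and [(b, y)] only the index [k = a * x] contributes. The end terms
    [k = 0] and [k = n] of the convolution vanish because [sigma j 0 = 0], in agreement with the
    positivity of all entries of [quads n]. *)
Lemma conv_sigma_quads (i j n : nat) :
  conv (sig i) (sig j) n = Lsum (quads n) (fun q => INR q.1.1 ^ i * INR q.2.1 ^ j).
Proof.
rewrite /quads Lsum_filter Lsum_prod /conv.
rewrite (sum_eq _ (fun k => Lsum (pairs n) (fun p => Lsum (pairs n) (fun p' =>
   if Nat.eqb (p.1 * p.2) k then
     (if Nat.eqb (p'.1 * p'.2) (n - k) then INR p.1 ^ i * INR p'.1 ^ j else 0) else 0)))); last first.
  move=> k Hk; rewrite /sig (sigma_dpairs i n k) // (sigma_dpairs j n (n - k)); last lia.
  rewrite /dpairs !Lsum_filter Rmult_comm -Lsum_scal; apply: Lsum_ext => p _.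
  rewrite Rmult_comm -Lsum_scal; apply: Lsum_ext => p' _.
  case: Nat.eqb; case: Nat.eqb; ring.
rewrite sum_f_R0_Lsum; apply: Lsum_ext => p _.
rewrite sum_f_R0_Lsum; apply: Lsum_ext => p' _.
rewrite (sum_f_R0_single (p.1 * p.2) n
  (fun k => if Nat.eqb (p'.1 * p'.2) (n - k) then INR p.1 ^ i * INR p'.1 ^ j else 0)).
move: (p.1 * p.2)%nat (p'.1 * p'.2)%nat => s t /=.
case: (Nat.leb_spec s n) => H; case: (Nat.eqb_spec t (n - s)) => H'; case: (Nat.eqb_spec (s + t) n) => H'' //; lia.
Qed.

Lemma Lsum_trichotomy {T : Type} (l : list T) (u v : T -> nat) (f : T -> R) :
  Lsum l f = Lsum (filter (fun q => Nat.ltb (u q) (v q)) l) f +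
    (Lsum (filter (fun q => Nat.ltb (v q) (u q)) l) f + Lsum (filter (fun q => Nat.eqb (u q) (v q)) l) f).
Proof.
rewrite !Lsum_filter -!Lsum_plus; apply: Lsum_ext => q _.
case: (Nat.ltb_spec (u q) (v q)) => H1; case: (Nat.ltb_spec (v q) (u q)) => H2;
  case: (Nat.eqb_spec (u q) (v q)) => H3; try lia; ring.
Qed.

(* The decomposition [x > y], [x < y], [x = y] of the solutions of [ax + by = n] is matched with the
   decomposition [a < b], [a > b], [a = b] through [ax + by = a(x - y) + (a + b)y]. *)
Lemma quads_transform (g : R -> R -> R) (n : nat) :
  (forall a b, g a b = g b a) -> (forall a b, g a (b - a) = g b (a - b)) ->
  Lsum (quads n) (fun q => g (INR q.1.1) (INR q.2.1) - g (INR q.1.1) (INR q.2.1 - INR q.1.1)) =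
  Lsum (dpairs n n) (fun p => Lsum (seq 1 (p.1 - 1)) (fun a => g (INR a) (INR p.1 - INR a))
     - (INR p.2 - 1) * g (INR p.1) 0).
Proof.
move=> Hg HG.
have -> : Lsum (quads n) (fun q => g (INR q.1.1) (INR q.2.1) - g (INR q.1.1) (INR q.2.1 - INR q.1.1)) =
  Lsum (quads n) (fun q => g (INR q.1.1) (INR q.2.1)) +
  -1 * Lsum (quads n) (fun q => g (INR q.1.1) (INR q.2.1 - INR q.1.1)).
  by rewrite -Lsum_scal -Lsum_plus; apply: Lsum_ext => q _; ring.
rewrite (Lsum_trichotomy (quads n) (fun q => q.2.2) (fun q => q.1.2) (fun q => g (INR q.1.1) (INR q.2.1))).
rewrite (Lsum_trichotomy (quads n) (fun q => q.1.1) (fun q => q.2.1) (fun q => g (INR q.1.1) (INR q.2.1 - INR q.1.1))).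
(* The solutions with x > y: (a, x, b, y) goes to (a, x - y, a + b, y), and g(a, (a + b) - a) = g(a,
   b). *)
have -> : Lsum (filter (fun q => Nat.ltb q.2.2 q.1.2) (quads n)) (fun q => g (INR q.1.1) (INR q.2.1)) =
  Lsum (filter (fun q => Nat.ltb q.1.1 q.2.1) (quads n)) (fun q => g (INR q.1.1) (INR q.2.1 - INR q.1.1)).
  refine (eq_trans _ (Lsum_bij (fun q => ((q.1.1, q.1.2 - q.2.2), (q.1.1 + q.2.1, q.2.2)))%nat
     (filter (fun q => Nat.ltb q.2.2 q.1.2) (quads n)) _ _ _ _ _ _ _)).
  - by apply: Lsum_ext => q _ /=; f_equal; rewrite plus_INR; ring.
  - by apply: NoDup_filter; apply: NoDup_quads.
  - by apply: NoDup_filter; apply: NoDup_quads.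
  - move=> [[a x] [b y]] /filter_In [/in_quads H /Nat.ltb_lt /= H'].
    apply/filter_In; split; last by apply/Nat.ltb_lt; rewrite /=; lia.
    apply/in_quads; repeat split; try lia; nia.
  - move=> [[a x] [b y]] [[a' x'] [b' y']] /filter_In [_ /Nat.ltb_lt /= H] /filter_In [_ /Nat.ltb_lt /= H'] /= [].
    by move=> E1 E2 E3 E4; repeat f_equal; lia.
  - move=> [[a x] [b y]] /filter_In [/in_quads H /Nat.ltb_lt /= H'].
    exists ((a, x + y), (b - a, y))%nat; split; last by rewrite /=; repeat f_equal; lia.
    apply/filter_In; split; last by apply/Nat.ltb_lt; rewrite /=; lia.
    apply/in_quads; repeat split; try lia; nia.
(* The solutions with x < y: (a, x, b, y) goes to (a + b, x, b, y - x), and both symmetries of [g]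
   give g(a + b, - a) = g(b, a) = g(a, b). *)
have -> : Lsum (filter (fun q => Nat.ltb q.1.2 q.2.2) (quads n)) (fun q => g (INR q.1.1) (INR q.2.1)) =
  Lsum (filter (fun q => Nat.ltb q.2.1 q.1.1) (quads n)) (fun q => g (INR q.1.1) (INR q.2.1 - INR q.1.1)).
  refine (eq_trans _ (Lsum_bij (fun q => ((q.1.1 + q.2.1, q.1.2), (q.2.1, q.2.2 - q.1.2)))%nat
     (filter (fun q => Nat.ltb q.1.2 q.2.2) (quads n)) _ _ _ _ _ _ _)).
  - apply: Lsum_ext => q _ /=; rewrite HG Hg; f_equal; rewrite plus_INR; ring.
  - by apply: NoDup_filter; apply: NoDup_quads.
  - by apply: NoDup_filter; apply: NoDup_quads.
  - move=> [[a x] [b y]] /filter_In [/in_quads H /Nat.ltb_lt /= H'].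
    apply/filter_In; split; last by apply/Nat.ltb_lt; rewrite /=; lia.
    apply/in_quads; repeat split; try lia; nia.
  - move=> [[a x] [b y]] [[a' x'] [b' y']] /filter_In [_ /Nat.ltb_lt /= H] /filter_In [_ /Nat.ltb_lt /= H'] /= [].
    by move=> E1 E2 E3 E4; repeat f_equal; lia.
  - move=> [[a x] [b y]] /filter_In [/in_quads H /Nat.ltb_lt /= H'].
    exists ((a - b, x), (b, x + y))%nat; split; last by rewrite /=; repeat f_equal; lia.
    apply/filter_In; split; last by apply/Nat.ltb_lt; rewrite /=; lia.
    apply/in_quads; repeat split; try lia; nia.
(* Both diagonal parts are indexed by factorizations n = d m with a part 0 < a < d: for x = y one
   has (a + b) x = n and d = a + b, for a = b one has a (x + y) = n and d = x + y. *)
pose T := filter (fun t : nat * nat * nat => Nat.ltb t.2 t.1.1) (list_prod (dpairs n n) (seq 1 n)).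
have in_T : forall d m a, In ((d, m), a) T <-> (1 <= d <= n /\ 1 <= m <= n /\ d * m = n /\ 1 <= a < d)%nat.
  move=> d m a; rewrite /T filter_In in_prod_iff in_dpairs in_seq Nat.ltb_lt /=; lia.
have NT : NoDup T.
  by apply: NoDup_filter; apply: NoDup_list_prod; [apply: NoDup_dpairs | apply: seq_NoDup].
have sumT : forall f, Lsum T f = Lsum (dpairs n n) (fun p => Lsum (seq 1 (p.1 - 1)) (fun a => f (p, a))).
  move=> f; rewrite /T Lsum_filter Lsum_prod; apply: Lsum_ext => -[d m] /in_dpairs Hd.
  rewrite -(Lsum_filter (seq 1 n) (fun a => Nat.ltb a d) (fun a => f ((d, m), a))).
  apply: (Lsum_bij (fun a => a)) => //; try (by apply: NoDup_filter; apply: seq_NoDup); try exact: seq_NoDup.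
  - move=> a /filter_In [/in_seq H /Nat.ltb_lt H']; apply/in_seq => /=; lia.
  - move=> a /in_seq /= H; exists a; split=> //; apply/filter_In; split; first by apply/in_seq; lia.
    by apply/Nat.ltb_lt; lia.
have -> : Lsum (filter (fun q => Nat.eqb q.2.2 q.1.2) (quads n)) (fun q => g (INR q.1.1) (INR q.2.1)) =
  Lsum T (fun t => g (INR t.2) (INR t.1.1 - INR t.2)).
  symmetry.
  refine (eq_trans _ (Lsum_bij (fun t : nat * nat * nat => ((t.2, t.1.2), (t.1.1 - t.2, t.1.2)))%nat
     T _ _ _ _ _ _ _)).
  - apply: Lsum_ext => -[[d m] a] /in_T H /=; rewrite minus_INR //; lia.
  - exact: NT.
  - by apply: NoDup_filter; apply: NoDup_quads.
  - move=> [[d m] a] /in_T /= H; apply/filter_In; split; last by apply/Nat.eqb_eq.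
    apply/in_quads; repeat split; try lia; nia.
  - move=> [[d m] a] [[d' m'] a'] /in_T H /in_T H' /= [] E1 E2 E3 E4; repeat f_equal; lia.
  - move=> [[a x] [b y]] /filter_In [/in_quads H /Nat.eqb_eq /= H'].
    exists ((a + b, x), a)%nat; split; last by rewrite /=; repeat f_equal; lia.
    apply/in_T; repeat split; try lia; nia.
have -> : Lsum (filter (fun q => Nat.eqb q.1.1 q.2.1) (quads n)) (fun q => g (INR q.1.1) (INR q.2.1 - INR q.1.1)) =
  Lsum T (fun t => g (INR t.1.2) 0).
  symmetry.
  refine (eq_trans _ (Lsum_bij (fun t : nat * nat * nat => ((t.1.2, t.2), (t.1.2, t.1.1 - t.2)))%nat
     T _ _ _ _ _ _ _)).
  - by apply: Lsum_ext => -[[d m] a] _ /=; f_equal; ring.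
  - exact: NT.
  - by apply: NoDup_filter; apply: NoDup_quads.
  - move=> [[d m] a] /in_T /= H; apply/filter_In; split; last by apply/Nat.eqb_eq.
    apply/in_quads; repeat split; try lia; nia.
  - move=> [[d m] a] [[d' m'] a'] /in_T H /in_T H' /= [] E1 E2 E3 E4; repeat f_equal; lia.
  - move=> [[a x] [b y]] /filter_In [/in_quads H /Nat.eqb_eq /= H'].
    exists ((x + y, a), x)%nat; split; last by rewrite /=; repeat f_equal; lia.
    apply/in_T; repeat split; try lia; nia.
rewrite !sumT.
(* The summand does not depend on [a], so the inner sum is d - 1 copies of g(m, 0); exchanging the
   factors d and m gives the stated form. *)
have -> : Lsum (dpairs n n) (fun p => Lsum (seq 1 (p.1 - 1)) (fun a => g (INR (p, a).1.2) 0)) =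
  Lsum (dpairs n n) (fun p => (INR p.2 - 1) * g (INR p.1) 0).
  refine (eq_trans _ (Lsum_bij (fun p : nat * nat => (p.2, p.1)) (dpairs n n) _ _ _ _ _ _ _)).
  - apply: Lsum_ext => -[d m] /in_dpairs H /=.
    have -> : INR d - 1 = INR (d - 1) by rewrite minus_INR //; lia.
    elim: (d - 1)%nat => [|k IH]; first by rewrite /Lsum /=; ring.
    rewrite seq_S Lsum_app IH S_INR Lsum_cons /Lsum /=; ring.
  - exact: NoDup_dpairs.
  - exact: NoDup_dpairs.
  - move=> [d m] /in_dpairs H; apply/in_dpairs; rewrite /=; lia.
  - by move=> [d m] [d' m'] _ _ /= [-> ->].
  - move=> [d m] /in_dpairs H; exists (m, d); split=> //; apply/in_dpairs; lia.
rewrite (Lsum_ext _ (fun p => Lsum (seq 1 (p.1 - 1)) (fun a => g (INR a) (INR p.1 - INR a))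
     - (INR p.2 - 1) * g (INR p.1) 0) (fun p => Lsum (seq 1 (p.1 - 1)) (fun a => g (INR a) (INR p.1 - INR a))
     + -1 * ((INR p.2 - 1) * g (INR p.1) 0))); last by move=> *; ring.
rewrite Lsum_plus Lsum_scal /=; ring.
Qed.

Lemma Lsum_seq_closed (f P : nat -> R) : P O = 0 -> (forall m, P (S m) = P m + f (S m)) ->
  forall m, Lsum (seq 1 m) f = P m.
Proof.
move=> P0 PS; elim=> [|m IH]; first by rewrite P0.
rewrite seq_S Lsum_app IH PS Lsum_cons /Lsum /=; ring.
Qed.

(** This is half of a^2 + b^2 + c^2 for c = - a - b. *)
Definition q2 (a b : R) : R := a * a + a * b + b * b.

(* [P D m] is the closed form of the sum of [g a (D - a)] over [1 <= a <= m]. The symmetry of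
   [a, b |-> g a (b - a)] holds for symmetric polynomials of even degree in [a, b, - a - b]. *)
Lemma conv_sig_q (g : R -> R -> R) (P : R -> R -> R) (n : nat) :
  (forall a b, g a b = g b a) -> (forall a b, g a (b - a) = g b (a - b)) ->
  (forall D, P D 0 = 0) -> (forall D m, P D (m + 1) = P D m + g (m + 1) (D - (m + 1))) ->
  Lsum (quads n) (fun q => g (INR q.1.1) (INR q.2.1) - g (INR q.1.1) (INR q.2.1 - INR q.1.1)) =
  Lsum (dpairs n n) (fun p => P (INR p.1) (INR p.1 - 1) - (INR p.2 - 1) * g (INR p.1) 0).
Proof.
move=> Hg HG P0 PS; rewrite quads_transform //; apply: Lsum_ext => -[d m] /in_dpairs H /=.
f_equal.
rewrite (Lsum_seq_closed _ (fun m => P (INR d) (INR m))) //.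
- by rewrite minus_INR //; lia.
- by move=> k; rewrite S_INR.
Qed.

(** Turns a linear combination of divisor sums into one sum over factorizations, so that the
    convolution identities can be checked term by term. The coefficients may depend on [n]. *)
Lemma sig_dpairs_lin (n : nat) (l : list (R * nat)) :
  Lsum l (fun c => c.1 * sig c.2 n) = Lsum (dpairs n n) (fun p => Lsum l (fun c => c.1 * INR p.1 ^ c.2)).
Proof.
elim: l => [|c l IH].
  rewrite {1}/Lsum /= (Lsum_ext _ _ (fun _ => 0 * 0)); last by move=> p _; rewrite /Lsum /=; ring.
  rewrite Lsum_scal; ring.
rewrite Lsum_cons IH /sig (sigma_dpairs c.2 n n) // -Lsum_scal -Lsum_plus.
by apply: Lsum_ext => p _; rewrite Lsum_cons.
Qed.

Lemma conv_lin_quads (n : nat) (i j i' j' : nat) (k l : R) :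
  k * conv (sig i) (sig j) n + l * conv (sig i') (sig j') n =
  Lsum (quads n) (fun q => k * (INR q.1.1 ^ i * INR q.2.1 ^ j) + l * (INR q.1.1 ^ i' * INR q.2.1 ^ j')).
Proof. by rewrite !conv_sigma_quads Lsum_plus !Lsum_scal. Qed.

Lemma conv_sig_sym (i j n : nat) : conv (sig i) (sig j) n = conv (sig j) (sig i) n.
Proof.
rewrite !conv_sigma_quads.
refine (eq_trans _ (Lsum_bij (fun q => (q.2, q.1)) (quads n) _ _ _ _ _ _ _)).
- by apply: Lsum_ext => q _ /=; ring.
- exact: NoDup_quads.
- exact: NoDup_quads.
- by move=> [[a x] [b y]] /in_quads H; apply/in_quads; repeat split; lia.
- by move=> [p q] [p' q'] _ _ /= [-> ->].
- move=> [[a x] [b y]] /in_quads H; exists ((b, y), (a, x)); split=> //.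
  by apply/in_quads; repeat split; lia.
Qed.

(** Since [q2 a (b - a)] is a^2 - ab + b^2, the choice g = q2^2 makes the difference equal to 4 a^3
    b + 4 a b^3, which involves no other convolution. The polynomial is Faulhaber's sum of q2(a, D -
    a)^2 over a <= m. *)
Lemma conv_sig13 (n : nat) : 240 * conv (sig 1) (sig 3) n =
  21 * sig 5 n + 10 * sig 3 n - 30 * (INR n * sig 3 n) - sig 1 n.
Proof.
have := conv_sig_q (fun a b => q2 a b ^ 2)
  (fun D m => (-1/30) * m^1 * D^0 + (1/2) * m^1 * D^2 + (-1/1) * m^1 * D^3 + (1/1) * m^1 * D^4 + (-1/2) * m^2 * D^1 + (3/2) * m^2 * D^2 + (-1/1) * m^2 * D^3 + (1/3) * m^3 * D^0 + (-1/1) * m^3 * D^1 + (1/1) * m^3 * D^2 + (1/2) * m^4 * D^0 + (-1/2) * m^4 * D^1 + (1/5) * m^5 * D^0) n.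
move=> /(_ ltac:(move=> *; rewrite /q2; ring) ltac:(move=> *; rewrite /q2; ring)
   ltac:(move=> *; field) ltac:(move=> *; rewrite /q2; field)).
rewrite (Lsum_ext (quads n) _ (fun q => 4 * (INR q.1.1 ^ 3 * INR q.2.1 ^ 1) + 4 * (INR q.1.1 ^ 1 * INR q.2.1 ^ 3)));
  last by move=> q _; rewrite /q2; ring.
rewrite -conv_lin_quads (conv_sig_sym 3) => E.
have -> : 240 * conv (sig 1) (sig 3) n = 30 * (4 * conv (sig 1) (sig 3) n + 4 * conv (sig 1) (sig 3) n) by ring.
rewrite E -Lsum_scal.
have := sig_dpairs_lin n [(21, 5%nat); (10 - 30 * INR n, 3%nat); (-1, 1%nat)].
rewrite /Lsum /= => E2.
have -> : 21 * sig 5 n + 10 * sig 3 n - 30 * (INR n * sig 3 n) - sig 1 n =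
  21 * sig 5 n + ((10 - 30 * INR n) * sig 3 n + (-1 * sig 1 n + 0)) by ring.
rewrite E2 -/(Lsum _ _).
(* With n = d m both sides are polynomials in d and m; the term m d^4 coming from g(d, 0) accounts
   for [INR n * sig 3 n]. *)
apply: Lsum_ext => -[d m] /in_dpairs [_ [_ H]] /=.
rewrite -H mult_INR /q2; field.
Qed.

(** For g = (ab(a + b))^2 the difference is 4 a^3 b^3. Here g(d, 0) = 0, which is why no multiple of
    [INR n] appears. *)
Lemma conv_sig33 (n : nat) : 120 * conv (sig 3) (sig 3) n = sig 7 n - sig 3 n.
Proof.
have := conv_sig_q (fun a b => (a * b * (a + b)) ^ 2)
  (fun D m => (-1/30) * m^1 * D^2 + (1/6) * m^1 * D^4 + (-1/2) * m^2 * D^3 + (1/2) * m^2 * D^4 + (1/3) * m^3 * D^2 + (-1/1) * m^3 * D^3 + (1/3) * m^3 * D^4 + (1/2) * m^4 * D^2 + (-1/2) * m^4 * D^3 + (1/5) * m^5 * D^2) n.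
move=> /(_ ltac:(move=> *; ring) ltac:(move=> *; ring)
   ltac:(move=> *; field) ltac:(move=> *; field)).
rewrite (Lsum_ext (quads n) _ (fun q => 4 * (INR q.1.1 ^ 3 * INR q.2.1 ^ 3) + 0 * (INR q.1.1 ^ 3 * INR q.2.1 ^ 3)));
  last by move=> q _; ring.
rewrite -conv_lin_quads => E.
have -> : 120 * conv (sig 3) (sig 3) n = 30 * (4 * conv (sig 3) (sig 3) n + 0 * conv (sig 3) (sig 3) n) by ring.
rewrite E -Lsum_scal.
have := sig_dpairs_lin n [(1, 7%nat); (-1, 3%nat)].
rewrite /Lsum /= => E2.
have -> : sig 7 n - sig 3 n = 1 * sig 7 n + (-1 * sig 3 n + 0) by ring.
rewrite E2 -/(Lsum _ _).
apply: Lsum_ext => -[d m] /in_dpairs [_ [_ H]] /=.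
field.
Qed.

(** With s = a^2 + b^2 and t = ab, the choice g = q2^3 gives (s + t)^3 - (s - t)^3 = 6 a^5 b + 6 a
    b^5 + 14 a^3 b^3; the last term is removed by [conv_sig33]. *)
Lemma conv_sig15 (n : nat) : 504 * conv (sig 1) (sig 5) n =
  20 * sig 7 n + 21 * sig 5 n - 42 * (INR n * sig 5 n) + sig 1 n.
Proof.
have := conv_sig_q (fun a b => q2 a b ^ 3)
  (fun D m => (1/42) * m^1 * D^0 + (-1/5) * m^1 * D^2 + (1/1) * m^1 * D^4 + (-3/2) * m^1 * D^5 + (1/1) * m^1 * D^6 + (1/4) * m^2 * D^1 + (-7/4) * m^2 * D^3 + (3/1) * m^2 * D^4 + (-3/2) * m^2 * D^5 + (-1/6) * m^3 * D^0 + (2/1) * m^3 * D^2 + (-7/2) * m^3 * D^3 + (2/1) * m^3 * D^4 + (-5/4) * m^4 * D^1 + (3/1) * m^4 * D^2 + (-7/4) * m^4 * D^3 + (1/2) * m^5 * D^0 + (-3/2) * m^5 * D^1 + (6/5) * m^5 * D^2 + (1/2) * m^6 * D^0 + (-1/2) * m^6 * D^1 + (1/7) * m^7 * D^0) n.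
move=> /(_ ltac:(move=> *; rewrite /q2; ring) ltac:(move=> *; rewrite /q2; ring)
   ltac:(move=> *; field) ltac:(move=> *; rewrite /q2; field)).
rewrite (Lsum_ext (quads n) _ (fun q => (6 * (INR q.1.1 ^ 5 * INR q.2.1 ^ 1) + 6 * (INR q.1.1 ^ 1 * INR q.2.1 ^ 5)) +
   14 * (INR q.1.1 ^ 3 * INR q.2.1 ^ 3)));
  last by move=> q _; rewrite /q2; ring.
rewrite Lsum_plus -conv_lin_quads Lsum_scal -conv_sigma_quads (conv_sig_sym 5) => E.
(* 49/10 is 42 * 14 / 120. *)
have -> : 504 * conv (sig 1) (sig 5) n = 42 * (6 * conv (sig 1) (sig 5) n + 6 * conv (sig 1) (sig 5) n +
   14 * conv (sig 3) (sig 3) n) - 49/10 * (120 * conv (sig 3) (sig 3) n) by field.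
rewrite conv_sig33 E -Lsum_scal.
have := sig_dpairs_lin n [(20 + 49/10, 7%nat); (21 - 42 * INR n, 5%nat); (- (49/10), 3%nat); (1, 1%nat)].
rewrite /Lsum /= => E2.
have -> : 20 * sig 7 n + 21 * sig 5 n - 42 * (INR n * sig 5 n) + sig 1 n =
  (20 + 49/10) * sig 7 n + ((21 - 42 * INR n) * sig 5 n + (- (49/10) * sig 3 n + (1 * sig 1 n + 0))) - 49/10 * (sig 7 n - sig 3 n) by ring.
rewrite E2 -/(Lsum _ _); f_equal.
apply: Lsum_ext => -[d m] /in_dpairs [_ [_ H]] /=.
rewrite -H mult_INR /q2; field.
Qed.

(** * Ramanujan's identities *)

Lemma cexp_plus (z w : C) : cexp (z + w)%C = (cexp z * cexp w)%C.
Proof.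
case: z => x y; case: w => u v; rewrite /cexp /Cmult /=.
rewrite exp_plus cos_plus sin_plus; f_equal; ring.
Qed.

Lemma Cmod_cexp (z : C) : Cmod (cexp z) = exp (Re z).
Proof.
rewrite /Cmod /cexp /=.
have -> : exp (Re z) * cos (Im z) * (exp (Re z) * cos (Im z) * 1) +
   exp (Re z) * sin (Im z) * (exp (Re z) * sin (Im z) * 1) =
   exp (Re z) * exp (Re z) * (Rsqr (sin (Im z)) + Rsqr (cos (Im z))) by rewrite /Rsqr; ring.
rewrite sin2_cos2 Rmult_1_r; apply: sqrt_square; exact/Rlt_le/exp_pos.
Qed.

Lemma is_derive_eps (f : R -> R) (x l : R) : is_derive f x l ->
  forall eps, 0 < eps -> exists d, 0 < d /\
    forall h, Rabs h < d -> Rabs (f (x + h) - f x - h * l) <= eps * Rabs h.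
Proof.
move=> [_ H] eps He.
have := H x (fun P HP => HP) (mkposreal _ He) => -[d Hd].
exists d; split; first exact: cond_pos.
move=> h Hh; have := Hd (x + h).
have -> : x + h = h + x by ring.
move=> HH.
have B : ball x d (h + x).
  change (Rabs ((h + x) - x) < d).
  by have -> : h + x - x = h by ring.
have := HH B.
change (Rabs ((f (h + x) - f x) - ((h + x) - x) * l) <= eps * Rabs ((h + x) - x) ->
  Rabs (f (h + x) - f x - h * l) <= eps * Rabs h).
by have -> : h + x - x = h by ring.
Qed.

Lemma cexp_0 : cexp 0%C = 1%C.
Proof. by rewrite /cexp /= exp_0 cos_0 sin_0 /RtoC; f_equal; ring. Qed.

(** The addition formula [cexp_plus] reduces every point to 0, where the real derivatives of [exp],
    [cos] and [sin] suffice. *)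
Lemma cder_cexp_0 : cder cexp 0%C 1%C.
Proof.
move=> eps He.
pose e := Rmin 1 (eps / 8).
have e0 : 0 < e by apply: Rmin_glb_lt; lra.
have e1 : e <= 1 by apply: Rmin_l.
have e2 : e <= eps / 8 by apply: Rmin_r.
have [d1 [d10 D1]] := is_derive_eps exp 0 _ (is_derive_exp 0) e e0.
have [d2 [d20 D2]] := is_derive_eps cos 0 _ (is_derive_cos 0) e e0.
have [d3 [d30 D3]] := is_derive_eps sin 0 _ (is_derive_sin 0) e e0.
exists (Rmin (Rmin d1 (e / 2)) (Rmin d2 d3)); split.
  by repeat apply: Rmin_glb_lt => //; lra.
move=> h Hh.
have m1 := Rmin_l (Rmin d1 (e / 2)) (Rmin d2 d3); have m2 := Rmin_r (Rmin d1 (e / 2)) (Rmin d2 d3).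
have m3 := Rmin_l d1 (e / 2); have m4 := Rmin_r d1 (e / 2); have m5 := Rmin_l d2 d3; have m6 := Rmin_r d2 d3.
have rx := re_le_Cmod h; have ry := im_le_Cmod h.
move: (Rle_trans _ _ _ m2 m5) (Rle_trans _ _ _ m2 m6) (Rle_trans _ _ _ m1 m3) (Rle_trans _ _ _ m1 m4) => n1 n2 n3 n4.
have {}D1 := D1 (Re h) ltac:(lra); have {}D2 := D2 (Im h) ltac:(lra); have {}D3 := D3 (Im h) ltac:(lra).
move: D1 D2 D3; rewrite !Rplus_0_l exp_0 cos_0 sin_0 => D1 D2 D3.
set x := Re h in rx D1 *; set y := Im h in ry D2 D3 *.
have E1 : Rabs (exp x - 1) <= e.
  have : exp x - 1 = (exp x - 1 - x * 1) + x by ring.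
  move=> ->; apply: Rle_trans (Rabs_triang _ _) _.
  have : e * Rabs x <= 1 * Rabs x by apply: Rmult_le_compat_r => //; apply: Rabs_pos.
  lra.
have E2 : Rabs (exp x) <= 2.
  have : exp x = (exp x - 1) + 1 by ring.
  move=> ->; apply: Rle_trans (Rabs_triang _ _) _; rewrite Rabs_R1; lra.
have -> : (cexp (0 + h) - cexp 0 - h * 1)%C =
  ((exp x - 1 - x * 1) + exp x * (cos y - 1 - y * (- 0)), exp x * (sin y - 0 - y * 1) + (exp x - 1) * y).
  rewrite cexp_0 Cplus_0_l /cexp -/x -/y.
  have -> : h = (x, y) by rewrite /x /y; case: (h).
  rewrite /Cminus /Cplus /Copp /Cmult /=; f_equal; ring.
apply: Rle_trans (Cmod_le_abs _) _; rewrite [Re _]/= [Im _]/=.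
have T1 := Rabs_triang (exp x - 1 - x * 1) (exp x * (cos y - 1 - y * (- 0))).
have T2 := Rabs_triang (exp x * (sin y - 0 - y * 1)) ((exp x - 1) * y).
rewrite !Rabs_mult in T1 T2.
rewrite Rmult_1_r in T1.
have P1 : Rabs (exp x) * Rabs (cos y - 1 - y * - 0) <= 2 * (e * Rabs y).
  by apply: Rmult_le_compat => //; apply: Rabs_pos.
have P2 : Rabs (exp x) * Rabs (sin y - 0 - y * 1) <= 2 * (e * Rabs y).
  by apply: Rmult_le_compat => //; apply: Rabs_pos.
have P3 : Rabs (exp x - 1) * Rabs y <= e * Rabs y.
  by apply: Rmult_le_compat_r => //; apply: Rabs_pos.
rewrite Rmult_1_r in D1 T1 *.
have P4 : e * Rabs x <= e * Cmod h by apply: Rmult_le_compat_l; lra.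
have P5 : e * Rabs y <= e * Cmod h by apply: Rmult_le_compat_l; lra.
have P6 : e * Cmod h <= eps / 8 * Cmod h by apply: Rmult_le_compat_r => //; apply: Cmod_ge_0.
rewrite ?Rmult_1_r in T2 P2 *.
have P7 : 0 <= eps * Cmod h by apply: Rmult_le_pos; [lra | apply: Cmod_ge_0].
lra.
Qed.

Lemma cder_cexp (z : C) : cder cexp z (cexp z).
Proof.
rewrite -{1}(Cplus_0_r z); apply/cder_shift.
apply: (cder_ext_loc (fun h => cexp z * cexp h)%C _ _ _ 1); first lra.
  by move=> h _; rewrite -cexp_plus Cplus_0_l.
have := cder_scal (cexp z) _ _ _ cder_cexp_0.
by rewrite Cmult_1_r.
Qed.

Definition two_pi_i : C := (RtoC (2 * PI) * Ci)%C.

Lemma two_pi_i_neq_0 : two_pi_i <> 0%C.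
Proof.
have := PI_RGT_0 => P E; have := f_equal Im E; rewrite /two_pi_i /=; lra.
Qed.

Lemma cder_qpar (z : C) : cder qpar z (two_pi_i * qpar z)%C.
Proof.
have H : cder (fun z => RtoC (2 * PI) * (Ci * z))%C z two_pi_i.
  have := cder_scal (RtoC (2 * PI)) _ _ _ (cder_scal Ci _ _ _ (cder_id z)).
  by rewrite Cmult_1_r.
exact: (cder_comp _ _ _ _ _ H (cder_cexp _)).
Qed.

Lemma Cmod_qpar (z : C) : UHP z -> Cmod (qpar z) < 1.
Proof.
rewrite /UHP => H; rewrite /qpar Cmod_cexp -exp_0; apply: exp_increasing.
have := PI_RGT_0.
have -> : Re (RtoC (2 * PI) * (Ci * z))%C = - (2 * PI * Im z) by rewrite /=; rewrite /Re /Im; ring.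
nra.
Qed.

(** Convergence of the majorant is known only strictly inside the disc, whence [rad a x] for
    [x < r]. A radius [m < r] is then refuted at the midpoint of [m] and [r]. *)
Lemma rad_comparison (a : nat -> C) (b : nat -> R) (r : R) :
  (forall n, Cmod (a n) <= b n) -> Rbar_le (Finite r) (CV_radius b) -> rad a r.
Proof.
move=> H B.
have b0 : forall n, 0 <= b n by move=> n; apply: Rle_trans (H n); apply: Cmod_ge_0.
have K : forall x, 0 <= x < r -> rad a x.
  move=> x Hx.
  have E : ex_series (fun n => Rabs (b n * x ^ n)).
    apply: CV_disk_inside; apply: Rbar_lt_le_trans B; rewrite Rabs_pos_eq /=; lra.
  apply: (rad_bounded _ _ (Series (fun n => Rabs (b n * x ^ n)))); first lra.
  move=> n.
  have P0 : 0 <= x ^ n by apply: pow_le; lra.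
  have P1 : Cmod (a n) * x ^ n <= Rabs (b n * x ^ n).
    rewrite Rabs_pos_eq; last exact: Rmult_le_pos.
    exact: Rmult_le_compat_r.
  apply: Rle_trans P1 _.
  have : forall c : nat -> R, ex_series c -> (forall n, 0 <= c n) -> c n <= Series c; last first.
    by move=> /(_ _ E); apply => m; apply: Rabs_pos.
  move=> c {}E c0.
  rewrite (Series_incr_n c (S n)) //; last lia.
  have S0 : 0 <= Series (fun k => c (S n + k)%nat).
    apply: Series_ge0 => //; by have [H1 _] := ex_series_incr_n (V := R_NormedModule) c (S n); apply: H1.
  rewrite [Init.Nat.pred _]/=.
  have : c n <= sum_f_R0 c n; last lra.
  case: n {P0 S0} => [|n] /=; first lra.
  have : 0 <= sum_f_R0 c n by apply: cond_pos_sum.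
  lra.
rewrite /rad.
have := CV_radius_ge_0 (fun n => Cmod (a n)).
case E : (CV_radius _) => [m| |] //= m0.
apply: Rnot_lt_le => L.
have := K ((m + r) / 2) ltac:(lra); rewrite /rad E /=; lra.
Qed.

(** An additional factor [n] is x d/dx, a formal derivative followed by a shift, and neither changes
    the radius. *)
Lemma CV_radius_pow (j : nat) : Rbar_le (Finite 1) (CV_radius (fun n => INR n ^ j)).
Proof.
elim: j => [|j IH].
  have := rad_bounded (fun _ => RtoC 1) 1 1 ltac:(lra) (fun n => _).
  rewrite /rad; move=> H.
  rewrite (CV_radius_ext _ (fun _ => Cmod 1)); last by move=> n; rewrite Cmod_1.
  by apply: H => n; rewrite Cmod_1 pow1; lra.
move: IH; rewrite -(CV_radius_derive (fun n => INR n ^ j)) -CV_radius_incr_1.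
congr (Rbar_le _ _); apply: CV_radius_ext => -[|n]; first by rewrite /= Rmult_0_l.
by rewrite /PS_incr_1 /PS_derive.
Qed.

Lemma sigma_le (j n : nat) : (Defs.sigma j n <= n * n ^ j)%nat.
Proof.
rewrite /Defs.sigma.
have H : forall l, (forall d, In d l -> (d <= n)%nat) ->
  (fold_right Nat.add 0 (map (fun d => if Nat.eqb (Nat.modulo n d) 0 then Nat.pow d j else 0) l) <= length l * n ^ j)%nat.
  elim=> [//|d l IH] Hl /=.
  have := IH (fun d Hd => Hl d (or_intror Hd)).
  have : (d ^ j <= n ^ j)%nat by apply: Nat.pow_le_mono_l; apply: Hl; left.
  case: Nat.eqb; nia.
by have := H (seq 1 n); rewrite length_seq; apply => d /in_seq; lia.
Qed.

Lemma rad_sig_pow (i j : nat) : rad (fun n => RtoC (INR n ^ i * sig j n)) 1.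
Proof.
apply: (rad_comparison _ (fun n => INR n ^ (i + S j))); last exact: CV_radius_pow.
move=> n; have P : 0 <= INR n ^ i by apply: pow_le; apply: pos_INR.
rewrite Cmod_R Rabs_pos_eq; last by apply: Rmult_le_pos => //; apply: pos_INR.
rewrite pow_add; apply: Rmult_le_compat_l => //.
rewrite -pow_INR; apply: le_INR; exact: sigma_le.
Qed.

Lemma rad_ext (a b : nat -> C) (r : R) : (forall n, a n = b n) -> rad a r -> rad b r.
Proof. by move=> E; rewrite /rad; congr (Rbar_le _ _); apply: CV_radius_ext => n; rewrite E. Qed.

Definition sigma_series (j : nat) (q : C) : C := CPS (fun n => RtoC (sig j n)) q.
(** This is q d/dq of [sigma_series]; the normalization of [dprime] turns the derivative in [z] into
    q d/dq. *)
Definition nsigma_series (j : nat) (q : C) : C := CPS (fun n => RtoC (INR n * sig j n)) q.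

Lemma rad_sig (j : nat) : rad (fun n => RtoC (sig j n)) 1.
Proof. by apply: rad_ext (rad_sig_pow 0 j) => n; rewrite /= Rmult_1_l. Qed.

Lemma rad_nsig (j : nat) : rad (fun n => RtoC (INR n * sig j n)) 1.
Proof. by apply: rad_ext (rad_sig_pow 1 j) => n; rewrite /= Rmult_1_r. Qed.

Lemma nsigma_series_dS (j : nat) (q : C) : Cmod q < 1 -> nsigma_series j q = (q * CPS (dS (fun n => RtoC (sig j n))) q)%C.
Proof.
move=> Hq; rewrite /nsigma_series (CPS_S _ 1) //; last exact: rad_nsig.
have -> : RtoC (INR 0 * sig j 0) = 0%C by rewrite /= Rmult_0_l.
rewrite Cplus_0_l; f_equal; apply: CSeries_ext => n.
by rewrite /dS RtoC_mult.
Qed.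

Lemma Eis_sigma_series (c : R) (k : nat) (z : C) : Eis c k z = (1 + c * sigma_series (k - 1) (qpar z))%C.
Proof. by []. Qed.

Lemma cder_Eis (c : R) (k : nat) (z : C) : UHP z ->
  cder (Eis c k) z (two_pi_i * (c * nsigma_series (k - 1) (qpar z)))%C.
Proof.
move=> U; have Q := Cmod_qpar _ U.
have H := cder_comp _ _ _ _ _ (cder_qpar z) (CPS_cder _ 1 _ (rad_sig (k - 1)) Q).
have := cder_plus _ _ _ _ _ (cder_const 1%C z) (cder_scal c _ _ _ H).
rewrite nsigma_series_dS //.
congr (cder _ _ _); ring.
Qed.

Lemma hol_Eis (c : R) (k : nat) : hol (Eis c k).
Proof. by move=> z /(cder_Eis c k) H; eexists; exact: H. Qed.

Lemma dprime_Eis (c : R) (k : nat) (z : C) : UHP z ->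
  dprime (Eis c k) z = (c * nsigma_series (k - 1) (qpar z))%C.
Proof.
move=> U; rewrite /dprime (cder_C_derive _ _ _ (cder_Eis c k z U)) -/two_pi_i.
by have N := two_pi_i_neq_0; field.
Qed.

(** Cauchy products are available for absolutely convergent real series, so real and imaginary parts
    are multiplied separately and recombined termwise through q^n = q^k q^(n-k). *)
Lemma CPS_real_mult (a b : nat -> R) (r : R) (q : C) :
  rad (fun n => RtoC (a n)) r -> rad (fun n => RtoC (b n)) r -> Cmod q < r ->
  (CPS (fun n => RtoC (a n)) q * CPS (fun n => RtoC (b n)) q)%C = CPS (fun n => RtoC (conv a b n)) q.
Proof.
move=> Ra Rb Hq.
have Ca := rad_cabs _ _ _ Ra Hq; have Cb := rad_cabs _ _ _ Rb Hq.
have [a1 [a2 [b1 b2]]] := (cabs_absRe _ Ca, (cabs_absIm _ Ca, (cabs_absRe _ Cb, cabs_absIm _ Cb))).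
have [a1' a2'] := (Series_correct _ (cabs_Re _ Ca), Series_correct _ (cabs_Im _ Ca)).
have [b1' b2'] := (Series_correct _ (cabs_Re _ Cb), Series_correct _ (cabs_Im _ Cb)).
have M11 := is_series_mult _ _ _ _ a1' b1' a1 b1.
have M12 := is_series_mult _ _ _ _ a1' b2' a1 b2.
have M21 := is_series_mult _ _ _ _ a2' b1' a2 b1.
have M22 := is_series_mult _ _ _ _ a2' b2' a2 b2.
rewrite {1 2}/CPS {1 2}/CSeries /Cmult /= /CPS /CSeries; f_equal; symmetry; apply: is_series_unique.
- apply: is_series_ext (is_series_minus _ _ _ _ M11 M22) => n.
  change (sum_f_R0 (fun k => Re (a k * q ^ k)%C * Re (b (n - k)%nat * q ^ (n - k))%C) n -
    sum_f_R0 (fun k => Im (a k * q ^ k)%C * Im (b (n - k)%nat * q ^ (n - k))%C) n = Re (conv a b n * q ^ n)%C).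
  have -> : Re (conv a b n * q ^ n)%C = conv a b n * Re (q ^ n)%C by case: (q ^ n)%C => u v /=; ring.
  rewrite -minus_sum Rmult_comm /conv scal_sum; apply: sum_eq => k Hk.
  have -> : (q ^ n = q ^ k * q ^ (n - k))%C by rewrite -Cpow_add_r; f_equal; lia.
  move: (q ^ k)%C (q ^ (n - k))%C => [? ?] [? ?] /=; ring.
- apply: is_series_ext (is_series_plus _ _ _ _ M12 M21) => n.
  change (sum_f_R0 (fun k => Re (a k * q ^ k)%C * Im (b (n - k)%nat * q ^ (n - k))%C) n +
    sum_f_R0 (fun k => Im (a k * q ^ k)%C * Re (b (n - k)%nat * q ^ (n - k))%C) n = Im (conv a b n * q ^ n)%C).
  have -> : Im (conv a b n * q ^ n)%C = conv a b n * Im (q ^ n)%C by case: (q ^ n)%C => u v /=; ring.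
  rewrite -plus_sum Rmult_comm /conv scal_sum; apply: sum_eq => k Hk.
  have -> : (q ^ n = q ^ k * q ^ (n - k))%C by rewrite -Cpow_add_r; f_equal; lia.
  move: (q ^ k)%C (q ^ (n - k))%C => [? ?] [? ?] /=; ring.
Qed.

Lemma CPS_ext (a b : nat -> C) (q : C) : (forall n, a n = b n) -> CPS a q = CPS b q.
Proof. by move=> E; apply: CSeries_ext => n; rewrite E. Qed.

(** Four terms are what the longest convolution identities have; the shorter one is padded with zero
    coefficients. *)
Lemma CPS_lin4 (u1 u2 u3 u4 : nat -> R) (k1 k2 k3 k4 r : R) (q : C) :
  rad (fun n => RtoC (u1 n)) r -> rad (fun n => RtoC (u2 n)) r ->
  rad (fun n => RtoC (u3 n)) r -> rad (fun n => RtoC (u4 n)) r -> Cmod q < r ->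
  CPS (fun n => RtoC (k1 * u1 n + k2 * u2 n + k3 * u3 n + k4 * u4 n)) q =
  (k1 * CPS (fun n => RtoC (u1 n)) q + k2 * CPS (fun n => RtoC (u2 n)) q +
   k3 * CPS (fun n => RtoC (u3 n)) q + k4 * CPS (fun n => RtoC (u4 n)) q)%C.
Proof.
move=> R1 R2 R3 R4 Hq; rewrite /CPS.
have C1 := rad_cabs _ _ _ R1 Hq; have C2 := rad_cabs _ _ _ R2 Hq.
have C3 := rad_cabs _ _ _ R3 Hq; have C4 := rad_cabs _ _ _ R4 Hq.
rewrite -!CSeries_scal // -!CSeries_plus; try by repeat apply: cabs_plus; apply: cabs_scal.
by apply: CSeries_ext => n; rewrite !RtoC_plus !RtoC_mult; ring.
Qed.

Lemma sigma_series_1_3 (q : C) : Cmod q < 1 -> (sigma_series 1 q * sigma_series 3 q)%C =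
  (RtoC (21/240) * sigma_series 5 q + RtoC (10/240) * sigma_series 3 q + RtoC (-30/240) * nsigma_series 3 q + RtoC (-1/240) * sigma_series 1 q)%C.
Proof.
move=> Hq; rewrite /sigma_series /nsigma_series (CPS_real_mult _ _ 1) //; try exact: rad_sig.
rewrite -(CPS_lin4 _ _ _ _ _ _ _ _ 1) //; try exact: rad_sig; try exact: rad_nsig.
by apply: CPS_ext => n; f_equal; have := conv_sig13 n; lra.
Qed.

Lemma sigma_series_3_3 (q : C) : Cmod q < 1 -> (sigma_series 3 q * sigma_series 3 q)%C =
  (RtoC (1/120) * sigma_series 7 q + RtoC (-1/120) * sigma_series 3 q + RtoC 0 * sigma_series 3 q + RtoC 0 * sigma_series 3 q)%C.
Proof.
move=> Hq; rewrite /sigma_series (CPS_real_mult _ _ 1) //; try exact: rad_sig.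
rewrite -(CPS_lin4 _ _ _ _ _ _ _ _ 1) //; try exact: rad_sig.
by apply: CPS_ext => n; f_equal; have := conv_sig33 n; lra.
Qed.

Lemma sigma_series_1_5 (q : C) : Cmod q < 1 -> (sigma_series 1 q * sigma_series 5 q)%C =
  (RtoC (20/504) * sigma_series 7 q + RtoC (21/504) * sigma_series 5 q + RtoC (-42/504) * nsigma_series 5 q + RtoC (1/504) * sigma_series 1 q)%C.
Proof.
move=> Hq; rewrite /sigma_series /nsigma_series (CPS_real_mult _ _ 1) //; try exact: rad_sig.
rewrite -(CPS_lin4 _ _ _ _ _ _ _ _ 1) //; try exact: rad_sig; try exact: rad_nsig.
by apply: CPS_ext => n; f_equal; have := conv_sig15 n; lra.
Qed.

(** The only nonlinear term is the product of the series of sigma_1 and sigma_3. Once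
    [sigma_series_1_3] has made it linear, the terms in sigma_1, sigma_3 and n sigma_3 cancel and
    those of E_6 remain. *)
Lemma ramanujan_E4 (z : C) : UHP z ->
  (dprime E4 z - RtoC (4 / 12) * (E2 z * E4 z) = - RtoC (1 / 3) * E6 z)%C.
Proof.
move=> U; have Q := Cmod_qpar _ U.
rewrite /E4 (dprime_Eis _ _ _ U) /E2 /E6 !Eis_sigma_series [(4 - 1)%nat]/= [(2 - 1)%nat]/= [(6 - 1)%nat]/=.
have := sigma_series_1_3 _ Q.
move: (sigma_series 1 _) (sigma_series 3 _) (sigma_series 5 _) (nsigma_series 3 _) => a1 a3 a5 n3 E.
have -> : ((1 + RtoC (-24) * a1) * (1 + RtoC 240 * a3) =
  1 + RtoC (-24) * a1 + RtoC 240 * a3 + RtoC (-24) * RtoC 240 * (a1 * a3))%C by ring.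
rewrite E.
rewrite !RtoC_div; try lra.
field.
Qed.

(** Here both sides have a quadratic term; made linear, each contains the series of sigma_7, with
    the same coefficient. *)
Lemma ramanujan_E6 (z : C) : UHP z ->
  (dprime E6 z - RtoC (6 / 12) * (E2 z * E6 z) = - RtoC (1 / 2) * (E4 z * E4 z))%C.
Proof.
move=> U; have Q := Cmod_qpar _ U.
rewrite /E6 (dprime_Eis _ _ _ U) /E2 /E4 !Eis_sigma_series [(4 - 1)%nat]/= [(2 - 1)%nat]/= [(6 - 1)%nat]/=.
have := sigma_series_1_5 _ Q; have := sigma_series_3_3 _ Q.
move: (sigma_series 1 _) (sigma_series 3 _) (sigma_series 5 _) (sigma_series 7 _) (nsigma_series 5 _) => a1 a3 a5 a7 n5 E33 E15.
have -> : ((1 + RtoC (-24) * a1) * (1 + RtoC (-504) * a5) =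
  1 + RtoC (-24) * a1 + RtoC (-504) * a5 + RtoC (-24) * RtoC (-504) * (a1 * a5))%C by ring.
have -> : ((1 + RtoC 240 * a3) * (1 + RtoC 240 * a3) =
  1 + RtoC 240 * a3 + RtoC 240 * a3 + RtoC 240 * RtoC 240 * (a3 * a3))%C by ring.
rewrite E15 E33.
rewrite !RtoC_div; try lra.
field.
Qed.

(** * The ring of operators *)

Lemma UHP_open (z : C) : UHP z -> forall h, Cmod h < Im z -> UHP (z + h)%C.
Proof.
move=> U h Hh; change (0 < Im z + Im h).
have := im_le_Cmod h; rewrite /Rabs; case: Rcase_abs; lra.
Qed.

Lemma cder_ext_UHP (f g : C -> C) (z l : C) : (forall w, UHP w -> f w = g w) -> UHP z ->
  cder f z l -> cder g z l.
Proof.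
move=> E U; apply: (cder_ext_loc _ _ _ _ (Im z)) => //.
by move=> h Hh; apply: E; apply: UHP_open.
Qed.

Lemma hol_ext (f g : C -> C) : (forall w, UHP w -> f w = g w) -> hol f -> hol g.
Proof. by move=> E H z U; have [l Hl] := H z U; exists l; apply: cder_ext_UHP Hl. Qed.

Lemma hol_const (c : C) : hol (fun _ => c).
Proof. by move=> z _; exists 0%C; apply: cder_const. Qed.

Lemma hol_plus (f g : C -> C) : hol f -> hol g -> hol (fun z => f z + g z)%C.
Proof.
move=> F G z U; have [l Hl] := F z U; have [m Hm] := G z U.
by exists (l + m)%C; apply: cder_plus.
Qed.

Lemma hol_mult (f g : C -> C) : hol f -> hol g -> hol (fun z => f z * g z)%C.
Proof.
move=> F G z U; have [l Hl] := F z U; have [m Hm] := G z U.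
by eexists; apply: cder_mult; [exact: Hl | exact: Hm].
Qed.

Lemma hol_C_derive (f : C -> C) (z : C) : hol f -> UHP z -> cder f z (C_derive f z).
Proof. by move=> F U; have [l Hl] := F z U; rewrite (cder_C_derive _ _ _ Hl). Qed.

Lemma hol_dprime (f : C -> C) : hol f -> hol (dprime f).
Proof. move=> F; exact: (hol_mult _ _ (hol_const (/ (RtoC (2 * PI) * Ci))%C) (hol_derive _ F)). Qed.

Lemma dprime_ext (f g : C -> C) (z : C) : (forall w, UHP w -> f w = g w) -> hol f -> UHP z ->
  dprime f z = dprime g z.
Proof.
move=> E F U; rewrite /dprime; f_equal; symmetry; apply: cder_C_derive.
exact: (cder_ext_UHP _ _ _ _ E U (hol_C_derive _ _ F U)).
Qed.

Lemma dprime_plus (f g : C -> C) (z : C) : hol f -> hol g -> UHP z ->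
  dprime (fun w => f w + g w)%C z = (dprime f z + dprime g z)%C.
Proof.
move=> F G U; rewrite /dprime.
rewrite (cder_C_derive _ _ _ (cder_plus _ _ _ _ _ (hol_C_derive _ _ F U) (hol_C_derive _ _ G U))).
ring.
Qed.

Lemma dprime_mult (f g : C -> C) (z : C) : hol f -> hol g -> UHP z ->
  dprime (fun w => f w * g w)%C z = (dprime f z * g z + f z * dprime g z)%C.
Proof.
move=> F G U; rewrite /dprime.
rewrite (cder_C_derive _ _ _ (cder_mult _ _ _ _ _ (hol_C_derive _ _ F U) (hol_C_derive _ _ G U))).
ring.
Qed.

Lemma dprime_const (c z : C) : dprime (fun _ => c) z = 0%C.
Proof. rewrite /dprime (cder_C_derive _ _ _ (cder_const c z)); ring. Qed.

Lemma hol_Dk (k : R) (f : C -> C) : hol f -> hol (Dk k f).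
Proof.
move=> F; apply: (hol_ext (fun z => dprime f z + (RtoC (- (k / 12)) * (E2 z * f z)))%C).
  by move=> w _; rewrite /Dk RtoC_opp; ring.
apply: hol_plus; first exact: hol_dprime.
apply: hol_mult; first exact: hol_const.
by apply: hol_mult => //; apply: hol_Eis.
Qed.

(** * Operators on H *)

Lemma inH_hol (phi : gfun) (n : R) : inH phi -> hol (phi n).
Proof. by move=> [H _]; apply/holo_hol; apply: H. Qed.

Lemma Heq_sym (phi psi : gfun) : Heq phi psi -> Heq psi phi.
Proof. by move=> H n z U; rewrite H. Qed.
Lemma Heq_trans (phi psi chi : gfun) : Heq phi psi -> Heq psi chi -> Heq phi chi.
Proof. by move=> H K n z U; rewrite H // K. Qed.

Lemma inH_shift (w : R) (F : R -> (C -> C) -> C -> C) (phi : gfun) :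
  (forall n f, hol f -> hol (F n f)) ->
  (forall n (f : C -> C), (forall z, UHP z -> f z = 0%C) -> forall z, UHP z -> F n f z = 0%C) ->
  inH phi -> inH (fun m z => F m (phi (m - w)) z).
Proof.
move=> H1 H2 H; split.
  by move=> n; apply/holo_hol; apply: H1; apply: inH_hol.
have [_ [L HL]] := H; exists (map (fun x => x + w) L) => n Hn z U.
apply: (H2 n (phi (n - w))) => // z' U'; apply: HL => // K; apply: Hn; apply/in_map_iff.
by exists (n - w); split=> //; ring.
Qed.

Lemma inH_delta (phi : gfun) : inH phi -> inH (delta phi).
Proof.
apply: (inH_shift 2 (fun m f => Dk (m - 2) f)) => [n f|n f F z U]; first exact: hol_Dk.
rewrite /Dk F // -(dprime_ext (fun _ => 0%C)) //; first by rewrite dprime_const; ring.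
  by move=> w W; rewrite F.
exact: hol_const.
Qed.

Lemma inH_e4 (phi : gfun) : inH phi -> inH (e4 phi).
Proof.
apply: (inH_shift 4 (fun m f z => E4 z * f z)%C) => [n f F|n f F z U].
  by apply: hol_mult => //; apply: hol_Eis.
by rewrite F // Cmult_0_r.
Qed.

Lemma inH_e6 (phi : gfun) : inH phi -> inH (e6 phi).
Proof.
apply: (inH_shift 6 (fun m f z => E6 z * f z)%C) => [n f F|n f F z U].
  by apply: hol_mult => //; apply: hol_Eis.
by rewrite F // Cmult_0_r.
Qed.

Lemma inH_scal (c : C) (phi : gfun) : inH phi -> inH (scalOp c phi).
Proof.
move=> H; split.
  by move=> n; apply/holo_hol; apply: hol_mult; [apply: hol_const | apply: inH_hol].
by have [_ [L HL]] := H; exists L => n Hn z U; rewrite /scalOp HL // Cmult_0_r.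
Qed.

Definition addH (phi psi : gfun) : gfun := fun n z => (phi n z + psi n z)%C.

Lemma inH_add (phi psi : gfun) : inH phi -> inH psi -> inH (addH phi psi).
Proof.
move=> H K; split.
  by move=> n; apply/holo_hol; apply: hol_plus; apply: inH_hol.
have [_ [L HL]] := H; have [_ [M HM]] := K; exists (L ++ M) => n Hn z U.
by rewrite /addH HL ?HM // ?Cplus_0_l // => I; apply: Hn; apply/in_app_iff; auto.
Qed.

Lemma inR_inH (a : Op) : inR a -> forall phi, inH phi -> inH (a phi).
Proof.
elim=> [||||b c _ Hb _ Hc|b c _ Hb _ Hc].
- exact: inH_delta.
- exact: inH_e4.
- exact: inH_e6.
- exact: inH_scal.
- by move=> phi H; apply: (inH_add (b phi) (c phi)); auto.
- by move=> phi H; apply: Hb; apply: Hc.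
Qed.

(** Components are functions on all of C, so it has to be proved that values off the half plane do
    not matter. For [delta] this holds because the half plane is open. *)
Lemma inR_Heq (a : Op) : inR a -> forall phi psi, inH phi -> inH psi -> Heq phi psi ->
  Heq (a phi) (a psi).
Proof.
elim=> [|||c|b c Rb Hb Rc Hc|b c Rb Hb Rc Hc] phi psi H K E n z U.
- rewrite /delta /Dk E // (dprime_ext (phi (n - 2)) (psi (n - 2))) //.
    by move=> w W; apply: E.
  exact: inH_hol.
- by rewrite /e4 E.
- by rewrite /e6 E.
- by rewrite /scalOp E.
- by rewrite /addOp (Hb phi psi) // (Hc phi psi).
- by apply: Hb => //; try apply: inR_inH => //; apply: Hc.
Qed.

Lemma inR_addH (a : Op) : inR a -> forall phi psi, inH phi -> inH psi ->
  Heq (a (addH phi psi)) (addH (a phi) (a psi)).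
Proof.
elim=> [|||c|b c Rb Hb Rc Hc|b c Rb Hb Rc Hc] phi psi H K.
- move=> n z U; rewrite /delta /Dk /addH dprime_plus //; try exact: inH_hol.
  ring.
- by move=> n z U; rewrite /e4 /addH; ring.
- by move=> n z U; rewrite /e6 /addH; ring.
- by move=> n z U; rewrite /scalOp /addH; ring.
- move=> n z U; rewrite /addOp (Hb phi psi) // (Hc phi psi) // /addH; ring.
- apply: Heq_trans (Hb _ _ (inR_inH _ Rc _ H) (inR_inH _ Rc _ K)).
  apply: (inR_Heq b) => //; first by apply: inR_inH => //; apply: inH_add.
    by apply: inH_add; apply: inR_inH.
  exact: Hc.
Qed.

Lemma inR_scalH (a : Op) : inR a -> forall k phi, inH phi ->
  Heq (a (scalOp k phi)) (scalOp k (a phi)).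
Proof.
elim=> [|||c|b c Rb Hb Rc Hc|b c Rb Hb Rc Hc] k phi H.
- move=> n z U; rewrite /delta /Dk /scalOp dprime_mult //; try exact: inH_hol; last exact: hol_const.
  rewrite dprime_const; ring.
- by move=> n z U; rewrite /e4 /scalOp; ring.
- by move=> n z U; rewrite /e6 /scalOp; ring.
- by move=> n z U; rewrite /scalOp; ring.
- move=> n z U; rewrite /addOp (Hb k phi) // (Hc k phi) // /scalOp; ring.
- apply: Heq_trans (Hb _ _ (inR_inH _ Rc _ H)).
  apply: (inR_Heq b) => //; first by apply: inR_inH => //; apply: inH_scal.
    by apply: inH_scal; apply: inR_inH.
  exact: Hc.
Qed.

Lemma inM_inR (a : Op) : inM a -> inR a.
Proof. by elim=> *; [apply: inR_e4 | apply: inR_e6 | apply: inR_scal | apply: inR_add | apply: inR_mul]. Qed.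

(** Composition respects [eqOp] only for operators that preserve H and [Heq]. Carrying the
    membership proof along makes the operations proper without side conditions, so that setoid
    rewriting works. *)
Record rop : Type := Rop { op :> Op; opP : inR op }.

Definition req (x y : rop) : Prop := eqOp x y.
Local Notation "x == y" := (req x y) (at level 70).

Definition radd (x y : rop) : rop := Rop (addOp x y) (inR_add _ _ (opP x) (opP y)).
Definition rmul (x y : rop) : rop := Rop (mulOp x y) (inR_mul _ _ (opP x) (opP y)).
Definition rscal (c : C) : rop := Rop (scalOp c) (inR_scal c).
Definition rdelta : rop := Rop delta inR_delta.
Local Notation "x +' y" := (radd x y) (at level 50, left associativity).
Local Notation "x *' y" := (rmul x y) (at level 40, left associativity).

#[local] Instance req_equiv : Equivalence req.
Proof.
split.
- by move=> x phi _.
- by move=> x y H phi K; apply: Heq_sym; apply: H.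
- by move=> x y z H K phi L; apply: Heq_trans (H _ L) (K _ L).
Qed.

#[local] Instance radd_proper : Proper (req ==> req ==> req) radd.
Proof. by move=> x x' H y y' K phi L n z U; rewrite /= /addOp (H phi) // (K phi). Qed.

#[local] Instance rmul_proper : Proper (req ==> req ==> req) rmul.
Proof.
move=> x x' H y y' K phi L.
have Y := inR_inH _ (opP y) _ L; have Y' := inR_inH _ (opP y') _ L.
apply: Heq_trans (H _ Y').
by apply: (inR_Heq x (opP x)) => //; apply: K.
Qed.

(** On this side distributivity is additivity of [x], which needs differentiable arguments; on the
    other side it holds by definition. *)
Lemma rmulDr (x y z : rop) : x *' (y +' z) == x *' y +' x *' z.
Proof.
move=> phi L; exact: (inR_addH _ (opP x) _ _ (inR_inH _ (opP y) _ L) (inR_inH _ (opP z) _ L)).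
Qed.

Lemma rmulDl (x y z : rop) : (x +' y) *' z == x *' z +' y *' z.
Proof. by []. Qed.

Lemma rmulA (x y z : rop) : x *' (y *' z) == x *' y *' z.
Proof. by []. Qed.

Lemma rscalC (x : rop) (c : C) : x *' rscal c == rscal c *' x.
Proof. by move=> phi L; apply: (inR_scalH _ (opP x)). Qed.

(** Evaluates at a point and calls [ring] in C with applied operators as atoms; it serves for
    additive rearrangements with scalars on the left. *)
Ltac addring := let phi := fresh in let L := fresh in let n := fresh in let z := fresh in let U := fresh in
  move=> phi L n z U; rewrite /= /zeroOp /mulOp /addOp /scalOp; ring.

Lemma rmul1 (x : rop) : rscal 1 *' x == x. Proof. addring. Qed.
Lemma rmulr1 (x : rop) : x *' rscal 1 == x. Proof. rewrite rscalC; exact: rmul1. Qed.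
Lemma rmul0 (x : rop) : rscal 0 *' x == rscal 0. Proof. addring. Qed.
Lemma rmulr0 (x : rop) : x *' rscal 0 == rscal 0. Proof. rewrite rscalC; exact: rmul0. Qed.
Lemma radd0 (x : rop) : x +' rscal 0 == x. Proof. addring. Qed.
Lemma radd0l (x : rop) : rscal 0 +' x == x. Proof. addring. Qed.

(* Elements of M act by convolution with finite families of holomorphic functions; [(k, F)] has weight [k]. *)
Fixpoint Lact (L : list (nat * (C -> C))) (phi : gfun) (n : R) (z : C) : C :=
  match L with
  | nil => RtoC 0
  | kF :: L' => (kF.2 z * phi (n - INR kF.1)%R z + Lact L' phi n z)%C
  end.

Definition Lhol (L : list (nat * (C -> C))) : Prop := forall kF, In kF L -> hol kF.2.

Definition Lmul (L M : list (nat * (C -> C))) : list (nat * (C -> C)) :=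
  map (fun p => ((p.1.1 + p.2.1)%nat, fun z => (p.1.2 z * p.2.2 z)%C)) (list_prod L M).

Lemma Lact_app (L M : list (nat * (C -> C))) (phi : gfun) (n : R) (z : C) :
  Lact (L ++ M) phi n z = (Lact L phi n z + Lact M phi n z)%C.
Proof.
elim: L => [|kF L IH] /=; first by rewrite Cplus_0_l.
by rewrite IH Cplus_assoc.
Qed.

Lemma Lact_mul (L M : list (nat * (C -> C))) (phi : gfun) (n : R) (z : C) :
  Lact (Lmul L M) phi n z = Lact L (Lact M phi) n z.
Proof.
rewrite /Lmul; elim: L => [//|[k F] L IH].
rewrite [list_prod _ _]/= map_app Lact_app IH map_map /=; f_equal.
rewrite {IH}; elim: M => [|[j G] M IH] /=; first by rewrite Cmult_0_r.
rewrite IH plus_INR.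
have -> : n - (INR k + INR j) = n - INR k - INR j by ring.
ring.
Qed.

Lemma Lact_swap (L M : list (nat * (C -> C))) (phi : gfun) (n : R) (z : C) :
  Lact L (Lact M phi) n z = Lact M (Lact L phi) n z.
Proof.
elim: L => [|[k F] L IH] /=.
  by elim: M => [//|[j G] M IH] /=; rewrite -IH; ring.
rewrite IH {IH}.
elim: M => [|[j G] M IH] /=; first by ring.
rewrite -IH.
have -> : n - INR k - INR j = n - INR j - INR k by ring.
ring.
Qed.

Lemma Lact_repr (a : Op) : inM a -> exists L, Lhol L /\ forall phi n z, UHP z -> a phi n z = Lact L phi n z.
Proof.
elim=> [||c|b c _ [L [HL EL]] _ [M [HM EM]]|b c _ [L [HL EL]] _ [M [HM EM]]].
- exists [(4%nat, E4)]; split; first by move=> kF [<-|//]; apply: hol_Eis.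
  move=> phi n z _; rewrite /e4 /= Cplus_0_r.
  by have -> : 1 + 1 + 1 + 1 = 4 by ring.
- exists [(6%nat, E6)]; split; first by move=> kF [<-|//]; apply: hol_Eis.
  move=> phi n z _; rewrite /e6 /= Cplus_0_r.
  by have -> : 1 + 1 + 1 + 1 + 1 + 1 = 6 by ring.
- exists [(0%nat, fun _ => c)]; split; first by move=> kF [<-|//]; apply: hol_const.
  by move=> phi n z _; rewrite /scalOp /= Cplus_0_r Rminus_0_r.
- exists (L ++ M); split; first by move=> kF /in_app_iff [/HL|/HM].
  by move=> phi n z U; rewrite Lact_app /addOp EL // EM.
- exists (Lmul L M); split.
    move=> kF /in_map_iff [[[k F] [j G]] [<- /in_prod_iff [H1 H2]]] /=.
    by apply: (hol_mult F G); [apply: (HL (k, F)) | apply: (HM (j, G))].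
  move=> phi n z U; rewrite Lact_mul /mulOp EL // .
  elim: L {HL EL} => [//|[k F] L IH] /=; by rewrite IH EM.
Qed.

(** A weight may occur several times in the list and its entries may cancel, so a top weight makes
    sense only for these collected coefficients. *)
Definition coefL (L : list (nat * (C -> C))) (k : nat) (z : C) : C :=
  fold_right Cplus 0%C (map (fun kF => if Nat.eqb kF.1 k then kF.2 z else RtoC 0) L).

Lemma hol_coefL (L : list (nat * (C -> C))) (k : nat) : Lhol L -> hol (coefL L k).
Proof.
elim: L => [|[j F] L IH] H; first exact: (hol_const 0%C).
apply: (hol_plus (fun z => if Nat.eqb j k then F z else RtoC 0) (coefL L k)); last first.
  by apply: IH => kF HkF; apply: H; right.
case: Nat.eqb; last exact: hol_const.
by apply: (H (j, F)); left.
Qed.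

Lemma Csum_plus (f g : nat -> C) (N : nat) : Csum (fun k => f k + g k)%C N = (Csum f N + Csum g N)%C.
Proof. elim: N => [|N IH] /=; last rewrite IH; ring. Qed.

Lemma Csum_single (f : nat -> C) (N K : nat) : (K < N)%nat ->
  (forall k, (k < N)%nat -> k <> K -> f k = 0%C) -> Csum f N = f K.
Proof.
move=> HK H.
have Z : forall n, (n <= N)%nat -> Csum f n = if Nat.ltb K n then f K else RtoC 0.
  elim=> [//|n IH] Hn /=; rewrite IH; last lia.
  case: (Nat.eq_dec n K) => [->|E].
    rewrite Nat.ltb_irrefl (proj2 (Nat.ltb_lt K (S K))) //; ring.
  rewrite (H n) //.
  case: (Nat.ltb_spec K n) => H1; case: (Nat.ltb_spec K (S n)) => H2; try lia; ring.
by rewrite Z // (proj2 (Nat.ltb_lt K N)).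
Qed.

Lemma Lact_coef (L : list (nat * (C -> C))) : exists N, forall phi n z,
  Lact L phi n z = Csum (fun k => coefL L k z * phi (n - INR k)%R z)%C N.
Proof.
have [N HN] : exists N, forall kF, In kF L -> (kF.1 < N)%nat.
  elim: L => [|[j F] L [N IH]]; first by exists O.
  exists (S j + N)%nat => kF [<-|/IH] /=; lia.
exists N => phi n z.
elim: L HN => [|[j F] L IH] HN.
  by rewrite /=; elim: {HN} N => [//|N IH] /=; rewrite -IH /coefL /=; ring.
have -> : Csum (fun k => coefL ((j, F) :: L) k z * phi (n - INR k)%R z)%C N =
  (Csum (fun k => (if Nat.eqb j k then F z else RtoC 0) * phi (n - INR k)%R z) N +
   Csum (fun k => coefL L k z * phi (n - INR k)%R z) N)%C.
  rewrite -Csum_plus; elim: {IH HN} N => [//|N IH] /=; rewrite IH /coefL /=; ring.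
rewrite /= IH; last by move=> kF H; apply: HN; right.
f_equal; rewrite (Csum_single _ N j).
- by rewrite Nat.eqb_refl.
- by apply: (HN (j, F)); left.
- move=> k _ E; case: (Nat.eqb_spec j k) => [E'|_]; [by case: E | ring].
Qed.

(** * Absence of M-torsion in H *)

Lemma list_max_exists (P : R -> Prop) (L : list R) : (forall x, P x -> In x L) -> (exists x, P x) ->
  exists m, P m /\ forall x, m < x -> ~ P x.
Proof.
elim: L P => [|y L IH] P HL [x Px]; first by case: (HL x Px).
case: (classic (exists x, P x /\ x <> y)) => [[x' Hx']|N].
  have [||m [[Pm Nm] Hm]] := IH (fun x => P x /\ x <> y).
  - by move=> u [Pu Nu]; case: (HL u Pu) => // E; case: Nu.
  - by exists x'.
  case: (classic (P y /\ m < y)) => [[Py ly]|N].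
    exists y; split=> // u lu Pu; apply: (Hm u); [lra | split=> //; lra].
  exists m; split=> // u lu Pu.
  case: (Req_dec u y) => [E|E]; first by apply: N; rewrite -E.
  by apply: (Hm u).
have E : forall u, P u -> u = y by move=> u Pu; apply: NNPP => E; apply: N; exists u.
exists y; split; first by rewrite -(E x Px).
by move=> u lu Pu; have := E u Pu; lra.
Qed.

Lemma nat_max_exists (P : nat -> Prop) (N : nat) : (exists k, (k < N)%nat /\ P k) ->
  exists k, (k < N)%nat /\ P k /\ forall j, (k < j < N)%nat -> ~ P j.
Proof.
elim: N => [|N IH] [k [Hk Pk]]; first lia.
case: (classic (P N)) => [PN|NN]; first by exists N; repeat split => //; lia.
have [|k' [H1 [H2 H3]]] := IH.
  by exists k; split=> //; case: (Nat.eq_dec k N) => [E|E]; [rewrite E in Pk | lia].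
exists k'; repeat split=> //; first lia.
by move=> j Hj; case: (Nat.eq_dec j N) => [->//|E]; apply: H3; lia.
Qed.

(* Compare top weights: the product of the two top components vanishes only if one of them does. *)
Lemma inM_torsion_free (f : Op) (phi : gfun) : inM f -> ~ eqOp f zeroOp -> inH phi ->
  Heq (f phi) zeroH -> Heq phi zeroH.
Proof.
move=> Mf Nf H E.
have [L [HL EL]] := Lact_repr f Mf.
have [N EN] := Lact_coef L.
pose nz k := ~ forall z, UHP z -> coefL L k z = 0%C.
have [K [HK [nzK HK']]] : exists k, (k < N)%nat /\ nz k /\ forall j, (k < j < N)%nat -> ~ nz j.
  apply: nat_max_exists; apply: NNPP => X; apply: Nf => psi _ n z U.
  rewrite EL // EN /zeroOp /scalOp Cmult_0_l.
  have Z : forall k, (k < N)%nat -> coefL L k z = 0%C.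
    by move=> k Hk; apply: NNPP => Y; apply: X; exists k; split=> // W; apply: Y; apply: W.
  elim: {EN nz X} N Z => [//|M IH] Z /=; rewrite IH; last by move=> k Hk; apply: Z; lia.
  by rewrite Z; [ring | lia].
apply: NNPP => X.
pose nzphi n := ~ forall z, UHP z -> phi n z = 0%C.
have [m [Hm Hm']] : exists m, nzphi m /\ forall x, m < x -> ~ nzphi x.
  have [_ [S HS]] := H.
  apply: (list_max_exists _ S).
    by move=> x Hx; apply: NNPP => Y; apply: Hx; apply: HS.
  apply: NNPP => Y; apply: X => n z U; apply: NNPP => W; apply: Y; exists n => V; apply: W.
  exact: V.
(* In weight [m + INR K] only [k = K] survives: for larger [k] the coefficient vanishes, for smaller
   [k] the component of [phi] has weight above [m]. *)
have Z : forall z, UHP z -> (coefL L K z * phi m z)%C = 0%C.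
  move=> z U; have := E (m + INR K) z U; rewrite EL // EN (Csum_single _ N K) //.
    by have -> : m + INR K - INR K = m by ring.
  move=> k Hk Ek; case: (Nat.lt_ge_cases K k) => HkK.
    have -> : coefL L k z = 0%C.
      have := HK' k ltac:(lia) => /NNPP; by apply.
    ring.
  have -> : phi (m + INR K - INR k) z = 0%C.
    have lk : INR k < INR K by apply: lt_INR; lia.
    have := Hm' (m + INR K - INR k) ltac:(lra) => /NNPP; by apply.
  ring.
case: (hol_integral (coefL L K) (phi m)) => //.
- exact: hol_coefL.
- exact: inH_hol.
Qed.

Lemma inM_comm (f g : Op) : inM f -> inM g -> eqOp (mulOp f g) (mulOp g f).
Proof.
move=> Mf Mg phi _ n z U; rewrite /mulOp.
have [L [_ EL]] := Lact_repr f Mf; have [M [_ EM]] := Lact_repr g Mg.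
rewrite EL // EM //.
have ext : forall K (u v : gfun) n, (forall n, u n z = v n z) -> Lact K u n z = Lact K v n z.
  by move=> K u v n' X; elim: K => [//|kF K IH] /=; rewrite X IH.
rewrite (ext L _ (Lact M phi)); last by move=> k; rewrite EM.
rewrite (ext M _ (Lact L phi)); last by move=> k; rewrite EL.
exact: Lact_swap.
Qed.

(** A nonzero test vector, which shows that the identity operator is not zero on H. *)
Definition unitH : gfun := fun n z => match Req_EM_T n 0 with left _ => RtoC 1 | right _ => RtoC 0 end.

Lemma inH_unitH : inH unitH.
Proof.
split.
  by move=> n; apply/holo_hol; rewrite /unitH; case: Req_EM_T => _; apply: hol_const.
by exists [0] => n Hn z _; rewrite /unitH; case: Req_EM_T => [E|//]; case: Hn; left.
Qed.

Lemma scal1_neq_0 : ~ eqOp (scalOp 1) zeroOp.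
Proof.
move=> E; have U : UHP Ci by rewrite /UHP /=; lra.
have := E _ inH_unitH 0 Ci U; rewrite /zeroOp /scalOp /unitH.
case: Req_EM_T => // _; rewrite Cmult_0_l Cmult_1_l => X.
by have := f_equal Re X; rewrite /=; lra.
Qed.

Lemma inM_neq_0_mul (f g : Op) : inM f -> inM g -> ~ eqOp f zeroOp -> ~ eqOp g zeroOp ->
  ~ eqOp (mulOp f g) zeroOp.
Proof.
move=> Mf Mg Nf Ng E; apply: Ng => phi H n z U.
have Hg := inR_inH _ (inM_inR _ Mg) _ H.
have X : Heq (f (g phi)) zeroH.
  by move=> k w W; have := E phi H k w W; rewrite /mulOp /zeroOp /scalOp Cmult_0_l.
by rewrite (inM_torsion_free f _ Mf Nf Hg X) // /zeroOp /scalOp Cmult_0_l.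
Qed.

(** For the generators this is Leibniz' rule with the weight of the product split as (n - 6) + 4 or
    (n - 8) + 6, followed by Ramanujan's identity; it passes to sums and products because a
    commutator with [delta] is a derivation. *)
Lemma delta_inM (f : rop) : inM f -> exists f' : rop, inM f' /\ rdelta *' f == f *' rdelta +' f'.
Proof.
have D4 : exists f' : rop, inM f' /\ rdelta *' Rop e4 inR_e4 == Rop e4 inR_e4 *' rdelta +' f'.
  exists (rscal (- RtoC (1 / 3)) *' Rop e6 inR_e6); split.
    by apply: inM_mul; [apply: inM_scal | apply: inM_e6].
  move=> phi H n z U; rewrite /= /mulOp /addOp /scalOp /delta /e4 /e6 /Dk.
  rewrite dprime_mult //; [|exact: hol_Eis|exact: inH_hol].
  have -> : n - 4 - 2 = n - 6 by ring.
  have -> : n - 2 - 4 = n - 6 by ring.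
  have E := ramanujan_E4 z U.
  rewrite (Cmult_assoc (- RtoC (1 / 3))%C) -E.
  have -> : (n - 6) / 12 = (n - 2) / 12 - 4 / 12 by field.
  rewrite RtoC_minus; ring.
have D6 : exists f' : rop, inM f' /\ rdelta *' Rop e6 inR_e6 == Rop e6 inR_e6 *' rdelta +' f'.
  exists (rscal (- RtoC (1 / 2)) *' (Rop e4 inR_e4 *' Rop e4 inR_e4)); split.
    by apply: inM_mul; [apply: inM_scal | apply: inM_mul; apply: inM_e4].
  move=> phi H n z U; rewrite /= /mulOp /addOp /scalOp /delta /e4 /e6 /Dk.
  rewrite dprime_mult //; [|exact: hol_Eis|exact: inH_hol].
  have -> : n - 4 - 4 = n - 8 by ring.
  have -> : n - 2 - 6 = n - 8 by ring.
  have -> : n - 6 - 2 = n - 8 by ring.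
  have E := ramanujan_E6 z U.
  rewrite (Cmult_assoc (E4 z) (E4 z)) (Cmult_assoc (- RtoC (1 / 2))%C) -E.
  have -> : (n - 8) / 12 = (n - 2) / 12 - 6 / 12 by field.
  rewrite RtoC_minus; ring.
case: f => f Rf /= Mf.
(* The membership proof [Rf] is generalized, because the induction on [inM] has to choose its own
   proofs for the subterms. *)
suff : exists f' : rop, inM f' /\ forall Rf, rdelta *' Rop f Rf == Rop f Rf *' rdelta +' f'.
  by move=> [f' [H1 H2]]; exists f'.
elim: Mf => {Rf f} [||c|b c Mb [b' [Mb' Hb]] Mc [c' [Mc' Hc]]|b c Mb [b' [Mb' Hb]] Mc [c' [Mc' Hc]]].
- by have [f' [H1 H2]] := D4; exists f'.
- by have [f' [H1 H2]] := D6; exists f'.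
- exists (rscal 0); split; first exact: inM_scal.
  move=> Rf; rewrite radd0 => phi L; exact: (rscalC rdelta c phi L).
- exists (b' +' c'); split; first exact: inM_add.
  move=> Rf; set x := Rop b (inM_inR b Mb); set y := Rop c (inM_inR c Mc).
  transitivity (rdelta *' (x +' y)); first by [].
  rewrite rmulDr (Hb (inM_inR b Mb)) (Hc (inM_inR c Mc)).
  addring.
- exists (Rop b (inM_inR b Mb) *' c' +' b' *' Rop c (inM_inR c Mc)); split.
    by apply: inM_add; apply: inM_mul.
  move=> Rf; set x := Rop b (inM_inR b Mb); set y := Rop c (inM_inR c Mc).
  transitivity (rdelta *' x *' y); first by [].
  rewrite (Hb (inM_inR b Mb)) rmulDl -rmulA (Hc (inM_inR c Mc)) rmulDr.
  addring.
Qed.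

(** * Order in delta and pseudo-division *)

Fixpoint dpow (k : nat) : rop := match k with O => rscal 1 | S j => rdelta *' dpow j end.

(** Order in [delta] strictly below [k], as a filtration: the leading coefficient may be 0 and the
    expansion need not be unique. [ord 0] means zero. *)
Fixpoint ord (k : nat) (x : rop) : Prop :=
  match k with
  | O => x == rscal 0
  | S j => exists m y : rop, inM m /\ ord j y /\ x == m *' dpow j +' y
  end.

Lemma ord_ext (k : nat) (x y : rop) : x == y -> ord k x -> ord k y.
Proof.
case: k => [|k] E /=; first by rewrite E.
by move=> [m [u [H1 [H2 H3]]]]; exists m, u; rewrite -E.
Qed.

Lemma ord_0 (k : nat) : ord k (rscal 0).
Proof.
elim: k => [//|k IH] /=; exists (rscal 0), (rscal 0); split; first exact: inM_scal.
by split=> //; rewrite rmul0 radd0.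
Qed.

Lemma ord_S (k : nat) (x : rop) : ord k x -> ord (S k) x.
Proof.
move=> H; exists (rscal 0), x; split; first exact: inM_scal.
by split=> //; rewrite rmul0 radd0l.
Qed.

Lemma ord_le (j k : nat) (x : rop) : (j <= k)%nat -> ord j x -> ord k x.
Proof. by elim=> [//|n _ IH] H; apply: ord_S; apply: IH. Qed.

Lemma ord_add (k : nat) (x y : rop) : ord k x -> ord k y -> ord k (x +' y).
Proof.
elim: k x y => [|k IH] x y /=; first by move=> -> ->; rewrite radd0.
move=> [m [u [M1 [O1 E1]]]] [n [v [M2 [O2 E2]]]].
exists (m +' n), (u +' v); split; first exact: inM_add.
split; first exact: IH.
rewrite E1 E2 rmulDl; addring.
Qed.

Lemma ord_inM (k : nat) (m x : rop) : inM m -> ord k x -> ord k (m *' x).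
Proof.
move=> M; elim: k x => [|k IH] x /=; first by move=> ->; rewrite rmulr0.
move=> [n [u [N [O E]]]]; exists (m *' n), (m *' u); split; first exact: inM_mul.
by split; [apply: IH | rewrite E rmulDr rmulA].
Qed.

Lemma ord_monomial (k : nat) (m : rop) : inM m -> ord (S k) (m *' dpow k).
Proof.
move=> M; exists m, (rscal 0); split=> //; split; first exact: ord_0.
by rewrite radd0.
Qed.

Lemma delta_monomial (k : nat) (m : rop) : inM m ->
  exists m' : rop, inM m' /\ rdelta *' (m *' dpow k) == m *' dpow (S k) +' m' *' dpow k.
Proof.
move=> M; have [m' [M' E]] := delta_inM m M; exists m'; split=> //.
by rewrite rmulA E rmulDl.
Qed.

Lemma ord_delta (k : nat) (x : rop) : ord k x -> ord (S k) (rdelta *' x).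
Proof.
elim: k x => [|k IH] x.
  by move=> /= E; apply: ord_ext (ord_0 1); rewrite E rmulr0.
move=> [m [u [M [O E]]]].
have [m' [M' E']] := delta_monomial k m M.
exists m, (m' *' dpow k +' rdelta *' u); split=> //; split.
  by apply: ord_add; [apply: ord_monomial | apply: IH].
rewrite E rmulDr E'; addring.
Qed.

Lemma ord_mul (a : Op) : inR a -> forall (Ra : inR a) (k : nat) (y : rop), ord k y ->
  exists j, ord j (Rop a Ra *' y).
Proof.
elim=> [|||c|b c Rb Hb Rc Hc|b c Rb Hb Rc Hc] Ra k y O.
- by exists (S k); apply: ord_ext (ord_delta k y O).
- exists k; apply: (ord_inM k (Rop e4 Ra)) => //; exact: inM_e4.
- exists k; apply: (ord_inM k (Rop e6 Ra)) => //; exact: inM_e6.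
- exists k; apply: (ord_inM k (Rop (scalOp c) Ra)) => //; exact: inM_scal.
- have [j1 H1] := Hb Rb k y O; have [j2 H2] := Hc Rc k y O.
  exists (j1 + j2)%nat.
  apply: (ord_ext _ (Rop b Rb *' y +' Rop c Rc *' y)) => //.
  by apply: ord_add; [apply: ord_le H1 | apply: ord_le H2]; lia.
- have [j1 H1] := Hc Rc k y O; have [j2 H2] := Hb Rb j1 _ H1.
  by exists j2; apply: ord_ext H2.
Qed.

Lemma ord_exists (x : rop) : exists k, ord k x.
Proof.
have O1 : ord 1 (rscal 1).
  by apply: (ord_ext _ (rscal 1 *' dpow 0)); [exact: rmul1 | apply: ord_monomial; apply: inM_scal].
have [j H] := ord_mul x (opP x) (opP x) 1 (rscal 1) O1.
by exists j; apply: ord_ext H; case: x => a Ra /=; apply: rmulr1.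
Qed.

(** Moving [delta] past [m] costs only terms of lower order, so multiplication by powers of [delta]
    keeps the leading coefficient. *)
Lemma dpow_leading (n : nat) (x m x0 : rop) : inM m -> ord n x0 -> x == m *' dpow n +' x0 ->
  forall k, exists y, ord (k + n) y /\ dpow k *' x == m *' dpow (k + n) +' y.
Proof.
move=> M O E; elim=> [|k [y [Oy Ey]]].
  by exists x0; split=> //; rewrite rmul1.
have [m' [M' E']] := delta_monomial (k + n) m M.
exists (m' *' dpow (k + n) +' rdelta *' y); split.
  by apply: ord_add; [apply: ord_monomial | apply: ord_delta].
rewrite /= -rmulA Ey rmulDr E'; addring.
Qed.

Definition nonzero (x : rop) : Prop := ~ x == rscal 0.

(** Each step multiplies by the leading coefficient [m] of the divisor and lowers the order of the
    dividend by one. The multiplier stays nonzero because products of nonzero elements of M are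
    nonzero. *)
Lemma pseudo_division (n : nat) (x m x0 : rop) :
  inM m -> nonzero m -> ord n x0 -> x == m *' dpow n +' x0 ->
  forall k b, ord (k + n) b -> exists f r c : rop,
    inM f /\ nonzero f /\ ord n c /\ f *' b == r *' x +' c.
Proof.
move=> M N O E; elim=> [|k IH] b.
  move=> Ob; exists (rscal 1), (rscal 0), b; split; first exact: inM_scal.
  split; first exact: scal1_neq_0.
  by split=> //; rewrite rmul0 rmul1 radd0l.
move=> Ob; have [m' [b0 [M' [O' E']]]] :
  exists m' b0 : rop, inM m' /\ ord (k + n) b0 /\ b == m' *' dpow (k + n) +' b0 := Ob.
have [y [Oy Ey]] := dpow_leading n x m x0 M O E k.
(* This is [m b - m' delta^k x]: the leading terms cancel because [m] and [m'] commute. *)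
set b1 := m *' b0 +' rscal (-1) *' (m' *' y).
have Ob1 : ord (k + n) b1.
  apply: ord_add; first exact: ord_inM.
  by apply: ord_inM; [apply: inM_scal | apply: ord_inM].
have Eb : m *' b == m' *' (dpow k *' x) +' b1.
  rewrite E' Ey !rmulDr !rmulA.
  have -> : m *' m' == m' *' m by apply: inM_comm.
  rewrite /b1; addring.
have [f [r [c [Mf [Nf [Oc Ec]]]]]] := IH b1 Ob1.
exists (f *' m), (f *' m' *' dpow k +' r), c; split; first exact: inM_mul.
split; first exact: inM_neq_0_mul.
split=> //.
rewrite -rmulA Eb rmulDr Ec rmulDl !rmulA; addring.
Qed.

(** * The left ideals [a] and annihilators *)

Lemma bracketP (a b : rop) : bracket a b <->
  exists f r : rop, inM f /\ nonzero f /\ f *' b == r *' a.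
Proof.
split.
- move=> [_ [f [Mf [Nf [r [Rr E]]]]]].
  by exists (Rop f (inM_inR f Mf)), (Rop r Rr).
- move=> [f [r [Mf [Nf E]]]]; split; first exact: opP.
  by exists f; split=> //; split=> //; exists r; split; [apply: opP | exact: E].
Qed.

Lemma bracket_inR (a b : Op) : bracket a b -> inR b. Proof. by case. Qed.

(** The product of the two multipliers is a common one, as M is commutative and has no zero
    divisors. *)
Lemma bracket_add (a b c : rop) : bracket a b -> bracket a c -> bracket a (b +' c).
Proof.
move=> /bracketP [f [r [Mf [Nf Ef]]]] /bracketP [g [s [Mg [Ng Eg]]]].
apply/bracketP; exists (f *' g), (g *' r +' f *' s).
split; first exact: inM_mul.
split; first exact: inM_neq_0_mul.
rewrite rmulDr rmulDl -!rmulA -Ef -Eg !rmulA.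
by have -> : f *' g == g *' f by apply: inM_comm.
Qed.

Lemma bracket_inM (a m b : rop) : inM m -> bracket a b -> bracket a (m *' b).
Proof.
move=> M /bracketP [f [r [Mf [Nf Ef]]]].
apply/bracketP; exists f, (m *' r); split=> //; split=> //.
rewrite -rmulA -Ef !rmulA.
by have -> : f *' m == m *' f by apply: inM_comm.
Qed.

(* [f^2 delta b = (f delta - f') f b] with [f' = [delta, f]], which commutes with [f]. *)
Lemma bracket_delta (a b : rop) : bracket a b -> bracket a (rdelta *' b).
Proof.
move=> /bracketP [f [r [Mf [Nf Ef]]]].
have [f' [Mf' E']] := delta_inM f Mf.
apply/bracketP; exists (f *' f), (f *' rdelta *' r +' rscal (-1) *' (f' *' r)).
split; first exact: inM_mul.
split; first exact: inM_neq_0_mul.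
have -> : (f *' rdelta *' r +' rscal (-1) *' (f' *' r)) *' a ==
  f *' (rdelta *' f *' b) +' rscal (-1) *' (f' *' (f *' b)).
  by rewrite rmulDl -!rmulA Ef.
have -> : f' *' (f *' b) == f *' (f' *' b).
  rewrite !rmulA; by have -> : f' *' f == f *' f' by apply: inM_comm.
rewrite E' rmulDl rmulDr !rmulA; addring.
Qed.

Lemma bracket_ext (a b c : Op) : bracket a b -> inR c -> eqOp b c -> bracket a c.
Proof.
move=> [Rb [f [Mf [Nf [r [Rr E]]]]]] Rc Ebc; split=> //.
exists f; split=> //; split=> //; exists r; split=> //.
have X : Rop f (inM_inR f Mf) *' Rop c Rc == Rop f (inM_inR f Mf) *' Rop b Rb.
  by apply: rmul_proper => //; symmetry.
by move=> phi H; apply: Heq_trans (X phi H) (E phi H).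
Qed.

(** Induction on [r] reduces the Ore condition to the generators: [delta] is the only one that does
    not commute with the multiplier. *)
Lemma bracket_mul (r : Op) : inR r -> forall a b : rop, bracket a b -> bracket a (mulOp r b).
Proof.
elim=> [|||c|u v Ru Hu Rv Hv|u v Ru Hu Rv Hv] a b H.
- exact: (bracket_delta a b).
- exact: (bracket_inM a (Rop e4 inR_e4) b inM_e4).
- exact: (bracket_inM a (Rop e6 inR_e6) b inM_e6).
- exact: (bracket_inM a (rscal c) b (inM_scal c)).
- exact: (bracket_add a (Rop u Ru *' b) (Rop v Rv *' b) (Hu a b H) (Hv a b H)).
- exact: (Hu a (Rop v Rv *' b) (Hv a b H)).
Qed.

Lemma bracket_LeftIdeal (a : Op) : inR a -> LeftIdeal (bracket a).
Proof.
move=> Ra; set a' := Rop a Ra.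
split; first exact: bracket_inR.
split; first by move=> b c; apply: bracket_ext.
split.
  apply/(bracketP a' (rscal 0)); exists (rscal 1), (rscal 0); split; first exact: inM_scal.
  by split; [apply: scal1_neq_0 | rewrite rmul0 rmulr0].
split.
  move=> b c Hb Hc.
  exact: (bracket_add a' (Rop b (bracket_inR _ _ Hb)) (Rop c (bracket_inR _ _ Hc))).
move=> r b Rr Hb; exact: (bracket_mul r Rr a' (Rop b (bracket_inR _ _ Hb))).
Qed.

Lemma bracket_0 (b : rop) : b == rscal 0 -> forall a : rop, bracket a b.
Proof.
move=> E a; apply/bracketP; exists (rscal 1), (rscal 0); split; first exact: inM_scal.
by split; [apply: scal1_neq_0 | rewrite E rmul0 rmulr0].
Qed.

Lemma minimal_nat (P : nat -> Prop) : (exists n, P n) -> exists n, P n /\ forall k, (k < n)%nat -> ~ P k.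
Proof.
move=> [n]; elim/(well_founded_induction Nat.lt_wf_0): n => n IH Pn.
case: (classic (exists k, (k < n)%nat /\ P k)) => [[k [Hk Pk]]|N]; first exact: IH Hk Pk.
by exists n; split=> // k Hk Pk; apply: N; exists k.
Qed.

(* A nonzero element of minimal order pseudo-divides every element of the ideal exactly. *)
Lemma LeftIdeal_bracket (I : Op -> Prop) : LeftIdeal I ->
  exists a, I a /\ (forall r, inR r -> I (mulOp r a)) /\ (forall b, I b -> bracket a b).
Proof.
move=> [IR [Iext [I0 [Iadd Imul]]]].
(* The zero ideal has no nonzero element of least order; it is generated by [zeroOp]. *)
case: (classic (exists x : rop, I x /\ nonzero x)) => [[x0 [Ix0 Nx0]]|Z]; last first.
  exists zeroOp; split=> //; split; first by move=> r Rr; apply: Imul.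
  move=> b Ib; apply: (bracket_0 (Rop b (IR b Ib)) _ (rscal 0)).
  by apply: NNPP => N; apply: Z; exists (Rop b (IR b Ib)).
have [|n [[x [Ix [Nx Ox]]] Hmin]] := minimal_nat (fun n => exists x : rop, I x /\ nonzero x /\ ord n x).
  by have [k Hk] := ord_exists x0; exists k, x0.
case: n Ox Hmin => [|n] Ox Hmin; first by case: (Nx Ox).
have [m [y [M [Oy E]]]] := Ox.
(* If [m] were zero, [x] would equal [y], whose order is smaller. *)
have Nm : nonzero m.
  move=> Em; apply: (Hmin n); first lia.
  exists x; split=> //; split=> //; apply: ord_ext Oy.
  by rewrite E Em rmul0 radd0l.
exists x; split=> //; split; first by move=> r Rr; apply: Imul.
move=> b Ib; set b' := Rop b (IR b Ib).
have [k Ok] := ord_exists b'.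
have Okn : ord (k + n) b' by apply: ord_le Ok; lia.
have [f [r [c [Mf [Nf [Oc Ec]]]]]] := pseudo_division n x m y M Nm Oy E k b' Okn.
apply/(bracketP x b'); exists f, r; split=> //; split=> //.
(* The remainder [c = f b - r x] lies in [I] and its order is below the minimal one. *)
suff : c == rscal 0 by move=> Z; rewrite Ec Z radd0.
apply: NNPP => Nc; apply: (Hmin n); first lia.
exists c; split=> //.
apply: (Iext (f *' b' +' rscal (-1) *' (r *' x))); last 1 first.
- change (f *' b' +' rscal (-1) *' (r *' x) == c); rewrite Ec; addring.
- apply: Iadd; first by apply: Imul => //; apply: opP.
  by apply: (Imul); [apply: inR_scal | apply: Imul => //; apply: opP].
- exact: opP.
Qed.

Lemma ann_LeftIdeal (phi : gfun) : inH phi -> LeftIdeal (ann phi).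
Proof.
move=> H; have H0 : inH zeroH.
  by split; [move=> n; apply/holo_hol; apply: hol_const | exists []].
split; first by move=> a [].
split.
  move=> a b [Ra Ea] Rb E; split=> //.
  exact: Heq_trans (Heq_sym _ _ (E phi H)) Ea.
split.
  by split; [apply: inR_scal | move=> n z U; rewrite /zeroOp /scalOp Cmult_0_l].
split.
  move=> a b [Ra Ea] [Rb Eb]; split; first exact: inR_add.
  by move=> n z U; rewrite /addOp Ea // Eb // Cplus_0_l.
move=> r a Rr [Ra Ea]; split; first exact: inR_mul.
apply: (Heq_trans _ (r zeroH)).
  by apply: (inR_Heq r Rr) => //; apply: inR_inH.
move=> n z U.
(* That [r] sends 0 to 0 follows from its homogeneity applied to the scalar 0. *)
have -> : zeroH n z = scalOp 0 (r zeroH) n z by rewrite /scalOp Cmult_0_l.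
rewrite -(inR_scalH r Rr 0%C zeroH H0) //.
apply: (inR_Heq r Rr) => //; first exact: inH_scal.
by move=> k w W; rewrite /scalOp Cmult_0_l.
Qed.

Lemma ann_bracket (phi : gfun) : inH phi -> exists a, inR a /\ forall b, ann phi b <-> bracket a b.
Proof.
move=> H; have [a [[Ra Ea] [_ Ha]]] := LeftIdeal_bracket (ann phi) (ann_LeftIdeal phi H).
exists a; split=> // b; split; first exact: Ha.
move=> [Rb [f [Mf [Nf [r [Rr E]]]]]]; split=> //.
apply: (inM_torsion_free f) => //; first exact: inR_inH.
apply: Heq_trans (E phi H) _.
have [_ [_ [_ [_ K]]]] := ann_LeftIdeal phi H.
by have [_] := K r a Rr (conj Ra Ea).
Qed.

Theorem theorem7p3 :
  (forall a, inR a -> LeftIdeal (bracket a)) /\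
  (forall I, LeftIdeal I ->
     exists a, I a /\ (forall r, inR r -> I (mulOp r a)) /\
               (forall b, I b -> bracket a b)) /\
  (forall phi, inH phi ->
     exists a, inR a /\ forall b, ann phi b <-> bracket a b).
Proof.
split; first exact: bracket_LeftIdeal.
split; [exact: LeftIdeal_bracket | exact: ann_bracket].
Qed.
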